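(* Let $\pi$ be an exterior order-$q$-subplane of $\mathrm{PG}(2,q^3)$ with conic cover $\mathbb C$. Then every $(\pi,\ell_\infty)$-special conic of $\pi$ corresponds in $\mathrm{PG}(6,q)$ to a $\mathbb C$-special twisted cubic.
   Context: Bruck-Bose representation. $q$ is a prime power. $\Sigma_\infty\cong\mathrm{PG}(5,q)$ is a hyperplane of $\mathrm{PG}(6,q)$ and $\mathcal S$ is a regular $2$-spread of $\Sigma_\infty$: a set of $q^3+1$ planes partitioning the points of $\Sigma_\infty$ and containing the $2$-regulus through any three of its planes. (A $2$-regulus is a set of $q+1$ mutually disjoint planes such that any line meeting three of them meets all.) The points of $\mathrm{PG}(6,q)\setminus\Sigma_\infty$, together with the $3$-spaces not in $\Sigma_\infty$ that contain a plane of $\mathcal S$ as lines, form an affine plane whose projective completion $\mathcal P(\mathcal S)$ is $\mathrm{PG}(2,q^3)$; points of the line at infinity $\ell_\infty$ correspond to planes of $\mathcal S$. For a set $X$ of points of $\mathrm{PG}(2,q^3)$, $[X]$ is the corresponding set in $\mathrm{PG}(6,q)$. A twisted cubic is a normal rational curve of order 3 in a 3-space; curves defined over $\mathbb F_q$ are extended to $\mathbb F_{q^3}$ by the same parametrisation. Subplanes and splashes. An order-$q$-subplane of $\mathrm{PG}(2,q^3)$ is an image of $\mathrm{PG}(2,q)$ under $\mathrm{PGL}(3,q^3)$; it is exterior if it has no point on $\ell_\infty$. The exterior splash $\mathbb S$ of an exterior order-$q$-subplane $\pi$ is the set of $q^2+q+1$ points of $\ell_\infty$ lying on extended lines of $\pi$;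 it is identified with the corresponding set of $q^2+q+1$ planes of $\mathcal S$. Special conics. Let $m,n$ be the two conjugates of $\ell_\infty$ with respect to $\pi$ (if $\pi=\phi(\mathrm{PG}(2,q))$, conjugation is $\phi\circ\mathrm{Frob}_q\circ\phi^{-1}$) and $E_1=\ell_\infty\cap m$, $E_2=\ell_\infty\cap n$, $E_3=m\cap n$. A $(\pi,\ell_\infty)$-special conic is a conic of $\pi$ (given by a quadratic equation over $\mathbb F_q$ in coordinates in which $\pi=\mathrm{PG}(2,q)$) whose extension to $\mathrm{PG}(2,q^3)$ (same equation) contains $E_1,E_2,E_3$. Covers. $\mathbb S$ has exactly two covers: sets of $q^2+q+1$ mutually disjoint planes of $\Sigma_\infty$ covering the same points as the planes of $\mathbb S$ and each meeting every plane of $\mathbb S$ in exactly one point. Planes from different covers meet in exactly one point. Each cover $\mathbb X$ has exactly three transversal lines: lines $g,g^q,g^{q^2}$ of the cubic extension $\mathrm{PG}(5,q^3)$ of $\Sigma_\infty$, conjugate under the $q$-Frobenius map and disjoint from $\Sigma_\infty$, that meet the extension of every plane of $\mathbb X$. Tangent and conic cover. For a line $\ell$ of $\pi$, $[\ell]$ (the $q+1$ points of $\pi$ on $\ell$) is a twisted cubic. For $P\in\pi$, the $q+1$ tangent lines at $P$ to the twisted cubics $[\ell]$, $\ell$ a line of $\pi$ through $P$, lie in a plane $\mathcal T_P$, and the line $\mathcal T_P\cap\Sigma_\infty$ lies in a plane of one of the two covers, the same cover for every $P\in\pi$. This cover is the tangent cover $\mathbb T$ of $\pi$; the other one is the conic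 cover $\mathbb C$ of $\pi$. Special twisted cubics. For a cover $\mathbb X$ of an exterior splash, an $\mathbb X$-special twisted cubic is a twisted cubic $\mathcal N$ in a $3$-space of $\mathrm{PG}(6,q)$, not contained in $\Sigma_\infty$, through a plane of $\mathbb X$, such that the extension of $\mathcal N$ to $\mathrm{PG}(6,q^3)$ meets the three transversal lines of $\mathbb X$. *)

(* Defs.v *)
From HB Require Import structures.
From mathcomp Require Import all_boot all_order all_algebra all_field.
From mathcomp Require Import boolp classical_sets functions cardinality.

Set Implicit Arguments.
Unset Strict Implicit.
Unset Printing Implicit Defensive.

Import GRing.Theory.
Local Open Scope classical_set_scope.
Local Open Scope card_scope.
Local Open Scope ring_scope.

(* PG(n-1, K) is the lattice of subspaces of 'rV[K]_n; \dim is the vector-space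
   dimension, one more than the projective dimension. *)
Definition points (K : fieldType) (n : nat) : set {vspace 'rV[K]_n} :=
  [set U | \dim U = 1%N].
Definition lines (K : fieldType) (n : nat) : set {vspace 'rV[K]_n} :=
  [set U | \dim U = 2%N].
Definition planes (K : fieldType) (n : nat) : set {vspace 'rV[K]_n} :=
  [set U | \dim U = 3%N].
Definition solids (K : fieldType) (n : nat) : set {vspace 'rV[K]_n} :=
  [set U | \dim U = 4%N].
Definition hyperplanes (K : fieldType) (n : nat) : set {vspace 'rV[K]_n} :=
  [set U | (\dim U).+1 = n].

Arguments points {K n}.
Arguments lines {K n}.
Arguments planes {K n}.
Arguments solids {K n}.
Arguments hyperplanes {K n}.

Definition meets (K : fieldType) (n : nat) (U V : {vspace 'rV[K]_n}) : Prop :=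
  (U :&: V)%VS <> 0%VS.

(* The subspace spanned by the entrywise image of U; for a field morphism f this
   span does not depend on the basis of U. *)
Definition map_vs (K K' : fieldType) (n : nat) (f : K -> K')
    (U : {vspace 'rV[K]_n}) : {vspace 'rV[K']_n} :=
  <<[seq map_mx f u | u <- vbasis U]>>%VS.

Definition ext (F : finFieldType) (L : fieldExtType F) (n : nat)
    (U : {vspace 'rV[F]_n}) : {vspace 'rV[L]_n} :=
  map_vs (in_alg L) U.

Definition frob (F : finFieldType) (L : fieldExtType F) (n : nat)
    (U : {vspace 'rV[L]_n}) : {vspace 'rV[L]_n} :=
  map_vs (fun x : L => x ^+ #|F|) U.

Arguments ext {F} L {n} U.

Definition is_regulus2 (F : finFieldType) (n : nat)
    (R : set {vspace 'rV[F]_n}) : Prop :=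
  [/\ R #= `I_(#|F|.+1),
      R `<=` planes,
      forall A B, R A -> R B -> A <> B -> (A :&: B)%VS = 0%VS
    & forall l A B D, lines l -> R A -> R B -> R D ->
        A <> B -> A <> D -> B <> D ->
        meets l A -> meets l B -> meets l D ->
        forall E, R E -> meets l E].

Record regular_spread (F : finFieldType) (n : nat) (Sinf : {vspace 'rV[F]_n})
    (S : set {vspace 'rV[F]_n}) : Prop := RegularSpread {
  spread_card : S #= `I_((#|F| ^ 3).+1);
  spread_planes : forall A, S A -> planes A /\ (A <= Sinf)%VS;
  spread_partition : forall P, points P -> (P <= Sinf)%VS ->
    exists! A, S A /\ (P <= A)%VS;
  spread_regular : forall A B D, S A -> S B -> S D ->
    A <> B -> A <> D -> B <> D ->
    exists R, [/\ is_regulus2 R, R A, R B, R D & R `<=` S]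
}.

(* The lines of the affine plane of the Bruck-Bose representation. *)
Definition bb_lines (F : finFieldType) (n : nat) (Sinf : {vspace 'rV[F]_n})
    (S : set {vspace 'rV[F]_n}) : set {vspace 'rV[F]_n} :=
  [set U | [/\ solids U, ~ (U <= Sinf)%VS & exists2 A, S A & (A <= U)%VS]].

(* bb, restricted to points, is an isomorphism from PG(2, L) onto P(S) taking
   linf to the line at infinity.  The points of P(S) are the points off Sinf and
   the elements of S, so incidence with an element of bb_lines is inclusion for
   both kinds of points.  The value of bb on non-points is irrelevant. *)
Record bruck_bose (F : finFieldType) (L : fieldExtType F)
    (linf : {vspace 'rV[L]_3}) (Sinf : {vspace 'rV[F]_7})
    (S : set {vspace 'rV[F]_7})
    (bb : {vspace 'rV[L]_3} -> {vspace 'rV[F]_7}) : Prop := BruckBose {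
  bb_affine : set_bij [set P | points P /\ ~ (P <= linf)%VS]
                      [set P | points P /\ ~ (P <= Sinf)%VS] bb;
  bb_infinity : set_bij [set P | points P /\ (P <= linf)%VS] S bb;
  bb_line : forall m, lines m -> m <> linf ->
    exists2 U, bb_lines Sinf S U &
      forall P, points P -> ((P <= m)%VS <-> (bb P <= U)%VS);
  bb_lineV : forall U, bb_lines Sinf S U ->
    exists m, [/\ lines m, m <> linf &
      forall P, points P -> ((P <= m)%VS <-> (bb P <= U)%VS)]
}.

(* [X], for a set X of points of PG(2, L). *)
Definition bb_set (F : finFieldType) (L : fieldExtType F)
    (bb : {vspace 'rV[L]_3} -> {vspace 'rV[F]_7})
    (X : set {vspace 'rV[L]_3}) : set {vspace 'rV[F]_7} :=
  [set P | points P /\ exists2 Q, X Q & (P <= bb Q)%VS].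

(* The action of the collineation v |-> v *m A on subspaces. *)
Definition pgl_act (K : fieldType) (n : nat) (A : 'M[K]_n)
    (U : {vspace 'rV[K]_n}) : {vspace 'rV[K]_n} :=
  (linfun (mulmxr A) @: U)%VS.

Definition subplane_of (F : finFieldType) (L : fieldExtType F) (A : 'M[L]_3) :
    set {vspace 'rV[L]_3} :=
  [set pgl_act A (ext L P) | P in (points : set {vspace 'rV[F]_3})].

Definition order_q_subplane (F : finFieldType) (L : fieldExtType F)
    (pi : set {vspace 'rV[L]_3}) : Prop :=
  exists2 A : 'M[L]_3, A \in unitmx & pi = subplane_of A.

Definition exterior (K : fieldType) (pi : set {vspace 'rV[K]_3})
    (linf : {vspace 'rV[K]_3}) : Prop :=
  forall P, pi P -> ~ (P <= linf)%VS.

(* The extended lines of pi; the corresponding line of pi is [subline pi m]. *)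
Definition extended_line (K : fieldType) (pi : set {vspace 'rV[K]_3})
    (m : {vspace 'rV[K]_3}) : Prop :=
  lines m /\ exists P Q, [/\ pi P, pi Q, P <> Q, (P <= m)%VS & (Q <= m)%VS].

Definition subline (K : fieldType) (pi : set {vspace 'rV[K]_3})
    (m : {vspace 'rV[K]_3}) : set {vspace 'rV[K]_3} :=
  [set P | pi P /\ (P <= m)%VS].

Definition splash (K : fieldType) (pi : set {vspace 'rV[K]_3})
    (linf : {vspace 'rV[K]_3}) : set {vspace 'rV[K]_3} :=
  [set P | [/\ points P, (P <= linf)%VS
             & exists2 m, extended_line pi m & (P <= m)%VS]].

(* phi o Frob_q o phi^-1, where phi is v |-> v *m A. *)
Definition conjugate (F : finFieldType) (L : fieldExtType F) (A : 'M[L]_3)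
    (U : {vspace 'rV[L]_3}) : {vspace 'rV[L]_3} :=
  pgl_act A (frob (pgl_act (invmx A) U)).

(* The quadratic form \sum_(i, j) M i j x_i x_j. *)
Definition qform (K : fieldType) (M : 'M[K]_3) (v : 'rV[K]_3) : K :=
  (v *m M *m v^T) 0 0.

(* Valid in every characteristic: no nonzero singular vector lies in the
   radical of the polar form. *)
Definition nonsingular_qform (K : fieldType) (M : 'M[K]_3) : Prop :=
  forall v, qform M v = 0 ->
    (forall w, qform M (v + w) = qform M v + qform M w) -> v = 0.

Definition qform_points (K : fieldType) (M : 'M[K]_3) :
    set {vspace 'rV[K]_3} :=
  [set P | points P /\ forall v, v \in P -> qform M v = 0].

Definition special_conic (F : finFieldType) (L : fieldExtType F)
    (pi : set {vspace 'rV[L]_3}) (linf : {vspace 'rV[L]_3})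
    (C : set {vspace 'rV[L]_3}) : Prop :=
  exists A : 'M[L]_3, exists M : 'M[F]_3,
    [/\ A \in unitmx, pi = subplane_of A, nonsingular_qform M,
        C = [set pgl_act A (ext L P) | P in qform_points M]
      & let Cext := [set pgl_act A P | P in qform_points (map_mx (in_alg L) M)] in
        let m := conjugate A linf in
        let n := conjugate A m in
        [/\ Cext (linf :&: m)%VS, Cext (linf :&: n)%VS & Cext (m :&: n)%VS]].

(* A twisted cubic is given by a matrix B of rank 4: it is the image under
   w |-> w *m B of {(s^3, s^2 t, s t^2, t^3)}.  Its extension is given by the
   same matrix over the larger field. *)
Definition moment (K : fieldType) (s t : K) : 'rV[K]_4 :=
  \row_i (s ^+ (3 - i) * t ^+ i).
Definition moment_ds (K : fieldType) (s t : K) : 'rV[K]_4 :=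
  \row_i ((3 - i)%:R * s ^+ (2 - i) * t ^+ i).
Definition moment_dt (K : fieldType) (s t : K) : 'rV[K]_4 :=
  \row_i (i%:R * s ^+ (3 - i) * t ^+ (i - 1)).

Definition is_twisted_cubic (K : fieldType) (n : nat) (B : 'M[K]_(4, n)) : Prop :=
  row_free B.

Definition cubic_solid (K : fieldType) (n : nat) (B : 'M[K]_(4, n)) :
    {vspace 'rV[K]_n} :=
  <<[seq row i B | i : 'I_4]>>%VS.

Definition cubic_point (K : fieldType) (n : nat) (B : 'M[K]_(4, n)) (s t : K) :
    {vspace 'rV[K]_n} :=
  <[moment s t *m B]>%VS.

Definition cubic_points (K : fieldType) (n : nat) (B : 'M[K]_(4, n)) :
    set {vspace 'rV[K]_n} :=
  [set P | exists s t, (s, t) <> (0, 0) /\ P = cubic_point B s t].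

(* In characteristic 3 the two partial derivatives alone need not span the
   tangent line, hence the first vector. *)
Definition cubic_tangent (K : fieldType) (n : nat) (B : 'M[K]_(4, n)) (s t : K) :
    {vspace 'rV[K]_n} :=
  <<[:: moment s t *m B; moment_ds s t *m B; moment_dt s t *m B]>>%VS.

Definition tangent_at (K : fieldType) (n : nat) (B : 'M[K]_(4, n))
    (P : {vspace 'rV[K]_n}) : set {vspace 'rV[K]_n} :=
  [set l | exists s t, [/\ (s, t) <> (0, 0), P = cubic_point B s t
                         & l = cubic_tangent B s t]].

Definition transversal_line (F : finFieldType) (L : fieldExtType F) (n : nat)
    (Sinf : {vspace 'rV[F]_n}) (X : set {vspace 'rV[F]_n})
    (g : {vspace 'rV[L]_n}) : Prop :=
  [/\ lines g, (g <= ext L Sinf)%VS,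
      forall P, points P -> (P <= Sinf)%VS -> ~ (ext L P <= g)%VS
    & forall A, X A -> meets g (ext L A)].

Definition special_twisted_cubic (F : finFieldType) (L : fieldExtType F)
    (n : nat) (Sinf : {vspace 'rV[F]_n}) (X : set {vspace 'rV[F]_n})
    (B : 'M[F]_(4, n)) : Prop :=
  [/\ is_twisted_cubic B, ~ (cubic_solid B <= Sinf)%VS,
      exists2 A, X A & (A <= cubic_solid B)%VS
    & exists g : {vspace 'rV[L]_n}, forall i : 'I_3,
        transversal_line Sinf X (iter i (@frob F L n) g) /\
        exists2 P, cubic_points (map_mx (in_alg L) B) P &
                   (P <= iter i (@frob F L n) g)%VS].

Arguments special_twisted_cubic {F} L {n} Sinf X B.

Definition is_cover (F : finFieldType) (n : nat) (Sinf : {vspace 'rV[F]_n})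
    (Spl X : set {vspace 'rV[F]_n}) : Prop :=
  [/\ X #= `I_(#|F| ^ 2 + #|F| + 1)%N,
      forall A, X A -> planes A /\ (A <= Sinf)%VS,
      forall A B, X A -> X B -> A <> B -> (A :&: B)%VS = 0%VS,
      forall P, points P ->
        ((exists2 A, X A & (P <= A)%VS) <-> (exists2 A, Spl A & (P <= A)%VS))
    & forall A B, X A -> Spl B -> points (A :&: B)%VS].

(* B is the twisted cubic [l], for l the line of pi on m.  If q >= 5 it is
   determined by its q + 1 points.  For smaller q it is not, and [l] denotes the
   cubic that is also special with respect to the spread S, i.e. whose extension
   meets the transversal lines of S; for q >= 5 this condition is automatic. *)
Definition subline_cubic (F : finFieldType) (L : fieldExtType F)
    (Sinf : {vspace 'rV[F]_7}) (S : set {vspace 'rV[F]_7})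
    (bb : {vspace 'rV[L]_3} -> {vspace 'rV[F]_7}) (pi : set {vspace 'rV[L]_3})
    (m : {vspace 'rV[L]_3}) (B : 'M[F]_(4, 7)) : Prop :=
  special_twisted_cubic L Sinf S B /\ cubic_points B = bb_set bb (subline pi m).

(* T is the plane T_P, for P a point of pi. *)
Definition tangent_plane (F : finFieldType) (L : fieldExtType F)
    (Sinf : {vspace 'rV[F]_7}) (S : set {vspace 'rV[F]_7})
    (bb : {vspace 'rV[L]_3} -> {vspace 'rV[F]_7}) (pi : set {vspace 'rV[L]_3})
    (P : {vspace 'rV[L]_3}) (T : {vspace 'rV[F]_7}) : Prop :=
  planes T /\
  forall m B l, extended_line pi m -> (P <= m)%VS ->
    subline_cubic Sinf S bb pi m B -> tangent_at B (bb P) l -> (l <= T)%VS.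

Definition tangent_cover (F : finFieldType) (L : fieldExtType F)
    (linf : {vspace 'rV[L]_3}) (Sinf : {vspace 'rV[F]_7})
    (S : set {vspace 'rV[F]_7})
    (bb : {vspace 'rV[L]_3} -> {vspace 'rV[F]_7}) (pi : set {vspace 'rV[L]_3})
    (X : set {vspace 'rV[F]_7}) : Prop :=
  is_cover Sinf (bb @` splash pi linf) X /\
  forall P, pi P -> exists2 T, tangent_plane Sinf S bb pi P T &
    exists2 A, X A & (T :&: Sinf <= A)%VS.

Definition conic_cover (F : finFieldType) (L : fieldExtType F)
    (linf : {vspace 'rV[L]_3}) (Sinf : {vspace 'rV[F]_7})
    (S : set {vspace 'rV[F]_7})
    (bb : {vspace 'rV[L]_3} -> {vspace 'rV[F]_7}) (pi : set {vspace 'rV[L]_3})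
    (X : set {vspace 'rV[F]_7}) : Prop :=
  is_cover Sinf (bb @` splash pi linf) X /\
  exists2 T, tangent_cover linf Sinf S bb pi T & X <> T.

(* Main.v *)
(* Write x_i for x^(q^i).  Choose linear coordinates on L^3 in which pi is the set
   of points (x_0, x_1, x_2), x in L, and linf is the first coordinate line; its
   conjugates are then the other two coordinate lines.  Parallelograms show that
   bb is additive in the affine coordinates, and the homotheties of AG(6, q) make
   it semilinear over an automorphism of F, which extends to L.  Hence affine
   points become p0 + e (x_1/x_0, x_2/x_0) with e : L x L -> Sinf an F-linear
   bijection, S consists of the graphs y = c x and of x = 0, and the splash of the
   graphs y = - u x with u of norm 1.

   A cover consists of graphs of F-linear maps x |-> - (a x + b x_1 + c x_2) such
   that a + b z + c z^(q+1) permutes the norm 1 elements z.  Power sums of degrees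
   1 and q + 1 give a = 0 and b c = 0, so the covers are {y = - u x_1} and
   {y = - u x_2}.  The tangent at x = 1 towards d meets Sinf in
   e (d_1 - d_0, d_2 - d_0), which rules out the first one as tangent cover.

   A special conic has equation Tr (r / x) = 0, so that x = 1 / y with y in the
   F-plane Tr (r y) = 0 with basis x1, x2.  Clearing denominators turns it into the
   cubic N(y) p0 + e (y_0^2 y_2, y_0^2 y_1), which at infinity lies in the plane
   y = - (r_1/r_0) x_1, and which over L meets the transversals where y_i = 0. *)
Require Import Defs.
From HB Require Import structures.
From mathcomp Require Import all_boot all_order all_algebra all_solvable all_field.
From mathcomp Require Import boolp classical_sets functions cardinality.
From mathcomp Require Import ring zify.

Set Implicit Arguments.
Unset Strict Implicit.
Unset Printing Implicit Defensive.

Import GRing.Theory.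
Local Open Scope classical_set_scope.
Local Open Scope ring_scope.

(** * The cubic extension L / F *)

(** The conic cover is only given as a cover different from the tangent cover, so no direct
    description of it is available: all covers are classified, and the tangent cover is excluded
    from one of the two types. Transversal lines and extended cubics live over L. There e is
    diagonalised as sum_i (x_i G_i + y_i H_i), with independent vectors permuted cyclically by
    Frobenius. Each transversal line is then spanned by one G and one H, and lying on it means that
    the other coordinates vanish. The coordinates of a point of an extended cubic are products of
    three of the conjugates l_0, l_1, l_2 of the form s x1 + t x2, so at the zero of a suitable l_r
    only two of them survive. For small q a cubic is not determined by its q + 1 points. Cubics are
    therefore given by matrices, and a coefficient vector w is treated as a functional on binary
    cubic forms. Rank 4 and the plane at infinity then follow from linear relations between l_0, l_1
    and l_2, in all characteristics at once. *)

Section CubicExtension.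
Variables (F : finFieldType) (L : fieldExtType F).

Local Notation q := #|F|%N.

(** The index lives in ['I_3], whose addition is modulo 3, so that conjugations compose by adding
    indices. *)
Definition cj (i : 'I_3) (x : L) : L := x ^+ (q ^ i).

Fact cj_is_zmod_morphism i : zmod_morphism (cj i).
Proof.
have [p p_pr pF] := finPcharP F.
have pL : p \in [pchar L] by rewrite (pchar_lalg L).
have qE : q = (p ^ logn p q)%N := card_pprimeChar pF.
have pnat : ([pchar L]).-nat (q ^ i)%N.
  by rewrite qE -expnM pnatX (eq_pnat _ (pcharf_eq pL)) pnat_id ?p_pr.
by move=> x y; have := exprDn_pchar (x - y) y pnat; rewrite subrK /cj => ->; rewrite addrK.
Qed.
HB.instance Definition _ i :=
  GRing.isZmodMorphism.Build L L (cj i) (cj_is_zmod_morphism i).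

Fact cj_is_monoid_morphism i : monoid_morphism (cj i).
Proof. by split=> [|x y]; rewrite /cj ?expr1n ?exprMn. Qed.
HB.instance Definition _ i :=
  GRing.isMonoidMorphism.Build L L (cj i) (cj_is_monoid_morphism i).

Lemma card_gt1 : (1 < q)%N. Proof. exact: finNzRing_gt1. Qed.

Lemma cj_alg i (c : F) : cj i c%:A = c%:A.
Proof.
suff: cj i (in_alg L c) = in_alg L c by [].
rewrite /cj -rmorphXn /=; congr (_%:A).
by elim: (i : nat) => // n IHn; rewrite expnS exprM expf_card.
Qed.

Lemma cj0 x : cj 0 x = x. Proof. by rewrite /cj expn0 expr1. Qed.

Lemma cj1E x : cj 1 x = x ^+ q. Proof. by rewrite /cj expn1. Qed.

Lemma cj_eq0 i x : (cj i x == 0) = (x == 0).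
Proof. exact: fmorph_eq0. Qed.

Lemma cj_fixed x : cj 1 x = x -> exists c : F, x = c%:A.
Proof.
rewrite cj1E => /eqP xq; have: x \in 1%VS.
  by rewrite (Fermat's_little_theorem 1%AS) dimv1 expn1.
by case/vlineP=> c ->; exists c.
Qed.

Lemma cjZ i (c : F) x : cj i (c *: x) = c *: cj i x.
Proof. by rewrite -mulr_algl rmorphM /= cj_alg mulr_algl. Qed.

Hypothesis hL : \dim {:L} = 3%N.

Lemma expr_card3 (x : L) : x ^+ (q ^ 3) = x.
Proof.
by apply/eqP; rewrite -hL -(Fermat's_little_theorem {:L}%AS) memvf.
Qed.

Lemma cjD i j x : cj i (cj j x) = cj (i + j) x.
Proof.
rewrite /cj -exprM -expnD [(j + i)%N]addnC /=.
have [lt3|ge3] := ltnP (i + j) 3; first by rewrite modn_small.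
have /modn_small m3 : (i + j - 3 < 3)%N by have := ltn_ord i; have := ltn_ord j; lia.
by rewrite -{1}(subnK ge3) expnD mulnC exprM expr_card3 -{2}(subnK ge3) modnDr m3.
Qed.

Lemma enumL : exists rs : seq L, uniq rs /\ size rs = (q ^ 3)%N.
Proof.
exists (enum {: finvect_type L}); split; first exact: enum_uniq.
transitivity #|finvect_type L|; first by rewrite cardE.
have := card_vspace (fullv : {vspace finvect_type L}).
rewrite (_ : \dim _ = 3%N) // => <-.
by apply: eq_card => x; rewrite memvf.
Qed.

Lemma prim_rootL : exists w : L, (q ^ 3).-1.-primitive_root w.
Proof.
have [rs [urs srs]] := enumL; have q1 := card_gt1.
have q3 : (1 < q ^ 3)%N by rewrite -{1}(exp1n 3) ltn_exp2r.
have: has (q ^ 3).-1.-primitive_root (filter (predC1 0) rs).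
  apply: has_prim_root; first by rewrite -ltnS prednK // ltnW.
  - apply/allP=> x; rewrite mem_filter /= => /andP[x0 _]; apply/unity_rootP.
    by apply: (mulIf x0); rewrite -exprSr prednK ?expr_card3 ?mul1r // ltnW.
  - exact: filter_uniq.
  rewrite size_filter; have := count_predC (pred1 0) rs.
  rewrite srs (count_uniq_mem 0 urs); move: (_ ^ 3)%N => Q.
  case: (0 \in rs) => /= <-; rewrite ?add0n ?add1n.
    exact: leqnn.
  exact: leq_pred.
by case/hasP=> w _; exists w.
Qed.

(* The distinct exponents are smaller than the number of elements of L. *)
Lemma cj_free (c : 'I_3 -> L) :
  (forall x, \sum_i c i * cj i x = 0) -> forall i, c i = 0.
Proof.
move=> c0; have q1 := card_gt1.
pose p : {poly L} := \sum_i c i *: 'X^(q ^ i).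
have [rs [urs srs]] := enumL.
have p0 : p = 0.
  apply/eqP/negPn/negP=> pn0.
  have rp : all (root p) rs.
    apply/allP=> x _; rewrite /root /p horner_sum -[X in _ == X](c0 x).
    by apply/eqP/eq_bigr=> i _; rewrite hornerZ hornerXn.
  have := max_poly_roots pn0 rp urs; rewrite srs ltnNge => /negP; apply.
  apply: (leq_trans (size_sum _ _ _)); apply/bigmax_leqP=> i _.
  apply: (leq_trans (size_scale_leq _ _)); rewrite size_polyXn.
  by rewrite ltn_exp2l.
move=> i; have := congr1 (fun r : {poly L} => r`_(q ^ i)) p0.
rewrite coef0 /p coef_sum (bigD1 i) //= coefZ coefXn eqxx mulr1 big1 ?addr0 //.
move=> j ji; rewrite coefZ coefXn; case: eqP => [|_]; last by rewrite mulr0.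
by move/(expnI q1)/val_inj=> ij; rewrite ij eqxx in ji.
Qed.

(** The elements [eps 0 k] form an F-basis of L. The matrix of their conjugates is invertible by
    [cj_free], and [mu] is its inverse. Hence an F-linear map into an L-space is a linearized
    polynomial, with coefficients read off from its values on the basis. *)
Lemma cj_dual : exists eps mu : 'I_3 -> 'I_3 -> L,
  (forall i j, \sum_k mu i k * cj j (eps 0 k) = (i == j)%:R) /\
  (forall V : lmodType L, forall u : L -> V,
     (forall (c : F) x y, u (c *: x + y) = c%:A *: u x + u y) ->
   forall x, u x = \sum_i cj i x *: \sum_k mu i k *: u (eps 0 k)).
Proof.
pose b (k : 'I_3) := (vbasis {:L})`_k.
have spanb (x : L) : exists d : 'I_3 -> F, x = \sum_k d k *: b k.
  have xb := coord_vbasis (memvf x).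
  exists (fun k => coord (vbasis {:L}) (cast_ord (esym hL) k) x).
  rewrite {1}xb; rewrite (reindex (cast_ord (esym hL))) //=.
  by exists (cast_ord hL) => k _; rewrite ?cast_ordK ?cast_ordKV.
pose M : 'M[L]_3 := \matrix_(k, j) cj j (b k).
have Mu : M^T \in unitmx.
  rewrite -row_free_unit; apply: inj_row_free => v vM.
  suff v0 i : v 0 i = 0 by apply/rowP=> i; rewrite v0 mxE.
  apply: (cj_free (c := v 0)) => x.
  have [d ->] := spanb x.
  under eq_bigr do rewrite rmorph_sum mulr_sumr.
  rewrite exchange_big big1 //= => k _.
  under eq_bigr do rewrite cjZ -scalerAr.
  rewrite -scaler_sumr; have := congr1 (fun r : 'rV__ => r 0 k) vM.
  rewrite !mxE => vMk; apply/eqP; rewrite scaler_eq0; apply/orP; right.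
  by apply/eqP; rewrite -[RHS]vMk; apply: eq_bigr => j _; rewrite !mxE.
rewrite unitmx_tr in Mu.
exists (fun _ => b), (fun i k => invmx M i k); split=> [i j|V u ulin x].
  have := congr1 (fun A : 'M__ => A i j) (mulVmx Mu); rewrite !mxE => <-.
  by apply: eq_bigr => k _; rewrite !mxE.
have u0 : u 0 = 0.
  by have /eqP := ulin 1 0 0; rewrite !scale1r addr0 addrC -subr_eq subrr => /eqP.
have usum (d : 'I_3 -> F) : u (\sum_k d k *: b k) = \sum_k (d k)%:A *: u (b k).
  elim/big_rec2: _ => [|k y1 y2 _ IH]; first exact: u0.
  by rewrite ulin IH.
have [d ->] := spanb x; rewrite usum.
have E k : u (b k) = \sum_i cj i (b k) *: \sum_m invmx M i m *: u (b m).
  under eq_bigr do rewrite scaler_sumr.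
  rewrite exchange_big /= (bigD1 k) //= [X in _ + X]big1 => [|m mk].
    rewrite addr0; under eq_bigr do rewrite scalerA.
    rewrite -scaler_suml; have := congr1 (fun A : 'M__ => A k k) (mulmxV Mu).
    rewrite !mxE eqxx => H; rewrite (_ : \sum_i _ = 1) ?scale1r // -[RHS]H.
    by apply: eq_bigr => i _; rewrite !mxE.
  under eq_bigr do rewrite scalerA.
  rewrite -scaler_suml; have := congr1 (fun A : 'M__ => A k m) (mulmxV Mu).
  rewrite !mxE eq_sym (negbTE mk) => H.
  rewrite (_ : \sum_i _ = 0) ?scale0r // -[RHS]H.
  by apply: eq_bigr => i _; rewrite !mxE.
under eq_bigr do rewrite {1}E scaler_sumr.
rewrite exchange_big /=; apply: eq_bigr => i _.
rewrite rmorph_sum scaler_suml; apply: eq_bigr => k _.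
by rewrite /= cjZ scalerA mulr_algl.
Qed.
End CubicExtension.

Arguments cj {F L} i x.

(** * Norm-one elements and linearized permutations *)

Lemma sum_prim_root (K : fieldType) (n k : nat) (z : K) :
  n.-primitive_root z -> ~~ (n %| k)%N -> \sum_(i < n) (z ^+ i) ^+ k = 0.
Proof.
move=> zP nk; have zk : z ^+ k - 1 != 0.
  by rewrite subr_eq0 -(prim_order_dvd zP).
apply: (mulfI zk); rewrite mulr0.
under eq_bigr do rewrite exprAC.
by rewrite -subrX1 exprAC (prim_expr_order zP) expr1n subrr.
Qed.

Section NormOne.
Variables (F : finFieldType) (L : fieldExtType F).
Hypothesis hL : \dim {:L} = 3%N.

Local Notation q := #|F|%N.

(* By Hilbert 90 these are the elements of L of norm 1 over F. *)
Definition norm_one (u : L) := exists2 w : L, w != 0 & u = cj 1 w / w.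

Lemma norm_one_neq0 u : norm_one u -> u != 0.
Proof. by case=> w w0 ->; rewrite mulf_neq0 ?invr_eq0 ?cj_eq0. Qed.

Lemma norm_oneV u v : norm_one u -> norm_one v -> norm_one (u / v).
Proof.
case=> w w0 -> [w' w'0 ->]; exists (w / w'); first by rewrite mulf_neq0 ?invr_eq0.
rewrite rmorphM fmorphV /=; field.
by rewrite w0 w'0 cj_eq0 w'0.
Qed.

Lemma cj_surj i x : exists y : L, cj i y = x.
Proof. by exists (cj (- i) x); rewrite (cjD hL) subrr cj0. Qed.

(* With z = x^(q-1), g x / x = al + be z + ga z^(q+1) permutes the norm 1 elements;
   its first and (q+1)-st power sums are al and be ga^q, and both vanish. *)
Lemma linearized_permutation (al be ga : L)
    (g := fun x => al * x + be * cj 1 x + ga * cj 2 x) :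
  (forall x, x != 0 -> norm_one (g x / x)) ->
  (forall x y, x != 0 -> y != 0 -> g x / x = g y / y ->
     cj 1 (y / x) = y / x) ->
  al = 0 /\ (be = 0 \/ ga = 0).
Proof.
move=> gN gI; have q1 := card_gt1 F.
have [w wP] := prim_rootL hL.
(* The number of elements of norm 1; they are the powers of z = w^(q-1). *)
pose n := (q ^ 2 + q + 1)%N.
have nE : ((q ^ 3).-1 = (q.-1) * n)%N.
  rewrite /n; case: (q) q1 => // m _; rewrite !expnS expn0; lia.
have n0 : (0 < n)%N by rewrite /n addn1.
have q10 : (0 < q.-1)%N by rewrite -ltnS prednK // ltnW.
pose z := w ^+ q.-1.
have zP : n.-primitive_root z.
  have := dvdn_prim_root wP (m := n); rewrite nE dvdn_mull // => /(_ isT).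
  by rewrite mulnK.
have w0 : w != 0.
  apply/eqP=> w0; have := prim_expr_order wP; rewrite w0 nE expr0n.
  by rewrite muln_eq0 !eqn0Ngt n0 q10 => /eqP; rewrite eq_sym oner_eq0.
have cjw (x : L) : x != 0 -> cj 1 x / x = x ^+ q.-1.
  by move=> x0; rewrite cj1E -{1}(prednK (ltnW q1)) exprSr mulfK.
have cj2w (x : L) : x != 0 -> cj 2 x / x = (x ^+ q.-1) ^+ (q + 1).
  move=> x0; rewrite (_ : cj 2 x = cj 1 (cj 1 x)); last first.
    by rewrite (cjD hL); congr (cj _ x); apply/val_inj.
  have y0 : cj 1 x != 0 by rewrite cj_eq0.
  have -> : cj 1 (cj 1 x) / x = cj 1 (cj 1 x) / cj 1 x * (cj 1 x / x).
    by rewrite mulrA divfK.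
  rewrite (cjw _ y0) (cjw _ x0).
  by rewrite cj1E exprAC -exprSr addn1.
have zw k : z ^+ k = (w ^+ k) ^+ q.-1 by rewrite /z exprAC.
pose h (i : 'I_n) := al + be * z ^+ i + ga * (z ^+ i) ^+ (q + 1).
have gw (i : 'I_n) : g (w ^+ i) / w ^+ i = h i.
  have wi0 : w ^+ i != 0 by rewrite expf_neq0.
  by rewrite /g /h !mulrDl mulfK // -!mulrA cjw // cj2w // zw.
have hz (i : 'I_n) : exists j : 'I_n, h i = z ^+ j.
  have [v v0 hv] := gN _ (expf_neq0 i w0); move: hv.
  rewrite gw cjw // => ->.
  have : (v ^+ q.-1) ^+ n = 1.
    apply: (mulIf v0); rewrite -exprM -nE -exprSr prednK ?(expr_card3 hL) ?mul1r //.
    by rewrite expn_gt0 ltnW.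
  by case/(prim_rootP zP)=> j ->; exists j.
have [s hs] : exists s : 'I_n -> 'I_n, forall i, h i = z ^+ s i by exact: (fin_all_exists hz).
(* Equal values put y / x in F, so x and y have the same (q-1)-st power. Hence h takes every norm 1
   value exactly once. *)
have sI : injective s.
  move=> i j sij; have := gI _ _ (expf_neq0 i w0) (expf_neq0 j w0).
  rewrite !gw !hs sij => /(_ erefl) fx.
  have : z ^+ i == z ^+ j.
    rewrite !zw; rewrite rmorphM fmorphV /= in fx.
    rewrite -!cjw ?expf_neq0 //.
    have wi := expf_neq0 i w0; have wj := expf_neq0 j w0.
    have ci : cj 1 (w ^+ i) != 0 by rewrite cj_eq0.
    have -> : cj 1 (w ^+ j) = w ^+ j / w ^+ i * cj 1 (w ^+ i) by rewrite -fx divfK.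
    by apply/eqP; field; rewrite wi wj.
  by rewrite (eq_prim_root_expr zP) !modn_small // => /eqP/val_inj.
have sumh k : \sum_(i < n) h i ^+ k = \sum_(i < n) (z ^+ i) ^+ k.
  rewrite [RHS](reindex_inj sI) /=; by apply: eq_bigr => i _; rewrite hs.
(* Since q = 0 in L, summing a constant over the n exponents returns that constant. *)
have nR : n%:R = 1 :> L.
  have q0 : q%:R = 0 :> L.
    have [p p_pr pF] := finPcharP F.
    have pL : p \in [pchar L] by rewrite (pchar_lalg L).
    have qE : q = (p ^ logn p q)%N := card_primeChar pF.
    rewrite qE natrX (pcharf0 pL) expr0n.
    by case: logn qE q1 => [->|].
  by rewrite /n !natrD natrX q0 expr0n !add0r.
have ndiv k : (0 < k < n)%N -> ~~ (n %| k)%N.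
  by case/andP=> k0 kn; rewrite gtnNdvd.
have sz k : (0 < k < n)%N -> \sum_(i < n) (z ^+ i) ^+ k = 0.
  by move=> kn; rewrite (sum_prim_root zP) ?ndiv.
have q2 : (q * 2 <= q ^ 2)%N by rewrite expnS expn1 leq_mul2l q1 orbT.
(* The exponents that occur in the two expansions. None is a multiple of n, so their power sums
   vanish and only the constant terms [al] and [be * cj 1 ga] survive. *)
have b1 : (0 < 1 < n)%N by rewrite /n; lia.
have b2 : (0 < q + 1 < n)%N by rewrite /n; lia.
have b3 : (0 < 2 * q + 1 < n)%N by rewrite /n; lia.
have b4 : (0 < q < n)%N by rewrite /n; lia.
have al0 : al = 0.
  have := sumh 1; rewrite sz // !big_split /= sumr_const card_ord.
  have -> : \sum_(i < n) be * z ^+ i = 0.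
    rewrite -mulr_sumr (eq_bigr (fun i : 'I_n => (z ^+ i) ^+ 1)) ?sz ?mulr0 //.
  by rewrite -mulr_sumr sz // mulr0 !addr0 -mulr_natr nR mulr1.
split=> //.
have := sumh (q + 1)%N; rewrite (sz (q + 1)%N) //.
(* This is h^q h, where y^n = 1 turns y^(q^2+q+1) into a constant and y^(q^2+2q+1) into y^q. *)
have E (i : 'I_n) : h i ^+ (q + 1) =
   (be * cj 1 be) * (z ^+ i) ^+ (q + 1) + be * cj 1 ga
   + ga * cj 1 be * (z ^+ i) ^+ (2 * q + 1) + ga * cj 1 ga * (z ^+ i) ^+ q.
  set y := z ^+ i; have yn : y ^+ n = 1.
    by rewrite /y exprAC (prim_expr_order zP) expr1n.
  have yn' : y ^+ (q ^ 2 + q) * y = 1 by rewrite -exprSr -addn1.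
  rewrite addn1 exprSr -cj1E /h al0 add0r rmorphD !rmorphM /=.
  have -> : cj 1 y = y ^+ q by rewrite cj1E.
  have -> : cj 1 (y ^+ (q + 1)) = y ^+ (q ^ 2 + q).
    by rewrite cj1E -exprM mulnDl mul1n.
  have e1 : y ^+ (q + 1) = y ^+ q * y by rewrite addn1 exprSr.
  have e2 : y ^+ (2 * q + 1) = y ^+ q * y ^+ q * y.
    by rewrite addn1 exprSr mul2n -addnn exprD.
  rewrite addn1 -/y exprSr e2 mulrDl.
  transitivity (be * cj 1 be * (y ^+ q * y) + be * cj 1 ga * (y ^+ (q ^ 2 + q) * y)
    + ga * cj 1 be * (y ^+ q * y ^+ q * y)
    + ga * cj 1 ga * (y ^+ (q ^ 2 + q) * y) * y ^+ q); first by ring.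
  by rewrite yn' !mulr1.
under eq_bigr do rewrite E.
rewrite !big_split /= -!mulr_sumr !sz // !mulr0 add0r !addr0.
rewrite sumr_const card_ord -mulr_natr nR mulr1 => /eqP.
by rewrite mulf_eq0 cj_eq0 => /orP[]/eqP; [left|right].
Qed.
End NormOne.

(** * Twisted cubics in PG(6, q) *)

Section BinaryCubics.
Variable K : fieldType.
Implicit Types (l m n : K * K) (w : 'rV[K]_4) (s t : K).

Definition lform l s t : K := l.1 * s + l.2 * t.

(** The coefficients of the product l m n at s^3, s^2 t, s t^2, t^3, in the order of [moment], so
    that pairing with [moment s t] is evaluation at (s, t). *)
Definition cubic_form l m n : 'cV[K]_4 :=
  \col_i [:: l.1 * m.1 * n.1;
             l.1 * m.1 * n.2 + l.1 * m.2 * n.1 + l.2 * m.1 * n.1;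
             l.1 * m.2 * n.2 + l.2 * m.1 * n.2 + l.2 * m.2 * n.1;
             l.2 * m.2 * n.2]`_i.

(* The linear functional w on binary cubic forms, evaluated at l m n. *)
Definition cubic_pair w l m n : K := (w *m cubic_form l m n) 0 0.

Lemma cubic_pairE w l m n : cubic_pair w l m n =
  w 0 0 * (l.1 * m.1 * n.1) +
  w 0 1 * (l.1 * m.1 * n.2 + l.1 * m.2 * n.1 + l.2 * m.1 * n.1) +
  w 0 2 * (l.1 * m.2 * n.2 + l.2 * m.1 * n.2 + l.2 * m.2 * n.1) +
  w 0 3 * (l.2 * m.2 * n.2).
Proof.
rewrite /cubic_pair mxE !big_ord_recl big_ord0 !mxE /= addr0 !addrA.
by congr (_ + w 0 _ * _ + w 0 _ * _ + w 0 _ * _); apply/val_inj.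
Qed.

Lemma cubic_pair_moment s t l m n :
  cubic_pair (moment s t) l m n = lform l s t * lform m s t * lform n s t.
Proof. by rewrite cubic_pairE !mxE /= /lform; ring. Qed.

Definition ldet l m : K := l.1 * m.2 - l.2 * m.1.

(** Cramer's rule: [ldet l1 l2] times n is a combination of l1 and l2. *)
Lemma cubic_pair_basis w l m l1 l2 : ldet l1 l2 != 0 ->
  cubic_pair w l m l1 = 0 -> cubic_pair w l m l2 = 0 ->
  forall n, cubic_pair w l m n = 0.
Proof.
move=> d0 w1 w2 n; apply: (mulfI d0); rewrite mulr0.
transitivity (ldet n l2 * cubic_pair w l m l1 + ldet l1 n * cubic_pair w l m l2).
  by rewrite !cubic_pairE /ldet; ring.
by rewrite w1 w2 !mulr0 addr0.
Qed.

Lemma cubic_pairC w l m n : cubic_pair w l m n = cubic_pair w m l n.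
Proof. by rewrite !cubic_pairE; ring. Qed.

Lemma cubic_pairAC w l m n : cubic_pair w l m n = cubic_pair w l n m.
Proof. by rewrite !cubic_pairE; ring. Qed.

(** The products l_i^2 l_j with i and j distinct span all binary cubics in every characteristic: two
    different l_j give l_i^2 times any form, and l_0^2 l_1 with l_0 l_1^2 give l_0 l_1 times any
    form. *)
Lemma cubic_forms_span w (l : 'I_3 -> K * K) :
  (forall i j, i != j -> ldet (l i) (l j) != 0) ->
  (forall i j, i != j -> cubic_pair w (l i) (l i) (l j) = 0) -> w = 0.
Proof.
move=> ld lw; pose W := cubic_pair w.
have W01 n : W (l 0) (l 1) n = 0.
  apply: (cubic_pair_basis (ld 0 1 isT)); first by rewrite cubic_pairAC lw.
  by rewrite cubic_pairC cubic_pairAC lw.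
have W00 n : W (l 0) (l 0) n = 0.
  by apply: (cubic_pair_basis (ld 1 2 isT)); rewrite lw.
have W0 m n : W (l 0) m n = 0.
  rewrite /W cubic_pairAC; apply: (cubic_pair_basis (ld 0 1 isT)).
    by rewrite cubic_pairAC; exact: W00.
  by rewrite cubic_pairAC; exact: W01.
have W11 n : W (l 1) (l 1) n = 0.
  by apply: (cubic_pair_basis (ld 0 2 isT)); rewrite lw.
have Wl m n : W (l 1) m n = 0.
  rewrite /W cubic_pairAC; apply: (cubic_pair_basis (ld 0 1 isT)).
    by rewrite cubic_pairAC cubic_pairC; exact: W0.
  by rewrite cubic_pairAC; exact: W11.
have W_eq0 k m n : W k m n = 0.
  rewrite /W cubic_pairC cubic_pairAC.
  apply: (cubic_pair_basis (ld 0 1 isT)).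
    by rewrite cubic_pairAC cubic_pairC; exact: W0.
  by rewrite cubic_pairAC cubic_pairC; exact: Wl.
apply/rowP; case=> [[|[|[|[|//]]]] lti]; rewrite [RHS]mxE.
- have := W_eq0 (1, 0) (1, 0) (1, 0); rewrite /W cubic_pairE /= => <-.
  by rewrite (_ : Ordinal lti = 0); [ring | apply/val_inj].
- have := W_eq0 (1, 0) (1, 0) (0, 1); rewrite /W cubic_pairE /= => <-.
  by rewrite (_ : Ordinal lti = 1); [ring | apply/val_inj].
- have := W_eq0 (1, 0) (0, 1) (0, 1); rewrite /W cubic_pairE /= => <-.
  by rewrite (_ : Ordinal lti = 2); [ring | apply/val_inj].
have := W_eq0 (0, 1) (0, 1) (0, 1); rewrite /W cubic_pairE /= => <-.
by rewrite (_ : Ordinal lti = 3); [ring | apply/val_inj].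
Qed.
End BinaryCubics.

(** * Frames of the cubic extension of PG(6, q) *)

Section Frames.
Variables (F : finFieldType) (L : fieldExtType F).
Hypothesis hL : \dim {:L} = 3%N.

Local Notation q := #|F|%N.
Local Notation emb := (map_mx (in_alg L)).

Definition fvec (p0 : 'rV[F]_7) (G H : 'I_3 -> 'rV[L]_7) n (a b : 'I_3 -> L) :=
  n *: emb p0 + \sum_i a i *: G i + \sum_i b i *: H i.

(* The hyperplane Sinf identified with L x L through e, and the seven vectors
   p0, G i, H i of the cubic extension in which e becomes diagonal. *)
Record frame (Sinf : {vspace 'rV[F]_7}) (p0 : 'rV[F]_7)
    (e : L -> L -> 'rV[F]_7) (G H : 'I_3 -> 'rV[L]_7) : Prop := Frame {
  frame_e : forall x y, emb (e x y) = fvec p0 G H 0 (cj^~ x) (cj^~ y);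
  frame_Sinf : forall v, v \in Sinf <-> exists x y, v = e x y;
  frame_free : forall n a b, fvec p0 G H n a b = 0 ->
    n = 0 /\ forall i, a i = 0 /\ b i = 0;
  frame_frobG : forall i, map_mx (cj 1) (G i) = G (i + 1);
  frame_frobH : forall i, map_mx (cj 1) (H i) = H (i + 1)
}.

Lemma emb_inj n : injective (fun v : 'rV[F]_n => emb v).
Proof. by move=> u v /rowP uv; apply/rowP=> i; have := uv i; rewrite !mxE => /fmorph_inj. Qed.

(** A nonvanishing Moore determinant: x and y are linearly independent over F. *)
Definition indep (x y : L) := cj 1 x * y != x * cj 1 y.

Lemma fvecD p0 G H n a b n' a' b' :
  fvec p0 G H n a b + fvec p0 G H n' a' b' =
  fvec p0 G H (n + n') (fun i => a i + a' i) (fun i => b i + b' i).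
Proof.
rewrite /fvec scalerDl; under [X in _ = _ + X + _]eq_bigr do rewrite scalerDl.
under [X in _ = _ + X]eq_bigr do rewrite scalerDl.
by rewrite !big_split /= addrACA; congr (_ + _); rewrite addrACA.
Qed.

Lemma fvecZ p0 G H c n a b :
  c *: fvec p0 G H n a b = fvec p0 G H (c * n) (fun i => c * a i) (fun i => c * b i).
Proof.
rewrite /fvec !scalerDr scalerA !scaler_sumr.
by congr (_ + _ + _); apply: eq_bigr => i _; rewrite scalerA.
Qed.

Lemma fvec_sum p0 G H I (r : seq I) (n : I -> L) (a b : I -> 'I_3 -> L) :
  \sum_(k <- r) fvec p0 G H (n k) (a k) (b k) =
  fvec p0 G H (\sum_(k <- r) n k) (fun i => \sum_(k <- r) a k i)
    (fun i => \sum_(k <- r) b k i).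
Proof.
elim: r => [|k r IH].
  rewrite big_nil /fvec big_nil scale0r add0r.
  by rewrite !big1 ?addr0 // => i _; rewrite big_nil scale0r.
rewrite !big_cons IH fvecD /fvec; congr (_ + _ + _).
  by apply: eq_bigr => i _; rewrite big_cons.
by apply: eq_bigr => i _; rewrite big_cons.
Qed.

Lemma eq_fvec p0 G H n n' a a' b b' : n = n' -> a =1 a' -> b =1 b' ->
  fvec p0 G H n a b = fvec p0 G H n' a' b'.
Proof. by move=> -> /funext-> /funext->. Qed.

Section Frame.
Variables (Sinf : {vspace 'rV[F]_7}) (p0 : 'rV[F]_7).
Variables (e : L -> L -> 'rV[F]_7) (G H : 'I_3 -> 'rV[L]_7).
Hypothesis fr : frame Sinf p0 e G H.

Local Notation vec := (fvec p0 G H).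

Lemma vec_inj n a b n' a' b' : vec n a b = vec n' a' b' ->
  [/\ n = n', a =1 a' & b =1 b'].
Proof.
move=> E; have: vec (n - n') (fun i => a i - a' i) (fun i => b i - b' i) = 0.
  transitivity (vec n a b - vec n' a' b'); last by rewrite E subrr.
  rewrite -[- vec n' a' b']scaleN1r fvecZ fvecD; apply: eq_fvec => [|i|i]; by rewrite mulN1r.
case/(frame_free fr) => /eqP; rewrite subr_eq0 => /eqP-> ab.
by split=> // i; apply/eqP; rewrite -subr_eq0; apply/eqP; have [] := ab i.
Qed.

Lemma emb_affine (n : F) x y :
  emb (n *: p0 + e x y) = vec n%:A (cj^~ x) (cj^~ y).
Proof. by rewrite map_mxD map_mxZ (frame_e fr) /fvec scale0r add0r addrA. Qed.

Lemma affine_inj n x y n' x' y' : n *: p0 + e x y = n' *: p0 + e x' y' ->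
  [/\ n = n', x = x' & y = y'].
Proof.
move=> /(congr1 (fun v : 'rV__ => emb v)); rewrite !emb_affine => /vec_inj[].
move=> nn /(_ 0) + /(_ 0); rewrite !cj0 => -> ->; split=> //.
exact: (@fmorph_inj _ _ (in_alg L) _ _ nn).
Qed.

Lemma e_inj x y x' y' : e x y = e x' y' -> x = x' /\ y = y'.
Proof. by move=> E; have [] := @affine_inj 0 x y 0 x' y'; rewrite ?E. Qed.

Lemma affineD n x y n' x' y' :
  (n *: p0 + e x y) + (n' *: p0 + e x' y') = (n + n') *: p0 + e (x + x') (y + y').
Proof.
apply: emb_inj; rewrite map_mxD !emb_affine fvecD.
by apply: eq_fvec => [|i|i]; rewrite ?rmorphD //= scalerDl.
Qed.

Lemma affineZ (c n : F) x y :
  c *: (n *: p0 + e x y) = (c * n) *: p0 + e (c *: x) (c *: y).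
Proof.
apply: emb_inj; rewrite map_mxZ !emb_affine fvecZ.
by apply: eq_fvec => [|i|i]; rewrite ?cjZ ?mulr_algl ?scalerA.
Qed.

Lemma eD x y x' y' : e x y + e x' y' = e (x + x') (y + y').
Proof. by have := affineD 0 x y 0 x' y'; rewrite addr0 !scale0r !add0r. Qed.

Lemma eZ c x y : c *: e x y = e (c *: x) (c *: y).
Proof. by have := affineZ c 0 x y; rewrite mulr0 !scale0r !add0r. Qed.

Lemma e00 : e 0 0 = 0.
Proof. by rewrite -(scale0r 0) -eZ scale0r. Qed.

Lemma affine_in n x y : (n *: p0 + e x y \in Sinf) = (n == 0).
Proof.
apply/idP/eqP=> [/(frame_Sinf fr)[x' [y' E]]|->].
  by have [] := @affine_inj n x y 0 x' y'; rewrite // E scale0r add0r.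
by apply/(frame_Sinf fr); exists x, y; rewrite scale0r add0r.
Qed.

End Frame.
End Frames.

Lemma ord3P (i : 'I_3) : [\/ i = 0, i = 1 | i = 2].
Proof.
case: i => [[|[|[|//]]] lti].
- by apply: Or31; apply/val_inj.
- by apply: Or32; apply/val_inj.
- by apply: Or33; apply/val_inj.
Qed.

Fact ord11 : 1 + 1 = 2 :> 'I_3. Proof. exact/val_inj. Qed.
Fact ord12 : 1 + 2 = 0 :> 'I_3. Proof. exact/val_inj. Qed.
Fact ord21 : 2 + 1 = 0 :> 'I_3. Proof. exact/val_inj. Qed.

(** * Twisted cubics written in a frame *)

Section FrameCubics.
Variables (F : finFieldType) (L : fieldExtType F).
Hypothesis hL : \dim {:L} = 3%N.
Variables (Sinf : {vspace 'rV[F]_7}) (p0 : 'rV[F]_7).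
Variables (e : L -> L -> 'rV[F]_7) (G H : 'I_3 -> 'rV[L]_7).
Hypothesis fr : frame Sinf p0 e G H.

Local Notation q := #|F|%N.
Local Notation emb := (map_mx (in_alg L)).
Local Notation vec := (fvec p0 G H).

Lemma indep_comb (x y : L) (s t : F) : indep x y -> s *: x + t *: y = 0 ->
  s = 0 /\ t = 0.
Proof.
rewrite -(mulr_algl s x) -(mulr_algl t y) => ixy st0.
have := congr1 (cj 1) st0; rewrite rmorphD rmorph0 !rmorphM /= !cj_alg => st0'.
have d0 : cj 1 x * y - x * cj 1 y != 0 by rewrite subr_eq0.
have alg0 (c : F) : c%:A * (cj 1 x * y - x * cj 1 y) = 0 -> c = 0.
  move/eqP; rewrite mulf_eq0 (negbTE d0) orbF.
  by rewrite scaler_eq0 oner_eq0 orbF => /eqP.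
split; apply: alg0; move: (s%:A) (t%:A) st0 st0' => S T st0 st0'.
  transitivity ((S * cj 1 x + T * cj 1 y) * y - (S * x + T * y) * cj 1 y).
    by ring.
  by rewrite st0 st0' !mul0r subrr.
transitivity ((S * x + T * y) * cj 1 x - (S * cj 1 x + T * cj 1 y) * x).
  by ring.
by rewrite st0 st0' !mul0r subrr.
Qed.

Variables (x1 x2 : L).
Hypothesis ind : indep x1 x2.

(** The coefficients are conjugated but s and t are not, so over L these are three linear forms with
    distinct zeros, while for s, t in F their values are the conjugates of s x1 + t x2. *)
Definition conj_form (i : 'I_3) : L * L := (cj i x1, cj i x2).
Local Notation lf := conj_form.

Lemma lform_conj i (s t : F) : lform (lf i) s%:A t%:A = cj i (s *: x1 + t *: x2).
Proof. by rewrite /lform /= rmorphD /= !cjZ !mulr_algr. Qed.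

(** Frobenius shifts the three determinants cyclically, and [ind] says that one of them is
    nonzero. *)
Lemma ldet_conj i j : i != j -> ldet (lf i) (lf j) != 0.
Proof.
have D1 k : ldet (lf k) (lf (k + 1)) != 0.
  have -> : ldet (lf k) (lf (k + 1)) = cj k (ldet (lf 0) (lf 1)).
    by rewrite /ldet /= rmorphB !rmorphM /= !(cjD hL) addr0.
  by rewrite cj_eq0 /ldet /= !cj0 subr_eq0 eq_sym mulrC.
have ldetC k l : ldet (lf k) (lf l) = - ldet (lf l) (lf k) by rewrite /ldet; ring.
have D01 := D1 0; have D12 := D1 1; have D20 := D1 2.
rewrite add0r in D01; rewrite ord11 in D12; rewrite ord21 in D20.
have [->|->|->] := ord3P i; have [->|->|->] := ord3P j => // _.
- by rewrite ldetC oppr_eq0.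
- by rewrite ldetC oppr_eq0.
by rewrite ldetC oppr_eq0.
Qed.

Lemma cj_cubic_form i a b c r :
  cj i (cubic_form (lf a) (lf b) (lf c) r 0) =
  cubic_form (lf (i + a)) (lf (i + b)) (lf (i + c)) r 0.
Proof.
rewrite !mxE; case: r => [[|[|[|[|//]]]] ltr] /=;
  by rewrite ?rmorphD !rmorphM /= !(cjD hL).
Qed.

Lemma cj_cubic_pair i (w : 'rV[F]_4) a b c :
  cj i (cubic_pair (emb w) (lf a) (lf b) (lf c)) =
  cubic_pair (emb w) (lf (i + a)) (lf (i + b)) (lf (i + c)).
Proof.
rewrite /cubic_pair !mxE rmorph_sum; apply: eq_bigr => r _.
by rewrite rmorphM /= cj_cubic_form mxE cj_alg.
Qed.

(* B is the cubic N(y) p0 + e (y_j^2 y_k, y_j'^2 y_k') for y = s x1 + t x2, with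
   y_i = y^(q^i).  Sublines of pi give (1, 2, 2, 1), special conics (0, 2, 0, 1). *)
Definition cubic_along (j k j' k' : 'I_3) (B : 'M[F]_(4, 7)) :=
  forall w : 'rV[L]_4, w *m emb B =
    vec (cubic_pair w (lf 0) (lf 1) (lf 2))
        (fun i => cubic_pair w (lf (i + j)) (lf (i + j)) (lf (i + k)))
        (fun i => cubic_pair w (lf (i + j')) (lf (i + j')) (lf (i + k'))).

(** Row r of B collects the coefficients at s^(3-r) t^r. Frobenius permutes the three factors of the
    norm form, so its coefficients lie in F and the rows are vectors over F. *)
Lemma exists_cubic j k j' k' : exists B, cubic_along j k j' k' B.
Proof.
have fixN (r : 'I_4) : exists c : F, cubic_form (lf 0) (lf 1) (lf 2) r 0 = c%:A.
  apply: cj_fixed; rewrite cj_cubic_form addr0 ord11 ord12.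
  rewrite !mxE; case: r => [[|[|[|[|//]]]] ltr] /=; ring.
have [c cE] := fin_all_exists fixN.
pose f a b r := cubic_form (lf a) (lf a) (lf b) r 0.
exists (\matrix_r (c r *: p0 + e (f j k r) (f j' k' r))) => w.
rewrite mulmx_sum_row.
under eq_bigr do rewrite -map_row rowK (emb_affine fr) fvecZ.
rewrite fvec_sum; apply: eq_fvec => [|i|i].
- by rewrite /cubic_pair mxE; apply: eq_bigr => r _; rewrite cE.
- by rewrite /cubic_pair mxE; apply: eq_bigr => r _; rewrite cj_cubic_form.
by rewrite /cubic_pair mxE; apply: eq_bigr => r _; rewrite cj_cubic_form.
Qed.

Variables (j k j' k' : 'I_3) (B : 'M[F]_(4, 7)).
Hypothesis hB : cubic_along j k j' k' B.
Hypothesis hjk : [/\ k - j != 0, k' - j' != 0 & k - j != k' - j'].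

Lemma mulmx_cubic (w : 'rV[F]_4) : exists n : F,
  n%:A = cubic_pair (emb w) (lf 0) (lf 1) (lf 2) /\
  w *m B = n *: p0 + e (cubic_pair (emb w) (lf j) (lf j) (lf k))
                      (cubic_pair (emb w) (lf j') (lf j') (lf k')).
Proof.
have [n nE] : exists n : F, cubic_pair (emb w) (lf 0) (lf 1) (lf 2) = n%:A.
  apply: cj_fixed; rewrite cj_cubic_pair addr0 ord11 ord12 !cubic_pairE; ring.
exists n; split=> //; apply: (@emb_inj F L).
rewrite map_mxM /= hB (emb_affine fr) nE.
by apply: eq_fvec => // i; rewrite cj_cubic_pair.
Qed.

(** If w B = 0, then w vanishes on the forms at all G_i and H_i. As k - j and k' - j' are the two
    nonzero residues modulo 3, these are all six products l_a^2 l_b with a and b distinct. *)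
Lemma cubic_row_free : row_free B.
Proof.
apply: inj_row_free => w wB; apply: (@emb_inj F L); rewrite map_mx0.
have := hB (emb w); rewrite -map_mxM wB map_mx0 => /esym/(frame_free fr)[_ ab].
apply: (cubic_forms_span ldet_conj) => a b ab0.
have: b - a != 0 by rewrite subr_eq0 eq_sym.
have [[Ed|Ed]|] : (b - a = k - j \/ b - a = k' - j') \/ b - a = 0; last by move=> ->.
- move: hjk; case: (ord3P (b - a)) => ->; case: (ord3P (k - j)) => ->;
    case: (ord3P (k' - j')) => -> [] //; by [left; left|left; right|right].
- move=> _; have [+ _] := ab (a - j).
  by rewrite subrK (_ : a - j + k = b) // addrAC -addrA -Ed addrC subrK.
move=> _; have [_ +] := ab (a - j').
by rewrite subrK (_ : a - j' + k' = b) // addrAC -addrA -Ed addrC subrK.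
Qed.

End FrameCubics.

(** * Spans under a change of scalars *)

Section ScalarExtension.
Variables (K K' : fieldType) (f : {rmorphism K -> K'}) (n : nat).

Lemma mem_map_span (X : seq 'rV[K]_n) u :
  u \in <<X>>%VS -> map_mx f u \in <<[seq map_mx f x | x <- X]>>%VS.
Proof.
move=> uX; rewrite (coord_span (X := in_tuple X) uX) raddf_sum /=.
apply: memv_suml => i _; rewrite map_mxZ; apply/memvZ/memv_span.
by apply: map_f; exact: mem_nth.
Qed.

Lemma map_vs_span (X : seq 'rV[K]_n) :
  map_vs f <<X>>%VS = <<[seq map_mx f x | x <- X]>>%VS.
Proof.
apply/eqP; rewrite eqEsubv; apply/andP; split; apply/span_subvP.
  by move=> _ /mapP[u /vbasis_mem uX ->]; exact: mem_map_span.
move=> _ /mapP[u uX ->]; apply: mem_map_span.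
by rewrite (span_basis (vbasisP _)) memv_span.
Qed.

Lemma mem_map_vs (U : {vspace 'rV[K]_n}) u : u \in U -> map_mx f u \in map_vs f U.
Proof. by move=> uU; apply: mem_map_span; rewrite (span_basis (vbasisP _)). Qed.
End ScalarExtension.

Lemma cubic_solidE (K : fieldType) n (C : 'M[K]_(4, n)) :
  cubic_solid C = limg (linfun (mulmxr C : 'rV_4 -> 'rV_n)).
Proof.
apply/eqP; rewrite eqEsubv; apply/andP; split.
  apply/span_subvP=> _ /fintype.imageP[i _ ->]; rewrite rowE.
  by apply/memv_imgP; exists (delta_mx 0 i); rewrite ?memvf ?lfunE.
apply/subvP=> _ /memv_imgP[w _ ->]; rewrite lfunE /= mulmx_sum_row.
by apply: memv_suml => i _; apply/memvZ/memv_span/fintype.image_f.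
Qed.

Lemma mem_cubic_solid (K : fieldType) n (C : 'M[K]_(4, n)) v :
  v \in cubic_solid C <-> exists w, v = w *m C.
Proof.
rewrite cubic_solidE; split=> [/memv_imgP[w _ ->]|[w ->]].
  by exists w; rewrite lfunE.
by apply/memv_imgP; exists w; rewrite ?memvf ?lfunE.
Qed.

Lemma dim_cubic_solid (K : fieldType) n (C : 'M[K]_(4, n)) :
  row_free C -> \dim (cubic_solid C) = 4%N.
Proof.
move=> Cf; rewrite cubic_solidE limg_dim_eq ?dimvf ?dim_matrix ?mul1n //.
apply/eqP; rewrite capfv -subv0; apply/subvP=> w; rewrite memv_ker lfunE /= memv0.
by rewrite -{1}(mul0mx _ C) => /eqP/(row_free_inj Cf)/eqP.
Qed.

(** * Transversal lines of the spread and of the covers *)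

Section Transversals.
Variables (F : finFieldType) (L : fieldExtType F).
Hypothesis hL : \dim {:L} = 3%N.
Variables (Sinf : {vspace 'rV[F]_7}) (p0 : 'rV[F]_7).
Variables (e : L -> L -> 'rV[F]_7) (G H : 'I_3 -> 'rV[L]_7).
Hypothesis fr : frame Sinf p0 e G H.

Local Notation q := #|F|%N.
Local Notation emb := (map_mx (in_alg L)).
Local Notation vec := (fvec p0 G H).

Lemma mem_ext n (U : {vspace 'rV[F]_n}) u : u \in U -> emb u \in ext L U.
Proof. exact: mem_map_vs. Qed.

Definition graph_of (g : L -> L) (A : {vspace 'rV[F]_7}) :=
  forall v, v \in A <-> exists x, v = e x (g x).

(* For m = 0 the transversal lines of the spread S, for m = 1 and m = 2 those of the
   covers consisting of the graphs of x |-> - u x^(q^m). *)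
Definition gline (m a : 'I_3) : {vspace 'rV[L]_7} := <<[:: G a; H (a - m)]>>%VS.

Lemma mem_gline m a v : v \in gline m a <-> exists c d, v = c *: G a + d *: H (a - m).
Proof.
rewrite /gline span_cons span_seq1; split.
  by case/memv_addP=> _ /vlineP[c ->] [_ /vlineP[d ->] ->]; exists c, d.
by case=> c [d ->]; rewrite memv_add ?memvZ ?memv_line.
Qed.

Lemma frob_gline m a : frob (gline m a) = gline m (a + 1).
Proof.
rewrite /frob (_ : (fun x : L => _) = cj 1); last by apply/funext=> x; rewrite cj1E.
by rewrite map_vs_span /= (frame_frobG fr) (frame_frobH fr) addrAC.
Qed.

Lemma iter_frob_gline m n : exists a, iter n (@frob F L 7) (gline m 0) = gline m a.
Proof. by elim: n => [|n [a IH]] /=; [exists 0 | exists (a + 1); rewrite IH frob_gline]. Qed.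

(** The dual basis inverts the system: each T_i is an L-combination of values of the sum at basis
    elements. *)
Lemma mem_cj_coef (V : {vspace 'rV[L]_7}) (T : 'I_3 -> 'rV[L]_7) :
  (forall x, \sum_i cj i x *: T i \in V) -> forall i, T i \in V.
Proof.
move=> TV i; have [eps [mu [dual _]]] := cj_dual hL.
have -> : T i = \sum_k mu i k *: \sum_j cj j (eps 0 k) *: T j.
  under eq_bigr do rewrite scaler_sumr.
  rewrite exchange_big /= (bigD1 i) //= [X in _ + X]big1 => [|j ji].
    under eq_bigr do rewrite scalerA.
    by rewrite -scaler_suml dual eqxx scale1r addr0.
  under eq_bigr do rewrite scalerA.
  by rewrite -scaler_suml dual eq_sym (negbTE ji) scale0r.
by apply: memv_suml => k _; apply: memvZ.
Qed.

Lemma sum_delta (X : 'I_3 -> 'rV[L]_7) a (c : 'I_3 -> L) :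
  (forall i, i != a -> c i = 0) -> \sum_i c i *: X i = c a *: X a.
Proof.
by move=> c0; rewrite (bigD1 a) //= big1 ?addr0 // => i ia; rewrite c0 ?scale0r.
Qed.

Lemma vec_gline a b c d : c *: G a + d *: H b =
  vec 0 (fun i => c * (i == a)%:R) (fun i => d * (i == b)%:R).
Proof.
rewrite /fvec scale0r add0r (@sum_delta _ a) => [|i /negbTE->]; last exact: mulr0.
rewrite (@sum_delta _ b) => [|i /negbTE->]; last exact: mulr0.
by rewrite !eqxx !mulr1.
Qed.

Lemma gline_eq0 a b c d : c *: G a + d *: H b = 0 -> c = 0 /\ d = 0.
Proof.
rewrite vec_gline => /(frame_free fr)[_ cd].
have [+ _] := cd a; have [_] := cd b; rewrite !eqxx !mulr1; by [].
Qed.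

Lemma dim_gline m a : \dim (gline m a) = 2%N.
Proof.
apply/eqP; rewrite [_ == _](_ : _ = free [:: G a; H (a - m)]); last first.
  by rewrite /free /gline.
rewrite free_cons span_seq1 /free span_seq1 dim_vline.
have -> : H (a - m) != 0.
  apply/eqP=> Hb; have [] := @gline_eq0 a (a - m) 0 1.
    by rewrite scale0r scale1r add0r.
  by move=> _ /eqP; rewrite oner_eq0.
rewrite eqxx andbT; apply/negP=> /vlineP[d Ga].
have [] := @gline_eq0 a (a - m) 1 (- d); first by rewrite scale1r Ga scaleNr subrr.
by move=> /eqP; rewrite oner_eq0.
Qed.

(** Comparing the coefficients of the conjugates of x shows that the extension of a graph y = c
    x^(q^m) contains G_a + c^(q^(a-m)) H_(a-m), a point of [gline m a]. A plane containing all e (0,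
    y) contributes H_(a-m) instead. *)
Lemma transversal_gline (X : set {vspace 'rV[F]_7}) (m : 'I_3) :
  (forall A, X A -> (exists c, graph_of (fun x => c * cj m x) A) \/
     (forall y, e 0 y \in A)) ->
  forall a, transversal_line Sinf X (gline m a).
Proof.
move=> hX a.
have HV (V : {vspace 'rV[L]_7}) : (forall y, emb (e 0 y) \in V) -> forall i, H i \in V.
  move=> yV; apply: mem_cj_coef => y; have := yV y; rewrite (frame_e fr) /fvec.
  rewrite scale0r add0r [X in X + _]big1 ?add0r // => i _.
  by rewrite rmorph0 scale0r.
have GV (V : {vspace 'rV[L]_7}) c :
    (forall x, emb (e x (c * cj m x)) \in V) ->
    forall i, G i + cj (i - m) c *: H (i - m) \in V.
  move=> xV; apply: mem_cj_coef => x.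
  have -> : \sum_i cj i x *: (G i + cj (i - m) c *: H (i - m)) =
      \sum_i cj i x *: G i + \sum_i cj i (c * cj m x) *: H i.
    rewrite [X in _ = _ + X](reindex (fun i => i - m)) /=; last first.
      by exists (fun i => i + m) => i _; rewrite ?subrK ?addrK.
    rewrite -big_split; apply: eq_bigr => i _ /=.
    by rewrite rmorphM /= (cjD hL) subrK scalerDr scalerA mulrC.
  by have := xV x; rewrite (frame_e fr) /fvec scale0r add0r.
split.
- exact: dim_gline.
- apply/span_subvP=> v; rewrite !inE => /orP[]/eqP->.
    have := GV (ext L Sinf) 0; rewrite /= => /(_ _ a); rewrite rmorph0 scale0r addr0.
    by apply=> x; apply: mem_ext; apply/(frame_Sinf fr); exists x, (0 * cj m x).
  by apply: HV => y; apply: mem_ext; apply/(frame_Sinf fr); exists 0, y.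
- move=> P dP /subvP PS /subvP Pg.
  have P0 : P != 0%VS by rewrite -dimv_eq0 dP.
  have /(frame_Sinf fr)[x [y vE]] := PS _ (memv_pick P).
  (* On the line the coordinates at G_(a+1) and H_(a-m+1) vanish; for a vector over F they are
     conjugates of x and y, so x = y = 0. *)
  have /mem_gline[c [d]] := Pg _ (mem_ext (memv_pick P)).
  rewrite vE (frame_e fr) vec_gline => /(vec_inj fr)[_ /(_ (a + 1)) xa /(_ (a - m + 1)) ya].
  have ne (b : 'I_3) : (b + 1 == b) = false.
    by rewrite -subr_eq0 addrAC subrr add0r.
  rewrite ne mulr0 in xa; rewrite ne mulr0 in ya.
  have x0 : x = 0 by move/eqP: xa; rewrite cj_eq0 => /eqP.
  have y0 : y = 0 by move/eqP: ya; rewrite cj_eq0 => /eqP.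
  by move/negP: P0; apply; rewrite -(vpick0 P) vE x0 y0 (e00 fr).
move=> A /hX[[c Ac]|A0]; move=> cap0.
  have : G a + cj (a - m) c *: H (a - m) \in (gline m a :&: ext L A)%VS.
    rewrite memv_cap; apply/andP; split.
      by apply/mem_gline; exists 1, (cj (a - m) c); rewrite scale1r.
    by apply: GV => x; apply: mem_ext; apply/Ac; exists x.
  rewrite cap0 memv0 -[G a]scale1r => /eqP/gline_eq0[/eqP].
  by rewrite oner_eq0.
have : H (a - m) \in (gline m a :&: ext L A)%VS.
  rewrite memv_cap; apply/andP; split.
    by apply/mem_gline; exists 0, 1; rewrite scale0r scale1r add0r.
  by apply: HV => y; apply: mem_ext; apply/A0.
rewrite cap0 memv0 => /eqP Ha; have [] := @gline_eq0 a (a - m) 0 1.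
  by rewrite Ha scaler0 scale0r addr0.
by move=> _ /eqP; rewrite oner_eq0.
Qed.

End Transversals.

Lemma vlineZ (K : fieldType) (vT : vectType K) (c : K) (v : vT) :
  c != 0 -> <[c *: v]>%VS = <[v]>%VS.
Proof.
move=> c0; apply/eqP; rewrite eqEsubv -!memvE memvZ ?memv_line //=.
by rewrite -{1}[v](scalerK c0) memvZ ?memv_line.
Qed.

(** The solid meets the hyperplane in dimension at least 4 + 6 - 7 = 3, so the inclusion of the
    intersection in the plane A is an equality. *)
Lemma plane_in_cubic_solid (F : fieldType) (Sinf A : {vspace 'rV[F]_7})
    (B : 'M[F]_(4, 7)) : hyperplanes Sinf -> row_free B -> planes A ->
  (forall v, v \in cubic_solid B -> v \in Sinf -> v \in A) ->
  (A <= cubic_solid B)%VS.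
Proof.
move=> hSinf Bf Ap sub; have capA : (cubic_solid B :&: Sinf <= A)%VS.
  by apply/subvP=> v; rewrite memv_cap => /andP[]; exact: sub.
suff -> : A = (cubic_solid B :&: Sinf)%VS by exact: capvSl.
apply/esym/eqP; rewrite eqEdim capA Ap.
have := dimv_sum_cap (cubic_solid B) Sinf.
have : (\dim (cubic_solid B + Sinf) <= 7)%N.
  by have := dimvS (subvf (cubic_solid B + Sinf)); rewrite dimvf.
rewrite dim_cubic_solid //; move: hSinf; rewrite /hyperplanes /=; lia.
Qed.

(** * Special twisted cubics from products of conjugate forms *)

Section SpecialCubics.
Variables (F : finFieldType) (L : fieldExtType F).
Hypothesis hL : \dim {:L} = 3%N.
Variables (Sinf : {vspace 'rV[F]_7}) (p0 : 'rV[F]_7).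
Variables (e : L -> L -> 'rV[F]_7) (G H : 'I_3 -> 'rV[L]_7).
Hypothesis fr : frame Sinf p0 e G H.

Local Notation q := #|F|%N.
Local Notation emb := (map_mx (in_alg L)).
Local Notation vec := (fvec p0 G H).

Definition nrm (x : L) := cj 0 x * cj 1 x * cj 2 x.

Lemma nrm_eq0 x : (nrm x == 0) = (x == 0).
Proof. by rewrite /nrm !mulf_eq0 !cj_eq0 !orbb. Qed.

Variables (x1 x2 : L).
Hypothesis ind : indep x1 x2.
Local Notation lf := (conj_form x1 x2).
Variables (j k j' k' : 'I_3) (B : 'M[F]_(4, 7)).
Hypothesis hB : cubic_along p0 G H x1 x2 j k j' k' B.
Hypothesis hjk : [/\ k - j != 0, k' - j' != 0 & k - j != k' - j'].

Lemma indep_neq0 (s t : F) : (s, t) <> (0, 0) -> s *: x1 + t *: x2 != 0.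
Proof. by move=> st0; apply/eqP=> /(indep_comb ind)[s0 t0]; apply: st0; rewrite s0 t0. Qed.

Lemma moment_cubic (s t : F) (x := s *: x1 + t *: x2) : exists n : F, n%:A = nrm x /\
  moment s t *m B = n *: p0 + e (cj j x * cj j x * cj k x) (cj j' x * cj j' x * cj k' x).
Proof.
have embm : emb (moment s t) = moment s%:A t%:A.
  by apply/rowP=> i; rewrite !mxE rmorphM !rmorphXn.
have [n [nE ->]] := mulmx_cubic hL fr hB (moment s t); exists n.
by rewrite nE embm !cubic_pair_moment !lform_conj.
Qed.

Lemma cubic_pointE (s t : F) (x := s *: x1 + t *: x2) : (s, t) <> (0, 0) ->
  cubic_point B s t = <[p0 + e (cj j x * cj j x * cj k x / nrm x)
                               (cj j' x * cj j' x * cj k' x / nrm x)]>%VS.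
Proof.
move=> /indep_neq0 x0; have [n [nE mE]] := moment_cubic s t.
have n0 : n != 0.
  by apply/eqP=> n0; move/eqP: nE; rewrite n0 scale0r eq_sym nrm_eq0 (negbTE x0).
rewrite /cubic_point mE -/x -(vlineZ (p0 + _) n0); congr (<[_]>%VS).
rewrite scalerDr (eZ fr) -!(mulr_algl n (_ / _)) nE -/x; congr (_ + e _ _);
  by rewrite [RHS]mulrC divfK // nrm_eq0.
Qed.

Lemma moment10_affine : exists n : F, n != 0 /\
  exists x y, row 0 B = n *: p0 + e x y.
Proof.
have [n [nE mE]] := moment_cubic 1 0; exists n; split.
  apply/eqP=> n0; move/eqP: nE; rewrite n0 scale0r eq_sym nrm_eq0.
  by apply/negP/indep_neq0=> -[/eqP]; rewrite oner_eq0.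
do 2!eexists; rewrite rowE -(_ : moment 1 0 = delta_mx 0 0); first exact: mE.
apply/rowP=> i; rewrite !mxE expr1n mul1r expr0n.
by case: i => [[|[|[|[|]]]]].
Qed.

(** The hypothesis on r says that l_r divides the form at every G_i with i <> a and at every H_i
    with i <> a - m. The point of the extended cubic at the zero of l_r therefore lies on
    [gline m a]. *)
Lemma special_cubic X m :
  (forall A, X A -> (exists c, graph_of e (fun x => c * cj m x) A) \/
     (forall y, e 0 y \in A)) ->
  (forall a, exists r, forall i, (i != a -> i + j = r \/ i + k = r) /\
     (i != a - m -> i + j' = r \/ i + k' = r)) ->
  (exists2 A, X A & (A <= cubic_solid B)%VS) ->
  special_twisted_cubic L Sinf X B.
Proof.
move=> hX hm hA; split=> //; first exact: (cubic_row_free hL fr ind hB hjk).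
  move=> /subvP BS; have [n [n0 [x [y rE]]]] := moment10_affine.
  have /BS : row 0 B \in cubic_solid B.
    by apply/mem_cubic_solid; exists (delta_mx 0 0); rewrite rowE.
  by rewrite rE (affine_in fr) (negbTE n0).
exists (gline G H m 0) => i; have [a ->] := iter_frob_gline fr m i.
split; first exact: (transversal_gline hL fr hX).
have [r hr] := hm a.
(* The zero of l_r. The coefficient of p0, the product of all three forms, vanishes there as
   well. *)
pose s := cj r x2; pose t := - cj r x1.
have lr : lform (lf r) s t = 0 by rewrite /lform /s /t /=; ring.
exists (cubic_point (emb B) s t).
  exists s, t; split=> // -[/eqP s0 _]; move: s0; rewrite cj_eq0 => /eqP x20.
  by move: ind; rewrite /indep x20 rmorph0 !mulr0 eqxx.
rewrite -memvE hB !cubic_pair_moment; apply/mem_gline.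
have -> : lform (lf 0) s t * lform (lf 1) s t * lform (lf 2) s t = 0.
  by case: (ord3P r) lr => -> ->; rewrite ?(mul0r, mulr0).
rewrite /fvec scale0r add0r.
rewrite (@sum_delta _ _ _ a) => [|l la]; last first.
  by rewrite cubic_pair_moment; have [/(_ la)[]-> _] := hr l; rewrite lr ?(mul0r, mulr0).
rewrite (@sum_delta _ _ _ (a - m)) => [|l la]; last first.
  by rewrite cubic_pair_moment; have [_ /(_ la)[]->] := hr l; rewrite lr ?(mul0r, mulr0).
by do 2!eexists.
Qed.

(** Three linear forms in two variables satisfy a relation with their determinants as coefficients,
    here multiplied by m n. On Sinf, where w vanishes on l_0 l_1 l_2, it leaves a proportionality of
    two coordinates and so gives the slope of the plane at infinity. *)
Lemma cubic_pair_plucker (w : 'rV[L]_4) l1 l2 l3 m n :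
  ldet l2 l3 * cubic_pair w m n l1 + ldet l3 l1 * cubic_pair w m n l2
    + ldet l1 l2 * cubic_pair w m n l3 = 0.
Proof. by rewrite !cubic_pairE /ldet; ring. Qed.

End SpecialCubics.

(** * Covers of the splash *)

Section Covers.
Variables (F : finFieldType) (L : fieldExtType F).
Hypothesis hL : \dim {:L} = 3%N.
Variables (Sinf : {vspace 'rV[F]_7}) (p0 : 'rV[F]_7).
Variables (e : L -> L -> 'rV[F]_7) (G H : 'I_3 -> 'rV[L]_7).
Hypothesis fr : frame Sinf p0 e G H.
Hypothesis hSinf : hyperplanes Sinf.
Variable Spl : set {vspace 'rV[F]_7}.
Hypothesis Spl_graph : forall A, Spl A ->
  exists2 u : L, norm_one u & graph_of e (fun x => - u * x) A.
Hypothesis graph_Spl : forall u : L, norm_one u ->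
  exists2 A, Spl A & graph_of e (fun x => - u * x) A.

Local Notation q := #|F|%N.

Lemma graph_of_inj g A A' : graph_of e g A -> graph_of e g A' -> A = A'.
Proof.
by move=> gA gA'; apply/vspaceP=> v; apply/idP/idP=> [/gA/gA'|/gA'/gA].
Qed.

Definition graph_cover (i : 'I_3) (X : set {vspace 'rV[F]_7}) :=
  forall A, X A -> exists2 c : L, norm_one c & graph_of e (fun x => - c * cj i x) A.

Section Cover.
Variable X : set {vspace 'rV[F]_7}.
Hypothesis Xcov : is_cover Sinf Spl X.

Lemma cover_mem A v : X A -> v \in A -> v != 0 ->
  exists x u, [/\ x != 0, norm_one u & v = e x (- u * x)].
Proof.
case: Xcov => _ _ _ cov _ XA vA v0.
have pv : points <[v]>%VS by rewrite /points /= dim_vline v0.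
have [D SD vD] : exists2 D, Spl D & (<[v]> <= D)%VS.
  by apply/(cov _ pv); exists A; rewrite // -memvE.
have [u uN gD] := Spl_graph SD; have /gD[x vE] : v \in D by rewrite memvE.
exists x, u; split=> //; apply/eqP=> x0; move/eqP: v0; apply.
by rewrite vE x0 mulr0 (e00 fr).
Qed.

(** Every splash plane is a graph over x, so no point of the plane x = 0 is covered. *)
Lemma cover_vertical A y : X A -> e 0 y \in A -> y = 0.
Proof.
move=> XA yA; apply/eqP/negPn/negP=> y0.
have v0 : e 0 y != 0.
  by apply/eqP; rewrite -(e00 fr) => /(e_inj fr)[_ /eqP]; rewrite (negbTE y0).
have [x [u [x0 _ /(e_inj fr)[/eqP]]]] := cover_mem XA yA v0.
by rewrite eq_sym (negbTE x0).
Qed.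

(** A is disjoint from the plane x = 0, so by dimension the two span Sinf. *)
Lemma cover_section A : X A -> forall x, exists y, e x y \in A.
Proof.
move=> XA x; case: (Xcov) => _ /(_ _ XA)[Ap AS] _ _ _.
have lin0 : linear (e 0).
  by move=> c y y'; rewrite (eZ fr) (eD fr) scaler0 addr0.
pose f : {linear L -> 'rV[F]_7} := HB.pack (e 0) (GRing.isLinear.Build F L _ _ (e 0) lin0).
pose V := limg (linfun f).
have dV : \dim V = 3%N.
  rewrite /V limg_dim_eq ?hL //; apply/eqP; rewrite capfv -subv0.
  apply/subvP=> y; rewrite memv_ker lfunE /= memv0 -(e00 fr).
  by move=> /eqP/(e_inj fr)[_ ->].
have cap0 : \dim (A :&: V) = 0%N.
  apply/eqP; rewrite dimv_eq0 -subv0; apply/subvP=> v; rewrite memv_cap memv0.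
  case/andP=> vA /memv_imgP[y _]; rewrite lfunE /= => vE.
  by move: vA; rewrite vE => /(cover_vertical XA)->; rewrite (e00 fr).
have AV : (A + V)%VS = Sinf.
  apply/eqP; rewrite eqEdim subv_add AS /=; apply/andP; split.
    apply/subvP=> _ /memv_imgP[y _ ->]; rewrite lfunE /=.
    by apply/(frame_Sinf fr); exists 0, y.
  have := dimv_sum_cap A V; rewrite cap0 dV Ap.
  by move: hSinf; rewrite /hyperplanes /=; lia.
have : e x 0 \in (A + V)%VS by rewrite AV; apply/(frame_Sinf fr); exists x, 0.
case/memv_addP=> a aA [_ /memv_imgP[y _ ->]]; rewrite lfunE /= => xE.
have /(frame_Sinf fr)[x' [y' aE]] := subvP AS _ aA.
move: xE; rewrite aE (eD fr) addr0 => /(e_inj fr)[-> _].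
by exists y'; rewrite -aE.
Qed.

(** The section is unique, hence A is the graph of an F-linear g, a linearized polynomial. Points of
    A lie in splash planes, which gives - g x / x norm 1; each splash plane meets A in a single
    point, which makes this ratio injective up to factors in F. *)
Lemma cover_graph A : X A -> exists2 c : L, norm_one c &
  graph_of e (fun x => - c * cj 1 x) A \/ graph_of e (fun x => - c * cj 2 x) A.
Proof.
move=> XA; have [g gA] := boolp.choice (cover_section XA).
have guniq x y : e x y \in A -> y = g x.
  move=> xyA; apply/eqP; rewrite -subr_eq0; apply/eqP/(cover_vertical XA).
  have -> : e 0 (y - g x) = e x y - e x (g x).
    by apply: (addIr (e x (g x))); rewrite (eD fr) !subrK add0r.
  exact: rpredB.
have gr : graph_of e g A.
  move=> v; split=> [vA|[x ->//]].
  case: (Xcov) => _ /(_ _ XA)[_ /subvP AS] _ _ _.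
  have /(frame_Sinf fr)[x [y vE]] := AS _ vA; exists x.
  by rewrite vE -(@guniq x y) // -vE.
have glin (c : F) (x y : L) : g (c *: x + y) = (c%:A : L) *: (g x : L^o) + g y.
  apply/esym/guniq; rewrite (_ : e _ _ = c *: e x (g x) + e y (g y)).
    by rewrite rpredD ?rpredZ ?gA.
  by rewrite (eZ fr) (eD fr) /GRing.scale /= mulr_algl.
have [eps [mu [_ rep]]] := cj_dual hL.
have {rep} := rep L^o g glin.
pose T (i : 'I_3) : L := \sum_k mu i k *: (g (eps 0 k) : L^o) => rep.
have {rep} repT x : g x = \sum_i cj i x * T i := rep x.
have gE x : g x = - ((- T 0) * x + (- T 1) * cj 1 x + (- T 2) * cj 2 x).
  rewrite repT; clearbody T; rewrite !big_ord_recl big_ord0 /= addr0.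
  rewrite (_ : lift ord0 ord0 = 1); last exact/val_inj.
  rewrite (_ : lift ord0 _ = 2); last exact/val_inj.
  rewrite cj0 !mulNr -!opprD opprK addrA.
  by congr (_ + _ + _); exact: mulrC.
have gN (x : L) : x != 0 -> norm_one ((- g x) / x).
  move=> x0; have v0 : e x (g x) != 0.
    by apply/eqP; rewrite -(e00 fr) => /(e_inj fr)[/eqP]; rewrite (negbTE x0).
  have [x' [u [_ uN /(e_inj fr)[<- ->]]]] := cover_mem XA (gA x) v0.
  by rewrite -mulNr opprK mulfK.
have gI (x y : L) : x != 0 -> y != 0 -> - g x / x = - g y / y ->
    cj 1 (y / x) = y / x.
  move=> x0 y0 gxy; have [D SD gD] := graph_Spl (gN x x0).
  case: (Xcov) => _ _ _ _ /(_ _ _ XA SD) cap1.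
  have xm : e x (g x) \in (A :&: D)%VS.
    rewrite memv_cap gA; apply/gD; exists x; congr (e _ _).
    by rewrite -mulNr opprK divfK.
  have ym : e y (g y) \in (A :&: D)%VS.
    rewrite memv_cap gA; apply/gD; exists y; congr (e _ _).
    by rewrite gxy -mulNr opprK divfK.
  have DE : (A :&: D)%VS = <[e x (g x)]>%VS.
    apply/esym/eqP; rewrite eqEdim -memvE xm cap1 dim_vline.
    rewrite (_ : e x (g x) != 0) //.
    by apply/eqP; rewrite -(e00 fr) => /(e_inj fr)[/eqP]; rewrite (negbTE x0).
  move: ym; rewrite DE => /vlineP[c]; rewrite (eZ fr) => /(e_inj fr)[-> _].
  by rewrite -mulr_algl mulfK // cj_alg.
have gEN x : - T 0 * x + - T 1 * cj 1 x + - T 2 * cj 2 x = - g x.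
  by rewrite gE opprK.
have [||T0 T12] := @linearized_permutation F L hL (- T 0) (- T 1) (- T 2).
- by move=> x x0; rewrite gEN; exact: gN.
- by move=> x y x0 y0; rewrite !gEN; exact: gI.
(* Evaluation at x = 1 gives norm 1 for the sum of the two remaining coefficients, one of which is
   0. *)
have g1 : norm_one (- T 1 + - T 2).
  have := gN 1 (oner_neq0 _); rewrite gE opprK divr1 T0 !rmorph1 !mulr1.
  by rewrite add0r.
case: T12 => Ti; [exists (- T 2); [|right] | exists (- T 1); [|left]].
- by move: g1; rewrite Ti add0r.
- by move=> v; split=> [/gr|] [x ->]; [exists x|apply/gr; exists x];
    rewrite gE T0 Ti !mul0r !add0r !mulNr.
- by move: g1; rewrite Ti addr0.
by move=> v; split=> [/gr|] [x ->]; [exists x|apply/gr; exists x];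
  rewrite gE T0 Ti !mul0r add0r addr0 !mulNr.
Qed.

(** Planes of different types would meet: c x^q = d x^(q^2) is solved by x^q = w, where c / d =
    w^(q-1). *)
Lemma cover_graph_cover : graph_cover 1 X \/ graph_cover 2 X.
Proof.
have [X1|nX1] := pselect (graph_cover 1 X); [by left | right=> A XA].
have [c cN [cA|cA]] := cover_graph XA; last by exists c.
exfalso; apply: nX1 => D XD.
have [d dN [dD|dD]] := cover_graph XD; first by exists d.
have [AD|/eqP AD] := eqVneq A D; first by exists c; rewrite // -AD.
case: (Xcov) => _ _ /(_ _ _ XA XD AD) cap0 _ _.
have [w w0 cdw] := norm_oneV cN dN; have [x xw] := cj_surj hL 1 w.
have x0 : x != 0 by rewrite -(cj_eq0 1) xw.
have : e x (- c * cj 1 x) \in (A :&: D)%VS.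
  rewrite memv_cap; apply/andP; split; first by apply/cA; exists x.
  apply/dD; exists x; congr (e _ _).
  rewrite (_ : cj 2 x = cj 1 w); last by rewrite -xw (cjD hL) ord11.
  have d0 := norm_one_neq0 dN.
  have -> : c = cj 1 w / w * d by rewrite -cdw divfK.
  by rewrite xw !mulNr mulrAC divfK // mulrC.
rewrite cap0 memv0 -(e00 fr) => /eqP/(e_inj fr)[/eqP].
by rewrite (negbTE x0).
Qed.

(** The point e (1, -c) lies in a splash plane, hence in a plane of X, and it determines the
    parameter of that plane. *)
Lemma graph_cover_full i c : graph_cover i X -> norm_one c ->
  exists2 A, X A & graph_of e (fun x => - c * cj i x) A.
Proof.
move=> Xi cN; have [D SD gD] := graph_Spl cN.
case: (Xcov) => _ _ _ cov _.
have v0 : e 1 (- c) != 0.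
  by apply/eqP; rewrite -(e00 fr) => /(e_inj fr)[/eqP]; rewrite oner_eq0.
have pv : points <[e 1 (- c)]>%VS by rewrite /points /= dim_vline v0.
have [A XA] : exists2 A, X A & (<[e 1 (- c)]> <= A)%VS.
  by apply/(cov _ pv); exists D; rewrite // -memvE; apply/gD; exists 1; rewrite mulr1.
rewrite -memvE => vA; have [d dN dA] := Xi _ XA; exists A => //.
have /dA[x /(e_inj fr)[<-]] := vA; rewrite rmorph1 mulr1 => /oppr_inj->.
exact: dA.
Qed.
End Cover.

Lemma graph_cover_uniq i X Y : is_cover Sinf Spl X -> is_cover Sinf Spl Y ->
  graph_cover i X -> graph_cover i Y -> X = Y.
Proof.
move=> Xc Yc Xi Yi; apply/seteqP; split=> A.
  move=> /Xi[c cN cA]; have [D YD cD] := graph_cover_full Yc Yi cN.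
  by rewrite (graph_of_inj cA cD).
move=> /Yi[c cN cA]; have [D YD cD] := graph_cover_full Xc Xi cN.
by rewrite (graph_of_inj cA cD).
Qed.
End Covers.

(** * Sublines, the tangent cover and special conics in a chart *)

Section CoordinatizedSubplane.
Variables (F : finFieldType) (L : fieldExtType F).
Hypothesis hL : \dim {:L} = 3%N.
Variables (Sinf : {vspace 'rV[F]_7}) (p0 : 'rV[F]_7).
Variables (e : L -> L -> 'rV[F]_7) (G H : 'I_3 -> 'rV[L]_7).
Hypothesis fr : frame Sinf p0 e G H.
Hypothesis hSinf : hyperplanes Sinf.
Variables (linf : {vspace 'rV[L]_3}) (S : set {vspace 'rV[F]_7}).
Variables (bb : {vspace 'rV[L]_3} -> {vspace 'rV[F]_7}) (pi : set {vspace 'rV[L]_3}).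
Hypothesis S_planes : forall A, S A -> planes A.
Hypothesis S_graph : forall A, S A ->
  (exists c, graph_of e (fun x => c * x) A) \/ (forall y, e 0 y \in A).
Hypothesis graph_S : forall c, exists2 A, S A & graph_of e (fun x => c * x) A.
Hypothesis splash_graph : forall A, (bb @` splash pi linf) A ->
  exists2 u : L, norm_one u & graph_of e (fun x => - u * x) A.
Hypothesis graph_splash : forall u : L, norm_one u ->
  exists2 A, (bb @` splash pi linf) A & graph_of e (fun x => - u * x) A.
Variable pp : L -> {vspace 'rV[L]_3}.
Hypothesis pi_pp : forall x : L, x != 0 -> pi (pp x).
Hypothesis bb_pp : forall x : L, x != 0 ->
  bb (pp x) = <[(p0 + e (cj 1 x / x) (cj 2 x / x))%R]>%VS.
Hypothesis pp_line : forall x1 x2 : L, indep x1 x2 ->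
  exists2 m, extended_line pi m & forall P, subline pi m P <->
    exists s t : F, (s, t) <> (0, 0) /\ P = pp (s *: x1 + t *: x2).

Local Notation q := #|F|%N.

Lemma cubic_points_bb_set (B : 'M[F]_(4, 7)) (C : set {vspace 'rV[L]_3})
    (Q : F -> F -> {vspace 'rV[L]_3}) :
  (forall P, C P <-> exists s t : F, (s, t) <> (0, 0) /\ P = Q s t) ->
  (forall s t, (s, t) <> (0, 0) ->
     bb (Q s t) = cubic_point B s t /\ points (cubic_point B s t)) ->
  cubic_points B = bb_set bb C.
Proof.
move=> CQ bQ; apply/seteqP; split=> P.
  case=> s [t [st ->]]; have [bE pt] := bQ s t st; split=> //.
  by exists (Q s t); [apply/CQ; exists s, t | rewrite bE].
case=> pP [_ /CQ[s [t [st ->]]]]; have [-> pt] := bQ s t st => PB.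
exists s, t; split=> //; apply/eqP; rewrite eqEdim PB.
by move: pP pt; rewrite /points /= => -> ->.
Qed.

Lemma affine_point x y : points <[p0 + e x y]>%VS.
Proof.
rewrite /points /= dim_vline; case: eqP => // E.
have := affine_in fr 1 x y; rewrite scale1r E mem0v => /esym.
by rewrite oner_eq0.
Qed.

Section Cubics.
Variables (x1 x2 : L).
Hypothesis ind : indep x1 x2.
Local Notation lf := (conj_form x1 x2).

(** Multiplying (x_1/x, x_2/x) by the norm x x_1 x_2 gives (x_1^2 x_2, x_2^2 x_1). *)
Lemma subline_cubic_exists m :
  (forall P, subline pi m P <->
    exists s t : F, (s, t) <> (0, 0) /\ P = pp (s *: x1 + t *: x2)) ->
  exists2 B, cubic_along p0 G H x1 x2 1 2 2 1 B & subline_cubic Sinf S bb pi m B.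
Proof.
move=> mE; have [B hB] := exists_cubic hL fr x1 x2 1 2 2 1.
have hjk : [/\ (2 : 'I_3) - 1 != 0, (1 : 'I_3) - 2 != 0 & (2 : 'I_3) - 1 != 1 - 2] by [].
have ptE := cubic_pointE hL fr ind hB.
exists B => //; split.
  apply: (special_cubic hL fr ind hB hjk (m := 0)).
  - move=> A /S_graph[[c cA]|A0]; [left; exists c | by right].
    by move=> v; rewrite cA; split=> -[x ->]; exists x; rewrite cj0.
  (* G_i and H_i carry l_(i+1)^2 l_(i+2) and l_(i+2)^2 l_(i+1), both divisible by l_a unless i =
     a. *)
  - by move=> a; exists a => i; case: (ord3P a) => ->; case: (ord3P i) => ->;
      split=> // _; first [left; exact/val_inj | right; exact/val_inj].
  (* The slope forced by the relation between the three forms, multiplied by l_1 l_2. *)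
  pose c : L := - (ldet (lf 2) (lf 0) / ldet (lf 0) (lf 1)).
  have [A SA gA] := graph_S c; exists A => //.
  apply: (plane_in_cubic_solid hSinf) => //.
  - exact: (cubic_row_free hL fr ind hB hjk).
  - exact: S_planes.
  move=> v /mem_cubic_solid[w ->]; have [n [nE ->]] := mulmx_cubic hL fr hB w.
  rewrite (affine_in fr) => /eqP n0; rewrite n0 scale0r add0r.
  apply/gA; eexists; congr (e _ _).
  rewrite n0 scale0r in nE.
  have d01 : ldet (lf 0) (lf 1) != 0 by exact: ldet_conj.
  have := cubic_pair_plucker (map_mx (in_alg L) w) (lf 0) (lf 1) (lf 2) (lf 1) (lf 2).
  rewrite (_ : cubic_pair _ (lf 1) (lf 2) (lf 0) = 0); last first.
    by rewrite nE !cubic_pairE; ring.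
  rewrite (_ : cubic_pair _ (lf 1) (lf 2) (lf 1) =
    cubic_pair (map_mx (in_alg L) w) (lf 1) (lf 1) (lf 2)); last exact: cubic_pairAC.
  rewrite (_ : cubic_pair _ (lf 1) (lf 2) (lf 2) =
    cubic_pair (map_mx (in_alg L) w) (lf 2) (lf 2) (lf 1)); last first.
    by rewrite !cubic_pairE; ring.
  rewrite mulr0 add0r addrC => /eqP; rewrite addr_eq0 => /eqP pl.
  by apply: (mulfI d01); rewrite pl /c mulNr mulrN mulrA [_ * (_ / _)]mulrC divfK.
apply: (cubic_points_bb_set mE) => s t st; rewrite (ptE _ _ st).
split; last exact: affine_point.
have x0 := indep_neq0 ind st; rewrite bb_pp //.
move: (s *: x1 + t *: x2) x0 => y y0.
by congr <[_ + e _ _]>%VS; rewrite /nrm cj0; field; rewrite !cj_eq0 y0.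
Qed.

Lemma conic_cubic_exists (C : set {vspace 'rV[L]_3}) X :
  is_cover Sinf (bb @` splash pi linf) X -> graph_cover e 1 X ->
  (forall P, C P <->
    exists s t : F, (s, t) <> (0, 0) /\ P = pp (s *: x1 + t *: x2)^-1) ->
  exists B : 'M[F]_(4, 7),
    special_twisted_cubic L Sinf X B /\ cubic_points B = bb_set bb C.
Proof.
move=> Xcov X1 CE; have [B hB] := exists_cubic hL fr x1 x2 0 2 0 1.
have hjk : [/\ (2 : 'I_3) - 0 != 0, (1 : 'I_3) - 0 != 0 & (2 : 'I_3) - 0 != 1 - 0] by [].
have ptE := cubic_pointE hL fr ind hB.
exists B; split.
  apply: (special_cubic hL fr ind hB hjk (m := 1)).
  - by move=> A /X1[c _ cA]; left; exists (- c).
  (* G_i and H_i carry l_i^2 l_(i+2) and l_i^2 l_(i+1). The form l_(a+1) divides the former unless i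
     = a and the latter unless i = a - 1. *)
  - by move=> a; exists (a + 1) => i; case: (ord3P a) => ->; case: (ord3P i) => ->;
      split=> // _; first [left; exact/val_inj | right; exact/val_inj].
  have d0 i j : i != j -> ldet (lf i) (lf j) != 0 by exact: ldet_conj.
  (* The slope forced by the relation multiplied by l_0 l_1. It has norm 1, since its numerator is
     the conjugate of its denominator. *)
  pose c : L := ldet (lf 2) (lf 0) / ldet (lf 1) (lf 2).
  have cN : norm_one c.
    exists (ldet (lf 1) (lf 2)); first exact: d0.
    congr (_ / _); rewrite /ldet /= rmorphB !rmorphM /= !(cjD hL).
    by rewrite ord11 ord12.
  have [A XA gA] := graph_cover_full fr graph_splash Xcov X1 cN; exists A => //.
  have [_ /(_ _ XA)[Ap _] _ _ _] := Xcov.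
  apply: (plane_in_cubic_solid hSinf) => //.
    exact: (cubic_row_free hL fr ind hB hjk).
  move=> v /mem_cubic_solid[w ->]; have [n [nE ->]] := mulmx_cubic hL fr hB w.
  rewrite (affine_in fr) => /eqP n0; rewrite n0 scale0r add0r.
  apply/gA; eexists; congr (e _ _).
  rewrite n0 scale0r in nE.
  rewrite cj_cubic_pair //.
  have d12 : ldet (lf 1) (lf 2) != 0 by exact: d0.
  have := cubic_pair_plucker (map_mx (in_alg L) w) (lf 0) (lf 1) (lf 2) (lf 0) (lf 1).
  rewrite -nE mulr0 addr0.
  rewrite (_ : cubic_pair _ (lf 0) (lf 1) (lf 0) =
    cubic_pair (map_mx (in_alg L) w) (lf 0) (lf 0) (lf 1)); last exact: cubic_pairAC.
  rewrite (_ : cubic_pair _ (lf 0) (lf 1) (lf 1) =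
    cubic_pair (map_mx (in_alg L) w) (lf 1) (lf 1) (lf 0)); last first.
    by rewrite !cubic_pairE; ring.
  move=> /eqP; rewrite addr_eq0 => /eqP pl.
  by apply: (mulfI d12); rewrite pl /c addr0 ord12 mulNr mulrN mulrA [_ * (_ / _)]mulrC divfK.
apply: (cubic_points_bb_set CE) => s t st; rewrite (ptE _ _ st).
split; last exact: affine_point.
have x0 := indep_neq0 ind st; rewrite bb_pp ?invr_eq0 //.
move: (s *: x1 + t *: x2) x0 => y y0.
have y1 : cj 1 y != 0 by rewrite cj_eq0.
have y2 : cj 2 y != 0 by rewrite cj_eq0.
rewrite /nrm !cj0 !fmorphV /=; move: (cj 1 y) (cj 2 y) y1 y2 => a b a0 b0.
by congr <[_ + e _ _]>%VS; field; rewrite oner_neq0 y0 a0 b0.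
Qed.
End Cubics.

(** If the tangent directions lay in a plane y = - c x_1, then d_2 - d = - c (d_2 - d_1). The
    tangent plane, and hence c, is the same for all d, so this would be a linear relation between
    the conjugates in which d has coefficient -1. *)
Lemma tangent_cover_graph T : tangent_cover linf Sinf S bb pi T ->
  ~ graph_cover e 1 T.
Proof.
case=> Tcov /(_ _ (pi_pp (oner_neq0 _)))[TT [_ TTl] [A TA capA]] T1.
have [c _ cA] := T1 _ TA.
have dE (d : L) : cj 2 d - d = - c * (cj 2 d - cj 1 d).
  (* For d in F both sides vanish; otherwise the subline through [pp 1] and [pp d] provides the
     tangent. *)
  have [d1|d1] := eqVneq (cj 1 d) d.
    by rewrite -ord11 -(cjD hL) !d1 subrr mulr0.
  have ind : indep 1 d by rewrite /indep rmorph1 !mul1r eq_sym.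
  have [m mext mE] := pp_line ind.
  have [B hB Bm] := subline_cubic_exists ind mE.
  have pt10 : (1, 0) <> (0, 0) :> F * F by case=> /eqP; rewrite oner_eq0.
  have pm : (pp 1 <= m)%VS.
    have /mE[] // : exists s t : F, (s, t) <> (0, 0) /\ pp 1 = pp (s *: 1 + t *: d).
    by exists 1, 0; rewrite scale0r addr0 scale1r.
  have tan : tangent_at B (bb (pp 1)) (cubic_tangent B 1 0).
    exists 1, 0; split=> //; rewrite (cubic_pointE hL fr ind hB pt10).
    rewrite bb_pp ?oner_eq0 // scale0r addr0 scale1r /nrm !rmorph1.
    by rewrite !mulr1 divr1.
  have /subvP lT := TTl _ _ _ mext pm Bm tan.
  have mom (w : 'rV[F]_4) : w \in [:: moment 1 0; moment_dt 1 0] -> w *m B \in TT.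
    rewrite !inE => w01; apply/lT/memv_span; rewrite !inE.
    by case/orP: w01 => /eqP->; rewrite eqxx ?orbT.
  have := mom (moment 1 0); rewrite !inE eqxx /= => /(_ isT).
  have [n0 [n0E ->]] := mulmx_cubic hL fr hB (moment 1 0) => m0.
  have := mom (moment_dt 1 0); rewrite !inE eqxx orbT /= => /(_ isT).
  have [n1 [n1E ->]] := mulmx_cubic hL fr hB (moment_dt 1 0) => m1.
  have p0E l l' l'' : cubic_pair (map_mx (in_alg L) (moment 1 0)) l l' l'' =
      l.1 * l'.1 * l''.1.
    by rewrite cubic_pairE !mxE /= !expr1n !expr0n !mulr0 !scale0r !mulr1 !scale1r; ring.
  have p1E l l' l'' : cubic_pair (map_mx (in_alg L) (moment_dt 1 0)) l l' l'' =
      l.1 * l'.1 * l''.2 + l.1 * l'.2 * l''.1 + l.2 * l'.1 * l''.1.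
    rewrite cubic_pairE !mxE /= !expr1n !expr0n !mul0r !mulr0 !scale0r.
    by rewrite !mulr1 !scale1r; ring.
  move: n0E n1E m0 m1; rewrite !p0E !p1E /= !rmorph1 !mul1r !mulr1 cj0 => n0E n1E m0 m1.
  have n01 : n0 = 1.
    by apply: (@fmorph_inj _ _ (in_alg L)); rewrite /= n0E scale1r.
  (* Here n1 is the trace of d; subtracting that multiple of the point moves the derivative into
     Sinf. *)
  have TTv : - n1 *: (n0 *: p0 + e 1 1) + (n1 *: p0 +
      e (cj 2 d + cj 1 d + cj 1 d) (cj 1 d + cj 2 d + cj 2 d)) \in TT.
    by rewrite rpredD ?rpredZ.
  move: TTv; rewrite (affineZ fr) (affineD fr) n01 mulr1 addNr => TTv.
  have : 0 *: p0 + e (- n1 *: 1 + (cj 2 d + cj 1 d + cj 1 d))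
      (- n1 *: 1 + (cj 1 d + cj 2 d + cj 2 d)) \in (TT :&: Sinf)%VS.
    by rewrite memv_cap TTv (affine_in fr) eqxx.
  move/(subvP capA); rewrite scale0r add0r scaleNr n1E => /cA[x /(e_inj fr)[<-]].
  rewrite !(rmorphD, rmorphN) /= !(cjD hL) ord11 ord12 cj0 => E.
  transitivity (- (cj 2 d + cj 1 d + d) + (cj 1 d + cj 2 d + cj 2 d)); first by ring.
  by rewrite E; congr (_ * _); ring.
have f0 (i : 'I_3) : [:: -1; - c; 1 + c]`_i = 0 :> L.
  apply: (cj_free hL (c := fun i => [:: -1; - c; 1 + c]`_(nat_of_ord i))) => d.
  rewrite !big_ord_recl big_ord0 /= addr0 cj0.
  rewrite (_ : lift ord0 ord0 = 1); last exact/val_inj.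
  rewrite (_ : lift ord0 _ = 2); last exact/val_inj.
  transitivity (cj 2 d - d - - c * (cj 2 d - cj 1 d)); first by ring.
  by rewrite dE subrr.
by move/eqP: (f0 0); rewrite /= oppr_eq0 oner_eq0.
Qed.

(** By the classification the tangent cover has type 2. A cover of a given type is unique, so a
    cover different from it has type 1. *)
Lemma special_conic_cubic CC (C : set {vspace 'rV[L]_3}) (x1 x2 : L) :
  conic_cover linf Sinf S bb pi CC -> indep x1 x2 ->
  (forall P, C P <->
    exists s t : F, (s, t) <> (0, 0) /\ P = pp (s *: x1 + t *: x2)^-1) ->
  exists B : 'M[F]_(4, 7),
    special_twisted_cubic L Sinf CC B /\ cubic_points B = bb_set bb C.
Proof.
case=> CCcov [T Tt CT] ind CE; apply: (conic_cubic_exists ind CCcov) => //.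
have [Tcov _] := Tt; have nT1 := tangent_cover_graph Tt.
have cg := cover_graph_cover hL fr hSinf splash_graph graph_splash.
have T2 : graph_cover e 2 T by case: (cg _ Tcov).
case: (cg _ CCcov) => // C2; exfalso; apply: CT.
exact: (graph_cover_uniq fr graph_splash CCcov Tcov C2 T2).
Qed.
End CoordinatizedSubplane.

(** * Coordinates for the Bruck-Bose representation *)

Lemma prime_subfield_nat (F : finFieldType) p (x : F) : p \in [pchar F] ->
  x ^+ p = x -> exists m : nat, x = m%:R.
Proof.
move=> pF xp; have p_pr := pcharf_prime pF.
have : (x : pPrimeCharType pF) \in 1%VS.
  by rewrite (Fermat's_little_theorem 1%AS) dimv1 expn1 card_Fp //; apply/eqP.
by case/vlineP=> c xE; exists c; rewrite [LHS]xE; exact: mulr1.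
Qed.

(** * Extending a field morphism from F to L *)

Section MorphismExtension.
Variables (F : finFieldType) (L : fieldExtType F) (sg : {rmorphism F -> L}).

Local Notation q := #|F|%N.

(* The polynomial with roots w^(p^k), for a generator w of the multiplicative group,
   has coefficients in the prime field, so sg w is one of its roots in L. *)
Lemma finField_morphism_pow p : p \in [pchar F] ->
  exists k : nat, forall c, sg c = c%:A ^+ (p ^ k).
Proof.
move=> pF; have q1 := finNzRing_gt1 F.
have [w wP] : exists w : F, q.-1.-primitive_root w.
  have: has q.-1.-primitive_root (filter (predC1 0) (enum F)).
    apply: has_prim_root; first by rewrite -ltnS prednK // ltnW.
    - apply/allP=> x; rewrite mem_filter /= => /andP[x0 _]; apply/unity_rootP.
      by apply: (mulIf x0); rewrite -exprSr prednK ?expf_card ?mul1r // ltnW.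
    - by rewrite filter_uniq ?enum_uniq.
    rewrite size_filter; have := count_predC (pred1 0) (enum F).
    by rewrite (count_uniq_mem 0 (enum_uniq F)) mem_enum /= -cardT => <-.
  by case/hasP=> w _ wP; exists w.
have qE : q = (p ^ logn p q)%N := card_primeChar pF.
have n0 : (0 < logn p q)%N by case: (logn p q) qE q1 => // ->.
move: (logn p q) qE n0 => n qE n0.
pose P : {poly F} := \prod_(k < n) ('X - (w ^+ (p ^ k))%:P).
(* The p-th power shifts the roots cyclically, because w^(p^n) = w^q = w. *)
have PF : map_poly (pFrobenius_aut pF) P = P.
  rewrite /P rmorph_prod /=.
  under eq_bigr do rewrite map_polyXsubC /= pFrobenius_autE -exprM -expnSr.
  case: n n0 qE @P => // n _ qE P.
  rewrite big_ord_recr [RHS]big_ord_recl /= mulrC -qE expf_card expn0 expr1.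
  by congr (_ * _).
have sgP : map_poly sg P = map_poly (in_alg L) P.
  apply/polyP=> i; rewrite !coef_map /=.
  have [m ->] : exists m : nat, P`_i = m%:R.
    apply: (prime_subfield_nat pF); rewrite -pFrobenius_autE.
    by rewrite -[in RHS]PF coef_map.
  by rewrite rmorph_nat -[RHS]/(in_alg L m%:R) rmorph_nat.
have : (map_poly sg P).[sg w] = 0.
  rewrite horner_map /P horner_prod (bigD1 (Ordinal n0)) //=.
  by rewrite expn0 expr1 hornerXsubC subrr mul0r rmorph0.
rewrite sgP /P rmorph_prod horner_prod => /eqP/prodf_eq0[k _].
rewrite /= map_polyXsubC hornerXsubC subr_eq0 => /eqP sgw.
exists k => c; have [->|c0] := eqVneq c 0.
  by rewrite rmorph0 scale0r expr0n expn_eq0 -leqn0 leqNgt prime_gt0 ?(pcharf_prime pF).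
have [i ->] : exists i : 'I_(q.-1), c = w ^+ i.
  have c1 : c ^+ q.-1 = 1.
    by apply: (mulIf c0); rewrite -exprSr prednK ?expf_card ?mul1r // ltnW.
  by have [i ->] := prim_rootP wP c1; exists i.
rewrite rmorphXn /= sgw -[LHS]/(in_alg L (w ^+ (p ^ k)) ^+ i).
by rewrite -[RHS]/(in_alg L (w ^+ i) ^+ (p ^ k)) -!rmorphXn -!exprM mulnC.
Qed.

Lemma extend_morphism : \dim {:L} = 3%N -> exists tau : {rmorphism L -> L},
  (forall y, exists x, tau x = y) /\ (forall c : F, tau c%:A = sg c).
Proof.
move=> hL; have [p p_pr pF] := finPcharP F.
have [k sgE] := finField_morphism_pow pF.
have pL : p \in [pchar L] by rewrite (pchar_lalg L).
have tauB : zmod_morphism (fun x : L => x ^+ (p ^ k)).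
  have pnat : ([pchar L]).-nat (p ^ k)%N.
    by rewrite pnatX (eq_pnat _ (pcharf_eq pL)) pnat_id ?p_pr.
  by move=> x y; have := exprDn_pchar (x - y) y pnat; rewrite subrK => ->; rewrite addrK.
have tauM : monoid_morphism (fun x : L => x ^+ (p ^ k)).
  by split=> [|x y]; rewrite ?expr1n ?exprMn.
pose tau : {rmorphism L -> L} := HB.pack (fun x : L => x ^+ (p ^ k))
  (GRing.isZmodMorphism.Build L L _ tauB) (GRing.isMonoidMorphism.Build L L _ tauM).
exists tau; split=> [y|c]; last by rewrite sgE.
have qE : q = (p ^ logn p q)%N := card_primeChar pF.
have per m : y ^+ (p ^ (logn p q * 3 * m)) = y.
  rewrite expnM (expnM p _ 3) -qE; elim: m => [|m IH]; first by rewrite expn0 expr1.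
  by rewrite expnSr exprM IH (expr_card3 hL).
have n0 : (0 < logn p q)%N by case: (logn p q) qE (finNzRing_gt1 F) => // ->.
(* The inverse of the p^k-th power: 3 [logn p q] is the degree of L over the prime field, and its
   k-fold multiple keeps the subtraction from truncating. *)
exists (y ^+ (p ^ (logn p q * 3 * k - k))); rewrite /= -exprM -expnD subnK ?per //.
by rewrite leq_pmull // muln_gt0 n0.
Qed.
End MorphismExtension.

(** * Existence of a frame *)

Section ExistsFrame.
Variables (F : finFieldType) (L : fieldExtType F).
Hypothesis hL : \dim {:L} = 3%N.
Variables (Sinf : {vspace 'rV[F]_7}) (p0 : 'rV[F]_7) (e : L -> L -> 'rV[F]_7).
Hypothesis e_lin : forall (c : F) x y x' y',
  e (c *: x + x') (c *: y + y') = c *: e x y + e x' y'.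
Hypothesis e_eq0 : forall x y, e x y = 0 -> x = 0 /\ y = 0.
Hypothesis e_Sinf : forall v, v \in Sinf <-> exists x y, v = e x y.
Hypothesis p0_Sinf : p0 \notin Sinf.

Local Notation emb := (map_mx (in_alg L)).

Lemma cj_coef_eq0 (T : 'I_3 -> 'rV[L]_7) :
  (forall x, \sum_i cj i x *: T i = 0) -> forall i, T i = 0.
Proof.
move=> T0 i; apply/eqP; rewrite -memv0; move: i.
by apply: (mem_cj_coef hL) => x; rewrite T0 mem0v.
Qed.

(** The vectors u x are fixed by Frobenius. Comparing their expansion with its conjugate, and
    uniqueness of the coefficients, shows that Frobenius permutes the G_i. *)
Lemma cj_representation (u : L -> 'rV[F]_7) :
  (forall (c : F) x y, u (c *: x + y) = c *: u x + u y) ->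
  exists2 G : 'I_3 -> 'rV[L]_7,
    forall x, emb (u x) = \sum_i cj i x *: G i &
    forall i j, map_mx (cj j) (G i) = G (i + j).
Proof.
move=> ulin; have [eps [mu [_ rep]]] := cj_dual hL.
have {rep} := rep _ (fun x => emb (u x)).
have embL (c : F) x y : emb (u (c *: x + y)) = (c%:A : L) *: emb (u x) + emb (u y).
  by rewrite ulin map_mxD map_mxZ.
move=> /(_ embL).
pose G i := \sum_k mu i k *: emb (u (eps 0 k)) => repG.
exists G => [x|]; first exact: repG.
have frobG i : map_mx (cj 1) (G i) = G (i + 1).
  apply/eqP; rewrite -subr_eq0; apply/eqP.
  rewrite -{1}(addrK 1 i); move: (i + 1) => {}i.
  move: i; apply: cj_coef_eq0 => x.
  under eq_bigr do rewrite scalerBr.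
  rewrite big_split sumrN /= -[X in _ - X]repG.
  rewrite (reindex (fun i => i + 1)) /=; last first.
    by exists (fun i => i - 1) => i _; rewrite ?subrK ?addrK.
  apply/eqP; rewrite subr_eq0; apply/eqP.
  transitivity (map_mx (cj 1) (emb (u x))); last first.
    by apply/rowP=> l; rewrite !mxE cj_alg.
  rewrite repG raddf_sum /=; apply: eq_bigr => i _.
  by rewrite addrK map_mxZ /= (cjD hL) addrC.
move=> i j; case: (ord3P j) => ->.
- by rewrite addr0; apply/rowP=> l; rewrite mxE cj0.
- exact: frobG.
rewrite -ord11 addrA -!frobG; apply/rowP=> l.
by rewrite !mxE (cjD hL).
Qed.

(* Applying Frobenius to a multiple of a dependency and summing up gives one with
   coefficients t, x_0, x_1, x_2, y_0, y_1, y_2, i.e. t p0 + e (x, y) = 0. *)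
Lemma exists_frame : exists G H, frame Sinf p0 e G H.
Proof.
have [|G GE GF] := @cj_representation (e^~ 0).
  by move=> c x y; rewrite -e_lin scaler0 addr0.
have [|H HE HF] := @cj_representation (e 0).
  by move=> c x y; rewrite -e_lin scaler0 addr0.
have eE x y : emb (e x y) = fvec p0 G H 0 (cj^~ x) (cj^~ y).
  have -> : e x y = e x 0 + e 0 y.
    by have := e_lin 1 x 0 0 y; rewrite !scale1r addr0 add0r.
  by rewrite map_mxD GE HE /fvec scale0r add0r.
exists G, H; split=> // n a b nab.
(* When Frobenius shifts vectors T_i, this is the coefficient at T_0 in the sum of the conjugates of
   l (sum_i c_i T_i); for constant c it is a trace. *)
pose tr (c : 'I_3 -> L) l := \sum_j cj j (l * c (- j)).
have tr0 c : (forall l, tr c l = 0) -> forall i, c i = 0.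
  move=> c0 i; have : cj (- i) (c i) = 0.
    rewrite -{2}(opprK i); move: (- i) => {}i; move: i.
    apply: (cj_free hL) => x; rewrite -[RHS](c0 x).
    by apply: eq_bigr => j _; rewrite rmorphM mulrC.
  by move/eqP; rewrite cj_eq0 => /eqP.
have cj_tr c l k : cj k (tr c l) = \sum_j cj j (l * c (k - j)).
  rewrite rmorph_sum [RHS](reindex (fun j => k + j)) /=; last first.
    by exists (fun j => - k + j) => j _; rewrite ?addKr ?addNKr.
  by apply: eq_bigr => j _; rewrite (cjD hL) opprD addrA subrr add0r.
have sum_conj (c : 'I_3 -> L) (T : 'I_3 -> 'rV[L]_7) l :
    (forall i j, map_mx (cj j) (T i) = T (i + j)) ->
    \sum_j map_mx (cj j) (\sum_i (l * c i) *: T i) = \sum_k cj k (tr c l) *: T k.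
  move=> TF; transitivity (\sum_j \sum_k cj j (l * c (k - j)) *: T k).
    apply: eq_bigr => j _; rewrite raddf_sum (reindex (fun i => i - j)) /=; last first.
      by exists (fun i => i + j) => i _; rewrite ?subrK ?addrK.
    by apply: eq_bigr => i _; rewrite map_mxZ /= TF subrK.
  by rewrite exchange_big; apply: eq_bigr => k _; rewrite cj_tr scaler_suml.
have key l : exists2 t : F, t%:A = tr (fun=> n) l & t *: p0 + e (tr a l) (tr b l) = 0.
  have [t tE] : exists t : F, tr (fun=> n) l = t%:A by apply: cj_fixed; rewrite cj_tr.
  exists t => //; apply: (@emb_inj F L); rewrite map_mxD map_mxZ eE map_mx0.
  transitivity (\sum_j map_mx (cj j) (l *: fvec p0 G H n a b)); last first.
    by rewrite nab scaler0 big1 // => j _; rewrite map_mx0.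
  under [RHS]eq_bigr do rewrite fvecZ /fvec !map_mxD map_mxZ /=.
  rewrite !big_split /fvec scale0r add0r addrA /=; congr (_ + _ + _).
  - rewrite -tE scaler_suml; apply: eq_bigr => j _; congr (_ *: _).
    by apply/rowP=> r; rewrite !mxE cj_alg.
  - by rewrite sum_conj.
  by rewrite sum_conj.
have key0 l : [/\ tr (fun=> n) l = 0, tr a l = 0 & tr b l = 0].
  have [t <- te] := key l; have t0 : t = 0.
    apply: contraNeq p0_Sinf => t0; rewrite -[p0](scalerK t0) rpredZ //.
    move/eqP: te; rewrite addr_eq0 => /eqP->; rewrite rpredN.
    by apply/e_Sinf; eexists; eexists.
  move: te; rewrite t0 !scale0r add0r => /e_eq0[-> ->]; by split.
split; first by apply: (tr0 (fun=> n) _ 0) => l; have [] := key0 l.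
by move=> i; split; [move: i; apply: tr0 | move: i; apply: tr0] => l; have [] := key0 l.
Qed.
End ExistsFrame.

(** * Affine charts of the Bruck-Bose map *)

Section AffineChart.
Variables (F : finFieldType) (L : fieldExtType F).
Variables (linf : {vspace 'rV[L]_3}) (Sinf : {vspace 'rV[F]_7}).
Variables (S : set {vspace 'rV[F]_7}) (bb : {vspace 'rV[L]_3} -> {vspace 'rV[F]_7}).
Hypothesis hSinf : hyperplanes Sinf.
Hypothesis hS : regular_spread Sinf S.
Hypothesis hbb : bruck_bose linf Sinf S bb.
Variable Th : 'M[L]_3.
Hypothesis Th_unit : Th \in unitmx.
Hypothesis linfE : forall v, (v \in linf) = ((v *m Th) 0 0 == 0).

Definition row3 (a b c : L) : 'rV[L]_3 := \row_i [:: a; b; c]`_i.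

Definition hpoint (a b c : L) : {vspace 'rV[L]_3} := <[row3 a b c *m invmx Th]>%VS.

Lemma row3E (X : 'rV[L]_3) : X = row3 (X 0 0) (X 0 1) (X 0 2).
Proof.
apply/rowP; case=> [[|[|[|//]]] lti]; rewrite mxE /=; congr (X 0 _); exact/val_inj.
Qed.

Lemma row3_inj a b c a' b' c' : row3 a b c = row3 a' b' c' ->
  [/\ a = a', b = b' & c = c'].
Proof.
move=> /rowP E; have := (E 0, E 1, E 2); rewrite !mxE /=.
by case=> -[-> ->] ->.
Qed.

Lemma row3_eq0 a b c : row3 a b c = 0 -> [/\ a = 0, b = 0 & c = 0].
Proof. by move=> /rowP E; have := (E 0, E 1, E 2); rewrite !mxE /= => -[[-> ->] ->]. Qed.

Lemma row3_comb k l a b c a' b' c' : k *: row3 a b c + l *: row3 a' b' c' =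
  row3 (k * a + l * a') (k * b + l * b') (k * c + l * c').
Proof. by rewrite [LHS]row3E !mxE. Qed.

Lemma row3Z k a b c : k *: row3 a b c = row3 (k * a) (k * b) (k * c).
Proof. by rewrite [LHS]row3E !mxE. Qed.

Lemma hpoint_points a b c : ~~ [&& a == 0, b == 0 & c == 0] -> points (hpoint a b c).
Proof.
move=> abc; rewrite /points /hpoint /= dim_vline; case: eqP => // E.
have: row3 a b c = 0 by rewrite -(mulmxKV Th_unit (row3 a b c)) E mul0mx.
by case/row3_eq0=> a0 b0 c0; rewrite a0 b0 c0 !eqxx in abc.
Qed.

Lemma hpoint_linf a b c : (hpoint a b c <= linf)%VS = (a == 0).
Proof. by rewrite -memvE linfE mulmxKV // mxE. Qed.

Lemma pointsE (P : {vspace 'rV[L]_3}) : points P ->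
  exists a b c, P = hpoint a b c /\ ~~ [&& a == 0, b == 0 & c == 0].
Proof.
move=> dP; have [v vP] : exists v, P = <[v]>%VS.
  have [v vP v0] : exists2 v, v \in P & v != 0.
    by exists (vpick P); rewrite ?memv_pick // vpick0 -dimv_eq0 dP.
  by exists v; apply/esym/eqP; rewrite eqEdim -memvE vP dP dim_vline v0.
exists ((v *m Th) 0 0), ((v *m Th) 0 1), ((v *m Th) 0 2).
rewrite /hpoint -row3E mulmxK //; split=> //.
apply/negP=> /and3P[/eqP a0 /eqP b0 /eqP c0].
have : v *m Th = 0 by rewrite [LHS]row3E a0 b0 c0 [RHS]row3E !mxE.
move/(congr1 (mulmx^~ (invmx Th))); rewrite mulmxK // mul0mx => v0.
by move: dP; rewrite vP v0 /points /= dim_vline eqxx.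
Qed.

Definition apoint (v : L * L) := hpoint 1 v.1 v.2.
Definition ipoint (d : L * L) := hpoint 0 d.1 d.2.
Definition scal (k : L) (d : L * L) : L * L := (k * d.1, k * d.2).

Lemma apoint_inj v w : apoint v = apoint w -> v = w.
Proof.
case: v w => [y z] [y' z'] /= E.
have : row3 1 y z *m invmx Th \in apoint (y', z') by rewrite -E memv_line.
case/vlineP=> k /(congr1 (mulmx^~ Th)).
rewrite -scalemxAl !mulmxKV // row3Z => /row3_inj[].
by rewrite mulr1 => <- -> ->; rewrite !mul1r.
Qed.

Lemma apoint_affine v : points (apoint v) /\ ~ (apoint v <= linf)%VS.
Proof.
split; first by apply: hpoint_points; rewrite oner_eq0.
by rewrite hpoint_linf oner_eq0.
Qed.

Lemma affine_apoint P : points P -> ~ (P <= linf)%VS -> exists v, P = apoint v.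
Proof.
move=> /pointsE[a [b [c [-> _]]]]; rewrite hpoint_linf => /negP a0.
exists (b / a, c / a); rewrite /apoint /hpoint /= -(vlineZ _ (invr_neq0 a0)) scalemxAl.
by rewrite row3Z mulVf // ![a^-1 * _]mulrC.
Qed.

Lemma ipoint_infinite d : d != (0, 0) -> points (ipoint d) /\ (ipoint d <= linf)%VS.
Proof.
case: d => y z d0; split; last by rewrite hpoint_linf.
by apply: hpoint_points; rewrite eqxx.
Qed.

Lemma infinite_ipoint P : points P -> (P <= linf)%VS ->
  exists2 d, d != (0, 0) & P = ipoint d.
Proof.
move=> /pointsE[a [b [c [-> abc]]]]; rewrite hpoint_linf => /eqP a0.
by move: abc; rewrite a0 eqxx => abc; exists (b, c).
Qed.

Lemma bb_ipoint d : d != (0, 0) -> S (bb (ipoint d)).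
Proof. by move=> /ipoint_infinite dp; case: (bb_infinity hbb) => + _ _; apply. Qed.

Lemma S_cap A B u : S A -> S B -> u \in A -> u \in B -> u != 0 -> A = B.
Proof.
move=> SA SB uA uB u0; have [[_ /subvP AS]] := spread_planes hS SA.
have up : points <[u]>%VS by rewrite /points /= dim_vline u0.
have [|D [_ uniqD]] := spread_partition hS up; first by rewrite -memvE AS.
by rewrite -(uniqD A) ?(uniqD B) // -memvE.
Qed.

Lemma ipoint_indep x y u : x.1 * y.2 - x.2 * y.1 != 0 ->
  u \in bb (ipoint x) -> u \in bb (ipoint y) -> u = 0.
Proof.
move=> xy ux uy; apply/eqP/negPn/negP=> u0.
have x0 : x != (0, 0).
  by apply: contraNneq xy => ->; rewrite /= !mul0r subrr.
have y0 : y != (0, 0).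
  by apply: contraNneq xy => ->; rewrite /= !mulr0 subrr.
have E := S_cap (bb_ipoint x0) (bb_ipoint y0) ux uy u0.
have /= {}E : ipoint x = ipoint y.
  case: (bb_infinity hbb) => _ + _; apply=> //; apply/mem_set;
    exact: ipoint_infinite.
have : row3 0 x.1 x.2 *m invmx Th \in ipoint y by rewrite -E memv_line.
case/vlineP=> k /(congr1 (mulmx^~ Th)).
rewrite -scalemxAl !mulmxKV // row3Z => /row3_inj[_ x1 x2].
by move/eqP: xy; apply; rewrite x1 x2; ring.
Qed.

(** p0 is a generator of the image of the origin. It lies outside the hyperplane Sinf, so every
    affine point has a generator in p0 + Sinf. *)
Lemma bb_chart_exists : exists p0 : 'rV[F]_7, exists f : L * L -> 'rV[F]_7,
  [/\ p0 \notin Sinf, forall v, f v \in Sinf, f (0, 0) = 0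
    & forall v, bb (apoint v) = <[p0 + f v]>%VS].
Proof.
have bbA v : points (bb (apoint v)) /\ ~ (bb (apoint v) <= Sinf)%VS.
  by case: (bb_affine hbb) => + _ _; apply; exact: apoint_affine.
pose p0 := vpick (bb (apoint (0, 0))).
have lineE (P : {vspace 'rV[F]_7}) w : points P -> w \in P -> w != 0 -> P = <[w]>%VS.
  by move=> dP wP w0; apply/esym/eqP; rewrite eqEdim -memvE wP dP dim_vline w0.
have pickE (P : {vspace 'rV[F]_7}) : points P -> P = <[vpick P]>%VS.
  by move=> dP; apply: lineE; rewrite ?memv_pick // vpick0 -dimv_eq0 dP.
have p0S : p0 \notin Sinf.
  have [/pickE E nS] := bbA (0, 0); apply/negP=> pS.
  by apply: nS; rewrite E -memvE.
have fullS : (<[p0]> + Sinf)%VS = fullv.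
  apply/eqP; rewrite eqEdim subvf (_ : \dim {:_} = 7%N) ?dimvf //.
  have : (\dim Sinf < \dim (<[p0]> + Sinf))%N.
    rewrite ltn_neqAle dimvS ?addvSr // andbT.
    apply: contra p0S => /eqP dE; have /eqP -> : Sinf == (<[p0]> + Sinf)%VS.
      by rewrite eqEdim addvSr -dE leqnn.
    by apply: (subvP (addvSl _ _)); exact: memv_line.
  by move: hSinf; rewrite /hyperplanes /=; lia.
have chart v : exists s, s \in Sinf /\ bb (apoint v) = <[p0 + s]>%VS.
  have [dP nS] := bbA v; have := memvf (vpick (bb (apoint v))).
  rewrite -fullS => /memv_addP[_ /vlineP[k ->] [s sS E]].
  have k0 : k != 0.
    apply/eqP=> k0; apply: nS; rewrite (pickE _ dP) -memvE E k0 scale0r add0r.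
    exact: sS.
  exists (k^-1 *: s); split; first exact: rpredZ.
  rewrite (pickE _ dP) E -(vlineZ _ (invr_neq0 k0)) scalerDr scalerA mulVf //.
  by rewrite scale1r.
have [f fE] := boolp.choice chart.
exists p0, f; split=> // [v||v]; try by have [] := fE v.
have [fS fl] := fE (0, 0).
have : p0 \in bb (apoint (0, 0)) by exact: memv_pick.
rewrite fl => /vlineP[k]; rewrite scalerDr => E.
have : (1 - k) *: p0 = k *: f (0, 0).
  by rewrite scalerBl scale1r {1}E addrAC subrr add0r.
have [k1|k1] := eqVneq k 1; first by rewrite k1 subrr scale0r scale1r.
move=> E'; move/negP: p0S; case.
rewrite -[p0](scalerK (_ : 1 - k != 0)); last by rewrite subr_eq0 eq_sym.
by rewrite E' !rpredZ.
Qed.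
End AffineChart.

(** * Additivity and semilinearity of the chart *)

Section LinearChart.
Variables (F : finFieldType) (L : fieldExtType F).
Variables (linf : {vspace 'rV[L]_3}) (Sinf : {vspace 'rV[F]_7}).
Variables (S : set {vspace 'rV[F]_7}) (bb : {vspace 'rV[L]_3} -> {vspace 'rV[F]_7}).
Hypothesis hS : regular_spread Sinf S.
Hypothesis hbb : bruck_bose linf Sinf S bb.
Variable Th : 'M[L]_3.
Hypothesis Th_unit : Th \in unitmx.
Hypothesis linfE : forall v, (v \in linf) = ((v *m Th) 0 0 == 0).
Variables (p0 : 'rV[F]_7) (f : L * L -> 'rV[F]_7).
Hypothesis p0_Sinf : p0 \notin Sinf.
Hypothesis f_Sinf : forall v, f v \in Sinf.
Hypothesis f00 : f (0, 0) = 0.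
Hypothesis bb_f : forall v, bb (apoint Th v) = <[p0 + f v]>%VS.

Local Notation ipt := (ipoint Th).
Local Notation apt := (apoint Th).

Lemma affine_span_inj u u' : u \in Sinf -> u' \in Sinf ->
  p0 + u \in <[p0 + u']>%VS -> u = u'.
Proof.
move=> uS uS' /vlineP[k E].
have E' : (1 - k) *: p0 = k *: u' - u.
  apply: (addIr u); rewrite subrK; apply: (addIr (k *: p0)).
  by rewrite scalerBl scale1r addrAC subrK E scalerDr addrC.
have [k1|k1] := eqVneq k 1; first by move: E; rewrite k1 scale1r => /addrI.
move/negP: p0_Sinf; case.
rewrite -[p0](scalerK (_ : 1 - k != 0)); last by rewrite subr_eq0 eq_sym.
by rewrite E' rpredZ // rpredB // rpredZ.
Qed.

Lemma f_inj : injective f.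
Proof.
move=> v w E; apply: (apoint_inj Th_unit).
case: (bb_affine hbb) => _ + _; apply; try exact/mem_set/(apoint_affine Th_unit linfE).
by rewrite !bb_f E.
Qed.

Lemma f_surj s : s \in Sinf -> exists v, f v = s.
Proof.
move=> sS; have nS : p0 + s \notin Sinf.
  by apply: contra p0_Sinf => pS; rewrite -(addrK s p0) rpredB.
have pt : points <[p0 + s]>%VS /\ ~ (<[p0 + s]> <= Sinf)%VS.
  rewrite /points /= dim_vline -memvE; split; last exact/negP.
  by case: eqP nS => // ->; rewrite mem0v.
case: (bb_affine hbb) => _ _ /(_ _ pt)[P /= [dP nP]] bP.
have [v vE] := affine_apoint Th_unit linfE dP nP.
exists v; apply: affine_span_inj => //.
by rewrite -bP vE bb_f memv_line.
Qed.

(* The affine line through v in direction d corresponds to the solid spanned by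
   p0 + f v and the spread element bb (ipoint d). *)
Lemma f_parallel (v w d : L * L) : d != (0, 0) ->
  (exists k, w = (v.1 + k * d.1, v.2 + k * d.2)) <-> f w - f v \in bb (ipt d).
Proof.
move=> d0; have [di dl] := ipoint_infinite Th_unit linfE d0.
have [dSp dS] := spread_planes hS (bb_ipoint hbb Th_unit linfE d0).
pose m := (apt v + ipt d)%VS.
have [av nav] := apoint_affine Th_unit linfE v.
have nm : m <> linf by move=> E; apply: nav; rewrite -E addvSl.
have m2 : lines m.
  have := dimv_sum_cap (apt v) (ipt d); rewrite /lines /= -/m av di.
  suff -> : (apt v :&: ipt d)%VS = 0%VS by rewrite dimv0 addn0.
  apply/eqP; rewrite -dimv_eq0; move: (dimvS (capvSl (apt v) (ipt d))).
  rewrite av leq_eqVlt ltnS leqn0 => /orP[/eqP c1|//].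
  case: nav; apply: subv_trans dl; apply/capv_idPl/eqP.
  by rewrite eqEdim capvSl av c1 leqnn.
have [U [U4 nU _] mU] := bb_line hbb m2 nm.
have dU : (bb (ipt d) <= U)%VS by apply/mU; rewrite ?addvSr.
have capU : (U :&: Sinf)%VS = bb (ipt d).
  have ltU : (\dim (U :&: Sinf) < \dim U)%N.
    rewrite ltn_neqAle dimvS ?capvSl // andbT; apply/eqP=> cE; apply: nU.
    by apply/capv_idPl/eqP; rewrite eqEdim capvSl cE leqnn.
  by apply/esym/eqP; rewrite eqEdim subv_cap dU dS /= dSp -ltnS (leq_trans ltU) ?U4.
have vU : p0 + f v \in U by rewrite memvE -bb_f; apply/mU; rewrite ?addvSl.
have aw : points (apt w) by have [] := apoint_affine Th_unit linfE w.
have wmE : (apt w <= m)%VS <-> f w - f v \in bb (ipt d).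
  rewrite (mU _ aw) bb_f -memvE -capU memv_cap (rpredB (f_Sinf w) (f_Sinf v)) andbT.
  have -> : f w - f v = (p0 + f w) - (p0 + f v) by rewrite opprD addrACA subrr add0r.
  by split=> [wU|wvU]; [exact: rpredB | rewrite -(subrK (p0 + f v) (p0 + f w)) rpredD].
rewrite -wmE -memvE; split.
  case=> k wE; apply/memv_addP; exists (row3 1 v.1 v.2 *m invmx Th); first exact: memv_line.
  exists (k *: (row3 0 d.1 d.2 *m invmx Th)); first exact/memvZ/memv_line.
  rewrite scalemxAl -mulmxDl wE /=; congr (_ *m _).
  by rewrite -[row3 1 v.1 v.2]scale1r row3_comb !mul1r mulr0 addr0.
case/memv_addP=> _ /vlineP[c ->] [_ /vlineP[k ->] /(congr1 (mulmx^~ Th))].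
rewrite mulmxDl -!scalemxAl !mulmxKV // row3_comb => /row3_inj[].
rewrite mulr1 mulr0 addr0 => <- w1 w2; exists k; rewrite [w]surjective_pairing.
by rewrite w1 w2 !mul1r.
Qed.

Lemma f_mem k (d : L * L) : d != (0, 0) -> f (scal k d) \in bb (ipt d).
Proof.
move=> d0; rewrite -[f _]subr0 -f00; apply/(f_parallel _ _ d0).
by exists k; rewrite !add0r.
Qed.

Lemma f_mem1 (d : L * L) : d != (0, 0) -> f d \in bb (ipt d).
Proof.
by move=> d0; have := f_mem 1 d0; rewrite /scal !mul1r -surjective_pairing.
Qed.

Lemma mem_bb_ipoint (d : L * L) u : d != (0, 0) ->
  u \in bb (ipt d) <-> exists k, u = f (scal k d).
Proof.
move=> d0; split=> [uB|[k ->]]; last exact: f_mem.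
have [_ /subvP dS] := spread_planes hS (bb_ipoint hbb Th_unit linfE d0).
have [v vE] := f_surj (dS _ uB).
have [k kE] : exists k, v = (0 + k * d.1, 0 + k * d.2).
  by apply/(f_parallel (0, 0) v d0); rewrite f00 subr0 vE.
by exists k; rewrite -vE kE !add0r.
Qed.

Local Notation det x y := (x.1 * y.2 - x.2 * y.1).

Lemma det_neq0 (x y : L * L) : det x y != 0 -> x != (0, 0) /\ y != (0, 0).
Proof.
by move=> xy; split; apply: contraNneq xy => ->; rewrite /= ?mul0r ?mulr0 subrr.
Qed.

(** Parallelogram argument: the defect f (x + y) - f x - f y lies in the spread elements of both
    directions, which meet trivially. *)
Lemma f_add_indep (x y : L * L) : det x y != 0 -> f (x.1 + y.1, x.2 + y.2) = f x + f y.
Proof.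
move=> xy; have [x0 y0] := det_neq0 xy.
apply/eqP; rewrite -subr_eq0; apply/eqP; apply: (ipoint_indep hS hbb Th_unit linfE xy).
  have -> : f (x.1 + y.1, x.2 + y.2) - (f x + f y) =
      (f (x.1 + y.1, x.2 + y.2) - f y) - f x by rewrite opprD addrA addrAC.
  rewrite rpredB //; last exact: f_mem1.
  by apply/(f_parallel _ _ x0); exists 1; rewrite !mul1r [y.1 + _]addrC [y.2 + _]addrC.
rewrite opprD addrA rpredB //; last exact: f_mem1.
by apply/(f_parallel _ _ y0); exists 1; rewrite !mul1r.
Qed.

(** Proportional x and y span no parallelogram; they are compared by expanding f (x + y + z) in two
    ways, with z independent of x. *)
Lemma f_add (x y : L * L) : f (x.1 + y.1, x.2 + y.2) = f x + f y.
Proof.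
have [xy|] := eqVneq (det x y) 0; last exact: f_add_indep.
have [x0|x0] := eqVneq x (0, 0).
  by rewrite x0 f00 !add0r -surjective_pairing.
have [y0|y0] := eqVneq y (0, 0).
  by rewrite y0 f00 !addr0 -surjective_pairing.
have [z xz] : exists z : L * L, det x z != 0.
  have [x1|x1] := eqVneq x.1 0.
    exists (1, 0); rewrite /= mulr0 mulr1 sub0r oppr_eq0.
    by apply: contra x0 => /eqP x2; rewrite [x]surjective_pairing x1 x2.
  by exists (0, 1); rewrite /= mulr0 mulr1 subr0.
have [k k0 yE] : exists2 k, k != 0 & y = scal k x.
  have [x1|x1] := eqVneq x.1 0.
    have x2 : x.2 != 0.
      by apply: contra x0 => /eqP x2; rewrite [x]surjective_pairing x1 x2.
    have y1 : y.1 = 0.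
      by move/eqP: xy; rewrite x1 mul0r sub0r oppr_eq0 mulf_eq0 (negbTE x2) => /eqP.
    exists (y.2 / x.2); last by rewrite /scal x1 mulr0 divfK // [y]surjective_pairing y1.
    apply: contra y0; rewrite mulf_eq0 invr_eq0 (negbTE x2) orbF => /eqP y2.
    by rewrite [y]surjective_pairing y1 y2.
  have y2 : y.2 = y.1 / x.1 * x.2.
    apply: (mulfI x1); apply/eqP; rewrite -subr_eq0 -[X in _ == X]xy; apply/eqP.
    by field.
  exists (y.1 / x.1); last by rewrite /scal divfK // -y2 -surjective_pairing.
  apply: contra y0; rewrite mulf_eq0 invr_eq0 (negbTE x1) orbF => /eqP y1.
  by rewrite [y]surjective_pairing y2 y1 !mul0r.
have yz : det y z != 0.
  have -> : det y z = k * det x z by rewrite yE /=; ring.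
  by rewrite mulf_neq0.
have E1 : f (x.1 + (y.1 + z.1), x.2 + (y.2 + z.2)) = f x + (f y + f z).
  rewrite -f_add_indep // -[in RHS]f_add_indep //=.
  have -> : det x (y.1 + z.1, y.2 + z.2) = det x y + det x z by rewrite /=; ring.
  by rewrite xy add0r.
have [xy0|xy0] := eqVneq (x.1 + y.1, x.2 + y.2) (0, 0).
  have [xy1 xy2] := xy0; move: E1; rewrite !addrA xy1 xy2 !add0r -surjective_pairing.
  by rewrite f00 -{1}[f z]add0r => /addIr <-.
apply: (addIr (f z)); rewrite -addrA -E1 -f_add_indep /= ?addrA //.
have -> : (x.1 + y.1) * z.2 - (x.2 + y.2) * z.1 = (1 + k) * det x z.
  by rewrite yE /=; ring.
rewrite mulf_neq0 //; apply: contra xy0 => /eqP k1; apply/eqP.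
have e (t : L) : t + k * t = 0 by rewrite -{1}[t]mul1r -mulrDl k1 mul0r.
by rewrite yE /= !e.
Qed.

(** Multiplication by c preserves every spread element, so on each direction it acts through a
    factor in L. Additivity on independent x, y forces their factors to agree with that of x + y. *)
Lemma f_homothety (c : F) : exists k : L, forall d : L * L, f (scal k d) = c *: f d.
Proof.
have ex (d : L * L) : exists k : L, c *: f d = f (scal k d).
  have [->|d0] := eqVneq d (0, 0).
    by exists 0; rewrite /scal !mul0r f00 scaler0.
  apply/(mem_bb_ipoint _ d0)/rpredZ; exact: f_mem1.
have same (x y : L * L) (k l : L) : det x y != 0 ->
    c *: f x = f (scal k x) -> c *: f y = f (scal l y) -> k = l.
  move=> xy kE lE; have [j jE] := ex (x.1 + y.1, x.2 + y.2).
  move: jE; rewrite f_add scalerDr kE lE -f_add => /f_inj[] /= e1 e2.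
  have kj : k = j.
    apply: (mulfI xy); apply/eqP; rewrite -subr_eq0; apply/eqP.
    transitivity ((k * x.1 + l * y.1 - j * (x.1 + y.1)) * y.2
                - (k * x.2 + l * y.2 - j * (x.2 + y.2)) * y.1); first by ring.
    by rewrite e1 e2 !subrr !mul0r subrr.
  rewrite kj; apply: (mulfI xy); apply/eqP; rewrite -subr_eq0; apply/eqP.
  transitivity ((k * x.1 + l * y.1 - j * (x.1 + y.1)) * x.2
              - (k * x.2 + l * y.2 - j * (x.2 + y.2)) * x.1); first by rewrite kj; ring.
  by rewrite e1 e2 !subrr !mul0r subrr.
have [k kE] := ex (1, 0); have [l lE] := ex (0, 1).
have kl : k = l by apply: same kE lE; rewrite /= mulr1 mul0r subr0 oner_eq0.
exists k => d; have [->|d0] := eqVneq d (0, 0).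
  by rewrite /scal !mulr0 f00 scaler0.
have [j jE] := ex d; rewrite jE; congr (f (scal _ d)).
have [d2|d2] := eqVneq d.2 0; last first.
  by apply: same kE jE; rewrite /= mul1r mul0r subr0.
rewrite kl; apply: same lE jE; rewrite /= mul0r mul1r sub0r oppr_eq0.
by apply: contra d0 => /eqP d1; rewrite [d]surjective_pairing d1 d2.
Qed.

Lemma f_semilinear : exists sg : {rmorphism F -> L},
  forall c (d : L * L), f (scal (sg c) d) = c *: f d.
Proof.
have [sg sgE] := boolp.choice f_homothety.
have inj (k l : L) : f (k, 0) = f (l, 0) -> k = l by move/f_inj=> [].
have sg10 c : f (sg c, 0) = c *: f (1, 0).
  by rewrite -sgE /scal /= mulr1 mulr0.
have sgD : {morph sg : x y / x + y}.
  move=> c c'; apply: inj; rewrite sg10 scalerDl -!sg10 -f_add.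
  by rewrite /= addr0.
have sgB : zmod_morphism sg.
  by move=> c c'; apply: (addIr (sg c')); rewrite -sgD !subrK.
have sgM : monoid_morphism sg.
  split=> [|c c']; apply: inj; rewrite sg10 ?scale1r //.
  by rewrite -scalerA -sg10 -sgE /scal /= mulr0.
pose sgR : {rmorphism F -> L} := HB.pack sg (GRing.isZmodMorphism.Build F L sg sgB)
  (GRing.isMonoidMorphism.Build F L sg sgM).
by exists sgR => c d; exact: sgE.
Qed.
End LinearChart.

(** * Coordinates for the subplane *)

Section TraceKernel.
Variables (F : finFieldType) (L : fieldExtType F).
Hypothesis hL : \dim {:L} = 3%N.

Lemma exists_not_fixed : exists d : L, cj 1 d != d.
Proof.
apply/not_existsP=> fixL; have f0 : forall i : 'I_3, [:: -1; 1; 0]`_i = 0 :> L.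
  apply: (cj_free hL (c := fun i => [:: -1; 1; 0]`_(nat_of_ord i))) => x.
  rewrite !big_ord_recl big_ord0 /= addr0 mul0r addr0 cj0.
  rewrite (_ : lift ord0 ord0 = 1); last exact/val_inj.
  by have /negP := fixL x; rewrite negbK => /eqP->; rewrite mulN1r mul1r addNr.
by move/eqP: (f0 0); rewrite /= oppr_eq0 oner_eq0.
Qed.

Lemma not_indep (x y : L) : y != 0 -> ~~ indep x y -> exists c : F, x = c *: y.
Proof.
move=> y0; rewrite negbK => /eqP xy.
have [c cE] : exists c : F, x / y = c%:A.
  apply: cj_fixed; rewrite rmorphM fmorphV /=.
  apply/eqP; rewrite (eqr_div _ _ _ y0) ?cj_eq0 //; exact/eqP.
by exists c; rewrite -mulr_algl -cE divfK.
Qed.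

(** The map y -> Tr (r y) is nonzero by independence of the conjugates and has values in F, so its
    kernel has dimension 3 - 1 = 2. *)
Lemma trace_kernel (r : L) : r != 0 -> exists x1 x2, indep x1 x2 /\
  forall y, \sum_i cj i (r * y) = 0 <-> exists s t : F, y = s *: x1 + t *: x2.
Proof.
move=> r0; pose tr y := \sum_i cj i (r * y).
have tr_lin : linear tr.
  move=> c x y; rewrite /tr scaler_sumr -big_split; apply: eq_bigr => i _ /=.
  by rewrite mulrDr rmorphD -scalerAr /= cjZ.
pose f : {linear L -> L} := HB.pack tr (GRing.isLinear.Build F L L *:%R tr tr_lin).
pose K := lker (linfun f).
have KE y : (y \in K) = (tr y == 0) by rewrite memv_ker lfunE.
have dK : \dim K = 2%N.
  have := limg_ker_dim (linfun f) fullv; rewrite capfv hL -/K.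
  suff -> : \dim (limg (linfun f)) = 1%N by rewrite addn1 => -[].
  have le1 : (limg (linfun f) <= 1)%VS.
    apply/subvP=> _ /memv_imgP[y _ ->]; rewrite lfunE /=.
    have [c ->] : exists c : F, tr y = c%:A.
      apply: cj_fixed; rewrite /tr rmorph_sum [RHS](reindex (fun i => 1 + i)) /=; last first.
        by exists (fun i => - 1 + i) => i _; rewrite ?addKr ?addNKr.
      by apply: eq_bigr => i _; rewrite (cjD hL).
    by apply/vlineP; exists c.
  have := dimvS le1; rewrite dimv1 => d1; apply/eqP; rewrite eqn_leq d1 lt0n dimv_eq0 /=.
  apply/eqP=> im0; have tr0 y : tr y = 0.
    apply/eqP; rewrite -memv0 -im0; have := memv_img (linfun f) (memvf y).
    by rewrite lfunE.
  have /(_ 0)/eqP : forall i, cj i r = 0.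
    apply: (cj_free hL) => x; rewrite -[RHS](tr0 x).
    by apply: eq_bigr => i _; rewrite rmorphM.
  by rewrite cj0 (negbTE r0).
have Kb := coord_vbasis; have Kf := basis_free (vbasisP K).
move: (vbasis K) (vbasisP K) Kf; rewrite dK => X Xb Xf.
have [x1 [x2 XE]] : exists x1 x2, X = [tuple x1; x2].
  by case/tupleP: X Xb Xf => x1 X _ _; case/tupleP: X => x2 X; exists x1, x2;
    rewrite [X]tuple0; exact/val_inj.
rewrite XE in Xb Xf; exists x1, x2; split.
  have x20 : x2 != 0.
    by move: Xf; rewrite /= free_cons => /andP[_]; rewrite seq1_free.
  have [//|/(not_indep x20)[c x1E]] := boolP (indep x1 x2).
  by move: Xf; rewrite /= free_cons span_seq1 x1E memvZ ?memv_line.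
move=> y; rewrite -(span_basis Xb) /= in KE.
have -> : (\sum_i cj i (r * y) = 0) <-> (y \in <<[:: x1; x2]>>%VS).
  by rewrite KE; split=> /eqP.
rewrite span_cons span_seq1; split.
  by case/memv_addP=> _ /vlineP[s ->] [_ /vlineP[t ->] ->]; exists s, t.
by case=> s [t ->]; rewrite memv_add ?memvZ ?memv_line.
Qed.

(** The vector y (x, x_1, x_2) - x (y, y_1, y_2) spans the point at infinity of the line joining x
    and y. Its second coordinate is this D, and its third is - D^(q^2). *)
Definition conj_det (x y : L) := y * cj 1 x - x * cj 1 y.

Lemma norm_one_cj2 (D : L) : D != 0 -> norm_one (cj 2 D / D).
Proof.
move=> D0; exists (D * cj 1 D); first by rewrite mulf_neq0 ?cj_eq0.
have D1 : cj 1 D != 0 by rewrite cj_eq0.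
by rewrite rmorphM /= (cjD hL) ord11; field; rewrite D0 D1.
Qed.

(** Replacing (1, d) by (t, t d) multiplies the determinant by t^(q+1), hence the ratio by w^(q-1)
    with w = t^q. Every element of norm 1 is such a factor, so every u is reached. *)
Lemma norm_one_conj_det (u : L) : norm_one u ->
  exists x y : L, indep x y /\ u = cj 2 (conj_det x y) / conj_det x y.
Proof.
move=> uN; have [d d1] := exists_not_fixed.
have D0 : conj_det 1 d != 0 by rewrite /conj_det rmorph1 mulr1 mul1r subr_eq0 eq_sym.
have [w w0 uw] := norm_oneV uN (norm_one_cj2 D0).
have [t tw] := cj_surj hL 1 w.
have t0 : t != 0 by rewrite -(cj_eq0 1) tw.
have tD : conj_det t (t * d) = t * cj 1 t * conj_det 1 d.
  by rewrite /conj_det rmorphM rmorph1 /=; ring.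
exists t, (t * d); split.
  rewrite /indep -subr_eq0 mulrC -/(conj_det t (t * d)) tD.
  by rewrite !mulf_neq0 ?cj_eq0.
have c0 : cj 2 (conj_det 1 d) / conj_det 1 d != 0.
  by rewrite mulf_neq0 ?invr_eq0 ?cj_eq0.
rewrite tD !rmorphM /= (cjD hL) ord21 cj0 -[LHS](divfK c0) uw -tw (cjD hL) ord11.
move: (conj_det 1 d) D0 => D D0; have t1 : cj 1 t != 0 by rewrite cj_eq0.
by field; rewrite D0 t0 t1.
Qed.
End TraceKernel.

(** * Collineations and conjugation of subspaces *)

Section Collineations.
Variables (F : finFieldType) (L : fieldExtType F).
Hypothesis hL : \dim {:L} = 3%N.

Lemma mem_pgl_act (K : fieldType) n (A : 'M[K]_n) U v : A \in unitmx ->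
  (v \in pgl_act A U) = (v *m invmx A \in U).
Proof.
move=> Au; apply/memv_imgP/idP=> [[u uU ->]|vU].
  by rewrite lfunE /= mulmxK.
by exists (v *m invmx A); rewrite // lfunE /= mulmxKV.
Qed.

Lemma pgl_act_line (K : fieldType) n (A : 'M[K]_n) v : A \in unitmx ->
  pgl_act A <[v]>%VS = <[v *m A]>%VS.
Proof. by move=> _; rewrite /pgl_act limg_line lfunE. Qed.

Lemma ext_line n (x : 'rV[F]_n) : ext L <[x]>%VS = <[map_mx (in_alg L) x]>%VS.
Proof. by rewrite -span_seq1 /ext map_vs_span /= span_seq1. Qed.

(** [cj 2] is the inverse of Frobenius, so membership in the image is tested by pulling back. *)
Lemma mem_frob n (U : {vspace 'rV[L]_n}) v :
  (v \in frob U) = (map_mx (cj 2) v \in U).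
Proof.
have frobE : frob U = map_vs (cj 1) U.
  by rewrite /frob; congr (map_vs _ U); apply/funext=> x; rewrite cj1E.
have cjK (i j : 'I_3) (w : 'rV[L]_n) : i + j = 0 -> map_mx (cj i) (map_mx (cj j) w) = w.
  by move=> ij; apply/rowP=> l; rewrite !mxE (cjD hL) ij cj0.
rewrite frobE; apply/idP/idP=> vU; last by rewrite -(cjK 1 2 v ord12) mem_map_vs.
have := mem_map_vs (cj 2) vU; rewrite {2}/map_vs map_vs_span -map_comp.
rewrite (eq_map (_ : _ =1 id)) ?map_id ?(span_basis (vbasisP U)) // => w.
exact: cjK ord21.
Qed.

Lemma mem_conjugate (A : 'M[L]_3) U v : A \in unitmx ->
  (v \in Defs.conjugate A U) = (map_mx (cj 2) (v *m invmx A) *m A \in U).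
Proof.
move=> Au; rewrite /Defs.conjugate mem_pgl_act // mem_frob mem_pgl_act ?unitmx_inv //.
by rewrite invmxK.
Qed.
End Collineations.

(** The equation is the coordinate along a vector w outside U, in a basis extending one of U. *)
Lemma hyperplane_equation (K : fieldType) (U : {vspace 'rV[K]_3}) : lines U ->
  exists c : 'cV[K]_3, forall v, (v \in U) = ((v *m c) 0 0 == 0).
Proof.
move=> U2; have [w wU] : exists w, w \notin U.
  apply/not_existsP=> allU; suff : (fullv <= U)%VS.
    by move/dimvS; rewrite U2 dimvf.
  by apply/subvP=> v _; have /negP := allU v; rewrite negbK.
have Ub := vbasisP U; have := basis_free Ub; have := span_basis Ub.
move: (vbasis U); rewrite U2 => X XU Xf.
have wXf : free (w :: X) by rewrite free_cons XU wU.
have full v : v \in <<w :: X>>%VS.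
  suff -> : <<w :: X>>%VS = fullv by exact: memvf.
  apply/eqP; rewrite eqEdim subvf dimvf /=.
  by move: wXf; rewrite /free => /eqP->; rewrite /= size_tuple.
pose Y := [tuple of w :: X]; pose f := coord Y ord0.
exists (\col_i f (delta_mx 0 i)) => v.
have -> : (v *m \col_i f (delta_mx 0 i)) 0 0 = f v.
  rewrite mxE [in RHS](row_sum_delta v) /f linear_sum; apply: eq_bigr => i _.
  by rewrite mxE linearZ.
have vE := coord_span (X := Y) (full v).
rewrite big_ord_recl /= in vE.
have restU : \sum_(i < 2) coord Y (lift ord0 i) v *: (w :: X)`_(lift ord0 i) \in U.
  apply: memv_suml => i _; apply: memvZ; rewrite -XU; apply: memv_span.
  by rewrite lift0 /= mem_nth // size_tuple ltn_ord.
apply/idP/eqP=> [vU|f0]; last by rewrite vE -/f f0 scale0r add0r.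
apply/eqP/negPn/negP=> f0; move/negP: wU; apply.
rewrite -[w](scalerK f0) rpredZ //.
rewrite -(addrK (\sum_(i < 2) coord Y (lift ord0 i) v *: (w :: X)`_(lift ord0 i)) (f v *: w)).
by rewrite -vE rpredB.
Qed.

(** * Conjugate coordinates for the subplane *)

Section SubplaneCoordinates.
Variables (F : finFieldType) (L : fieldExtType F).
Hypothesis hL : \dim {:L} = 3%N.
Variables (linf : {vspace 'rV[L]_3}) (A : 'M[L]_3) (c : 'cV[L]_3).
Hypothesis Au : A \in unitmx.
Hypothesis linf_c : forall v, (v \in linf) = ((v *m c) 0 0 == 0).
Hypothesis A_ext : exterior (subplane_of A) linf.

Local Notation emb := (map_mx (in_alg L)).

(** The equation of linf evaluated on pi. As pi is exterior this is injective, hence an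
    F-isomorphism from F^3 onto L, which identifies pi with the nonzero elements of L up to factors
    in F. *)
Definition xi (x : 'rV[F]_3) : L := (emb x *m (A *m c)) 0 0.

Lemma xiE x : xi x = \sum_i x 0 i *: (A *m c) i 0.
Proof. by rewrite /xi mxE; apply: eq_bigr => i _; rewrite mxE mulr_algl. Qed.

Fact xi_is_linear : linear xi.
Proof.
move=> k x y; rewrite !xiE scaler_sumr -big_split; apply: eq_bigr => i _ /=.
by rewrite !mxE scalerDl scalerA.
Qed.
HB.instance Definition _ := GRing.isLinear.Build F 'rV[F]_3 L _ xi xi_is_linear.

Lemma pgl_act_point (x : 'rV[F]_3) : pgl_act A (ext L <[x]>%VS) = <[emb x *m A]>%VS.
Proof. by rewrite ext_line pgl_act_line. Qed.

Lemma xi_eq0 x : xi x = 0 -> x = 0.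
Proof.
move=> x0; apply/eqP/negPn/negP=> xn0.
apply: (A_ext (P := pgl_act A (ext L <[x]>%VS))).
  by exists <[x]>%VS; rewrite // /points /= dim_vline xn0.
by rewrite pgl_act_point -memvE linf_c -mulmxA -/(xi x) x0.
Qed.

Lemma xi_surj y : exists x, xi x = y.
Proof.
suff /memv_imgP[x _ ->] : y \in limg (linfun xi) by exists x; rewrite lfunE.
suff -> : limg (linfun xi) = fullv by exact: memvf.
apply/eqP; rewrite eqEdim subvf hL limg_dim_eq ?dimvf //.
apply/eqP; rewrite capfv -subv0; apply/subvP=> x; rewrite memv_ker lfunE /= memv0.
by move=> /eqP/xi_eq0->.
Qed.

(* Column j is the equation of the j-th conjugate of linf, so coord_mx is the change
   to coordinates in which linf and its conjugates are the coordinate lines. *)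
Definition conj_mx : 'M[L]_3 := \matrix_(i, j) cj j ((A *m c) i 0).

Lemma mulmx_conj (x : 'rV[F]_3) :
  emb x *m conj_mx = row3 (xi x) (cj 1 (xi x)) (cj 2 (xi x)).
Proof.
rewrite [LHS]row3E; suff E j : (emb x *m conj_mx) 0 j = cj j (xi x).
  by rewrite !E cj0.
rewrite mxE xiE rmorph_sum; apply: eq_bigr => i _.
by rewrite !mxE mulr_algl /= cjZ.
Qed.

(** A relation between the columns would be one between the conjugates, since [xi] is onto. *)
Lemma conj_mx_unit : conj_mx \in unitmx.
Proof.
rewrite -unitmx_tr -row_free_unit; apply: inj_row_free => v v0.
suff vi i : v 0 i = 0 by apply/rowP=> i; rewrite vi mxE.
apply: (cj_free hL (c := v 0)) => y; have [x <-] := xi_surj y.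
have := congr1 (fun w => (emb x *m w^T) 0 0) v0.
rewrite trmx_mul trmxK mulmxA trmx0 mulmx0 [RHS]mxE mulmx_conj => E.
rewrite -[RHS]E mxE; apply: eq_bigr => l _; rewrite !mxE mulrC; congr (_ * _).
by case: (ord3P l) => ->; rewrite ?cj0.
Qed.

Definition coord_mx : 'M[L]_3 := invmx A *m conj_mx.

Lemma coord_mx_unit : coord_mx \in unitmx.
Proof. by rewrite unitmx_mul unitmx_inv Au conj_mx_unit. Qed.

Lemma linf_coord v : (v \in linf) = ((v *m coord_mx) 0 0 == 0).
Proof.
have vc : v *m c = v *m invmx A *m (A *m c) by rewrite mulmxA mulmxKV.
rewrite linf_c vc /coord_mx [in RHS]mulmxA; congr (_ == _).
rewrite mxE [RHS]mxE; apply: eq_bigr => i _.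
by congr (_ * _); rewrite [RHS]mxE cj0.
Qed.

Definition spoint (y : L) := hpoint coord_mx y (cj 1 y) (cj 2 y).

Lemma pgl_act_spoint x : pgl_act A (ext L <[x]>%VS) = spoint (xi x).
Proof.
rewrite pgl_act_point /spoint /hpoint -mulmx_conj.
by rewrite -(mulmxK coord_mx_unit (emb x *m A)) !mulmxA mulmxK.
Qed.

Lemma subplane_spoint P : subplane_of A P <-> exists2 y, y != 0 & P = spoint y.
Proof.
split.
  case=> Q dQ <-; have x0 : vpick Q != 0 by rewrite vpick0 -dimv_eq0 dQ.
  have -> : Q = <[vpick Q]>%VS.
    by apply/esym/eqP; rewrite eqEdim -memvE memv_pick dQ dim_vline x0.
  by exists (xi (vpick Q)); [apply: contra x0 => /eqP/xi_eq0-> | rewrite pgl_act_spoint].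
case=> y y0 ->; have [x xE] := xi_surj y; rewrite -xE -pgl_act_spoint.
exists <[x]>%VS => //; rewrite /points /= dim_vline; case: eqP => // x0.
by move: y0; rewrite -xE x0 linear0 eqxx.
Qed.

Lemma spoint_line x y : indep x y -> exists2 m, extended_line (subplane_of A) m &
  (ipoint coord_mx (conj_det x y, - cj 2 (conj_det x y)) <= m)%VS /\
  forall P, subline (subplane_of A) m P <->
    exists s t : F, (s, t) <> (0, 0) /\ P = spoint (s *: x + t *: y).
Proof.
move=> ind; pose rv z := row3 z (cj 1 z) (cj 2 z) *m invmx coord_mx.
have x0 : x != 0 by apply: contraNneq ind => ->; rewrite rmorph0 !mul0r.
have y0 : y != 0 by apply: contraNneq ind => ->; rewrite rmorph0 !mulr0.
have rvD (s t : F) : rv (s *: x + t *: y) = s%:A *: rv x + t%:A *: rv y.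
  rewrite /rv !scalemxAl -mulmxDl row3_comb; congr (row3 _ _ _ *m _);
  by rewrite ?rmorphD /= ?cjZ !mulr_algl.
have spx z : spoint z = <[rv z]>%VS by [].
pose m := (spoint x + spoint y)%VS.
have mem v : v \in m <-> exists k l, v *m coord_mx =
    row3 (k * x + l * y) (k * cj 1 x + l * cj 1 y) (k * cj 2 x + l * cj 2 y).
  split.
    case/memv_addP=> _ /vlineP[k ->] [_ /vlineP[l ->] ->]; exists k, l.
    rewrite -row3_comb mulmxDl -!scalemxAl !mulmxKV ?coord_mx_unit //.
  case=> k [l E]; apply/memv_addP; exists (k *: rv x); first exact/memvZ/memv_line.
  exists (l *: rv y); first exact/memvZ/memv_line.
  by rewrite -(mulmxK coord_mx_unit v) E -row3_comb mulmxDl !scalemxAl.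
have dne : ldet (conj_form x y 1) (conj_form x y 2) != 0 by exact: ldet_conj.
(* Conjugating the first two equations shows that the conjugates of k and l solve the last two. By
   Cramer's rule they equal k and l, so points of pi on the line have coefficients in F. *)
have fixed (k l z : L) : k * x + l * y = z -> k * cj 1 x + l * cj 1 y = cj 1 z ->
    k * cj 2 x + l * cj 2 y = cj 2 z -> cj 1 k = k /\ cj 1 l = l.
  move=> e0 e1 e2; have f1 := congr1 (cj 1) e0; have f2 := congr1 (cj 1) e1.
  move: f1 f2; rewrite !rmorphD !rmorphM /= !(cjD hL) ord11 -e2 -e1 => f1 f2.
  split; apply: (mulfI dne); apply/eqP; rewrite -subr_eq0; apply/eqP;
    rewrite /ldet /=.
    transitivity ((cj 1 k * cj 1 x + cj 1 l * cj 1 y - (k * cj 1 x + l * cj 1 y)) * cj 2 y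
      - (cj 1 k * cj 2 x + cj 1 l * cj 2 y - (k * cj 2 x + l * cj 2 y)) * cj 1 y).
      by ring.
    by rewrite f1 f2 !subrr !mul0r subrr.
  transitivity ((cj 1 k * cj 2 x + cj 1 l * cj 2 y - (k * cj 2 x + l * cj 2 y)) * cj 1 x
    - (cj 1 k * cj 1 x + cj 1 l * cj 1 y - (k * cj 1 x + l * cj 1 y)) * cj 2 x).
    by ring.
  by rewrite f1 f2 !subrr !mul0r subrr.
have dxy : spoint x <> spoint y.
  move=> E; have : rv x \in spoint y by rewrite -E memv_line.
  case/vlineP=> k /(congr1 (mulmx^~ coord_mx)).
  rewrite -scalemxAl !mulmxKV ?coord_mx_unit // row3Z => /row3_inj[xk x1k _].
  by move/eqP: ind; apply; rewrite x1k xk; ring.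
have pxy z : z != 0 -> points (spoint z).
  by move=> z0; apply: (hpoint_points coord_mx_unit); rewrite (negbTE z0).
have m2 : lines m.
  have := dimv_sum_cap (spoint x) (spoint y); rewrite /lines /= -/m !pxy //.
  suff -> : (spoint x :&: spoint y)%VS = 0%VS by rewrite dimv0 addn0.
  apply/eqP; rewrite -dimv_eq0; move: (dimvS (capvSl (spoint x) (spoint y))).
  rewrite (pxy _ x0) leq_eqVlt ltnS leqn0 => /orP[/eqP c1|//].
  case: dxy; have xy : (spoint x <= spoint y)%VS.
    by apply/capv_idPl/eqP; rewrite eqEdim capvSl (pxy _ x0) c1 leqnn.
  by apply/eqP; rewrite eqEdim xy (pxy _ x0) (pxy _ y0).
exists m.
  split=> //; exists (spoint x), (spoint y); split; rewrite ?addvSl ?addvSr //;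
    apply/subplane_spoint; by [exists x | exists y].
split.
  rewrite -memvE; apply/mem; exists y, (- x).
  rewrite mulmxKV ?coord_mx_unit //; congr row3; rewrite /conj_det /=.
  - by ring.
  - by ring.
  by rewrite rmorphB !rmorphM /= !(cjD hL) ord21 !cj0; ring.
move=> P; split.
  case=> /subplane_spoint[z z0 ->]; rewrite -memvE => /mem[k [l]].
  rewrite mulmxKV ?coord_mx_unit // => /row3_inj[e0 e1 e2].
  have [k1 l1] := fixed k l z (esym e0) (esym e1) (esym e2).
  have [s sE] := cj_fixed k1; have [t tE] := cj_fixed l1.
  rewrite sE tE !mulr_algl in e0.
  exists s, t; split; last by rewrite e0.
  by case=> s0 t0; move: z0; rewrite e0 s0 t0 !scale0r addr0 eqxx.
case=> s [t [st ->]]; have z0 := indep_neq0 ind st; split.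
  by apply/subplane_spoint; exists (s *: x + t *: y).
by rewrite spx -memvE rvD; apply: memv_add; exact/memvZ/memv_line.
Qed.
End SubplaneCoordinates.

(** * Special conics as trace equations *)

Section SpecialConic.
Variables (F : finFieldType) (L : fieldExtType F).
Hypothesis hL : \dim {:L} = 3%N.
Variables (linf : {vspace 'rV[L]_3}) (A : 'M[L]_3) (c : 'cV[L]_3).
Hypothesis Au : A \in unitmx.
Hypothesis linf_c : forall v, (v \in linf) = ((v *m c) 0 0 == 0).
Hypothesis A_ext : exterior (subplane_of A) linf.

Local Notation emb := (map_mx (in_alg L)).
Local Notation Om := (conj_mx A c).
Local Notation Th := (coord_mx A c).

(** Column i + 1 of [conj_mx] is the conjugate of column i, so conjugation shifts the coordinate
    lines. *)
Lemma conjugate_coord (U : {vspace 'rV[L]_3}) i :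
  (forall v, (v \in U) = ((v *m Th) 0 i == 0)) ->
  forall v, (v \in Defs.conjugate A U) = ((v *m Th) 0 (i + 1) == 0).
Proof.
move=> Ui v; rewrite (mem_conjugate hL) // Ui /coord_mx !mulmxA mulmxK //.
move: (v *m invmx A) => w; rewrite -(cj_eq0 2 ((w *m Om) 0 (i + 1))).
congr (_ == _); rewrite !mxE rmorph_sum; apply: eq_bigr => l _ /=.
by rewrite !mxE rmorphM /= (cjD hL) addrCA ord21 addr0.
Qed.

(** Conjugating the inverse and shifting its indices gives a left inverse again. *)
Lemma cj_inv_conj_mx i l : cj 1 (invmx Om i l) = invmx Om (i + 1) l.
Proof.
have Ou := conj_mx_unit hL Au linf_c A_ext.
pose N : 'M[L]_3 := \matrix_(i, l) cj 1 (invmx Om (i - 1) l).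
have NO : N *m Om = 1%:M.
  apply/matrixP=> r s; have := congr1 (fun X : 'M__ => X (r - 1) (s - 1)) (mulVmx Ou).
  rewrite !mxE (inj_eq (addIr (-1))) => E; rewrite -[RHS](rmorph_nat (cj 1)) -E.
  rewrite rmorph_sum; apply: eq_bigr => t _.
  by rewrite !mxE rmorphM /= (cjD hL) [1 + _]addrCA subrr addr0.
have E : invmx Om = N by rewrite -[invmx Om]mul1mx -NO mulmxK.
by rewrite [in RHS]E mxE addrK.
Qed.

Lemma qformZ (K : fieldType) (M : 'M[K]_3) k v : qform M (k *: v) = k ^+ 2 * qform M v.
Proof.
by rewrite /qform -!scalemxAl linearZ /= -scalemxAr scalerA !mxE expr2.
Qed.

Lemma qform_change (K : fieldType) (M N : 'M[K]_3) v :
  qform M (v *m N) = qform (N *m M *m N^T) v.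
Proof. by rewrite /qform trmx_mul !mulmxA. Qed.

Lemma qform_row3 (M : 'M[L]_3) x y z : (forall i, M i i = 0) ->
  qform M (row3 x y z) = (M 0 1 + M 1 0) * (x * y) + (M 2 0 + M 0 2) * (x * z)
    + (M 1 2 + M 2 1) * (y * z).
Proof.
move=> M0; have sum3 (f : 'I_3 -> L) : \sum_i f i = f 0 + f 1 + f 2.
  rewrite !big_ord_recl big_ord0 addr0 addrA.
  by congr (f _ + f _ + f _); exact/val_inj.
rewrite /qform mxE sum3 !mxE !sum3 !mxE /= !M0; ring.
Qed.

(** In conjugate coordinates the three prescribed points are the vertices of the coordinate
    triangle, so the form has no square terms. It comes from F, so its mixed coefficients are
    conjugates of one r, and on pi it equals Tr (r x_1 x_2) = N(x) Tr (r / x). *)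
Lemma special_conic_trace (M : 'M[F]_3) : nonsingular_qform M ->
  (let Cext := [set pgl_act A P | P in qform_points (emb M)] in
   let m := Defs.conjugate A linf in let n := Defs.conjugate A m in
   [/\ Cext (linf :&: m)%VS, Cext (linf :&: n)%VS & Cext (m :&: n)%VS]) ->
  exists2 r : L, r != 0 &
    forall P, [set pgl_act A (ext L P) | P in qform_points M] P <->
      exists y, [/\ y != 0, \sum_i cj i (r * y^-1) = 0 & P = spoint A c y].
Proof.
move=> Mns /=; set m := Defs.conjugate A linf; set n := Defs.conjugate A m.
have Ou := conj_mx_unit hL Au linf_c A_ext.
have lE := linf_coord Au linf_c.
have mE : forall v, (v \in m) = ((v *m Th) 0 1 == 0).
  by move=> v; rewrite (conjugate_coord lE) add0r.
have nE : forall v, (v \in n) = ((v *m Th) 0 2 == 0).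
  by move=> v; rewrite (conjugate_coord mE) ord11.
pose Q : 'M[L]_3 := invmx Om *m emb M *m (invmx Om)^T.
have QE X : qform (emb M) (X *m invmx Om) = qform Q X by rewrite qform_change.
have Qii i E : [set pgl_act A P | P in qform_points (emb M)] E ->
    (delta_mx 0 i *m invmx Om *m A \in E) -> Q i i = 0.
  case=> P [_ Pq] <-; rewrite (mem_pgl_act _ _ Au) mulmxK // => /Pq.
  rewrite QE /qform -rowE mxE (bigD1 i) //= big1 ?addr0 => [|j ji].
    by rewrite !mxE !eqxx mulr1.
  by rewrite !mxE (negbTE ji) andbF mulr0.
have dT i j : (delta_mx 0 i *m invmx Om *m A *m Th) 0 j = (j == i)%:R.
  by rewrite /coord_mx mulmxA mulmxK // mulmxKV // mxE eqxx.
(* The vertices are numbered by their nonzero coordinate. *)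
case=> E2 E1 E0.
have Q0 i : Q i i = 0.
  case: (ord3P i) => ->.
  - by apply: (Qii _ _ E0); rewrite memv_cap mE nE !dT /= eqxx.
  - by apply: (Qii _ _ E1); rewrite memv_cap lE nE !dT /= eqxx.
  by apply: (Qii _ _ E2); rewrite memv_cap lE mE !dT /= eqxx.
have cjQ i j : cj 1 (Q i j) = Q (i + 1) (j + 1).
  rewrite !mxE rmorph_sum; apply: eq_bigr => l _.
  rewrite !mxE rmorphM /= cj_inv_conj_mx; congr (_ * _).
  rewrite rmorph_sum; apply: eq_bigr => k _.
  by rewrite rmorphM /= cj_inv_conj_mx !mxE cj_alg.
pose r := Q 1 2 + Q 2 1.
have r1 : cj 1 r = Q 2 0 + Q 0 2 by rewrite rmorphD /= !cjQ ord11 ord21.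
have r2 : cj 2 r = Q 0 1 + Q 1 0.
  by rewrite -ord11 -(cjD hL) r1 rmorphD /= !cjQ ord21 !add0r.
have qxi x : (qform M x)%:A = cj 2 r * (xi A c x * cj 1 (xi A c x))
   + cj 1 r * (xi A c x * cj 2 (xi A c x)) + r * (cj 1 (xi A c x) * cj 2 (xi A c x)).
  rewrite r1 r2 -qform_row3 // -mulmx_conj -QE mulmxK //.
  by rewrite /qform matrix.map_trmx -!map_mxM [RHS]mxE.
(* For r = 0 the form would vanish on all of F^3, against nonsingularity at the all-ones vector. *)
have r0 : r != 0.
  apply/eqP=> r0; have q0 x : qform M x = 0.
    apply: (@fmorph_inj _ _ (in_alg L)); rewrite /= qxi r0 !rmorph0 scale0r; ring.
  have /(Mns (const_mx 1) (q0 _))/rowP/(_ 0) : forall w, qform M (const_mx 1 + w) =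
      qform M (const_mx 1) + qform M w by move=> w; rewrite !q0 addr0.
  by rewrite !mxE => /eqP; rewrite oner_eq0.
exists r => // P.
have qtr x : xi A c x != 0 ->
    (qform M x == 0) = (\sum_i cj i (r * (xi A c x)^-1) == 0).
  move=> x0; have x1 : cj 1 (xi A c x) != 0 by rewrite cj_eq0.
  have x2 : cj 2 (xi A c x) != 0 by rewrite cj_eq0.
  have -> : (qform M x == 0) = ((qform M x)%:A == 0 :> L).
    by rewrite scaler_eq0 oner_eq0 orbF.
  rewrite qxi !big_ord_recl big_ord0 /= addr0 cj0.
  rewrite (_ : lift ord0 ord0 = 1); last exact/val_inj.
  rewrite (_ : lift ord0 _ = 2); last exact/val_inj.
  rewrite !rmorphM /= !fmorphV /=.
  move: (xi A c x) (cj 1 _) (cj 2 _) (cj 1 r) (cj 2 r) x0 x1 x2 => a b d s t a0 b0 d0.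
  have -> : t * (a * b) + s * (a * d) + r * (b * d) =
      a * b * d * (r / a + (s / b + t / d)) by field; rewrite a0 b0 d0.
  by rewrite !mulf_eq0 (negbTE a0) (negbTE b0) (negbTE d0).
split.
  case=> R [dR Rq] <-; have x0 : vpick R != 0 by rewrite vpick0 -dimv_eq0 dR.
  have xn0 : xi A c (vpick R) != 0.
    by apply: contra x0 => /eqP/(xi_eq0 Au linf_c A_ext)->.
  exists (xi A c (vpick R)); split=> //.
    by apply/eqP; rewrite -qtr //; apply/eqP/Rq; exact: memv_pick.
  rewrite -(pgl_act_spoint hL Au linf_c A_ext); congr (pgl_act A (ext L _)).
  by apply/esym/eqP; rewrite eqEdim -memvE memv_pick dR dim_vline x0.
case=> y [y0 ytr ->]; have [x xE] := xi_surj hL Au linf_c A_ext y.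
rewrite -xE -(pgl_act_spoint hL Au linf_c A_ext); exists <[x]>%VS => //; split.
  rewrite /points /= dim_vline; case: eqP => // x0.
  by move: y0; rewrite -xE x0 linear0 eqxx.
move=> _ /vlineP[k ->]; rewrite qformZ.
have /eqP-> : qform M x == 0 by rewrite qtr xE // ytr.
by rewrite mulr0.
Qed.
End SpecialConic.

(** * The image of a special conic in the Bruck-Bose coordinates *)

Lemma line_uniq (K : fieldType) n (l m P Q : {vspace 'rV[K]_n}) :
  lines l -> lines m -> points P -> points Q -> P <> Q ->
  (P <= l)%VS -> (Q <= l)%VS -> (P <= m)%VS -> (Q <= m)%VS -> l = m.
Proof.
move=> dl dm dP dQ PQ Pl Ql Pm Qm.
have dPQ : \dim (P + Q) = 2%N.
  have := dimv_sum_cap P Q; rewrite dP dQ.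
  suff -> : (P :&: Q)%VS = 0%VS by rewrite dimv0 addn0.
  apply/eqP; rewrite -dimv_eq0; move: (dimvS (capvSl P Q)).
  rewrite dP leq_eqVlt ltnS leqn0 => /orP[/eqP c1|//].
  case: PQ; have PsQ : (P <= Q)%VS.
    by apply/capv_idPl/eqP; rewrite eqEdim capvSl dP c1 leqnn.
  by apply/eqP; rewrite eqEdim PsQ dP dQ.
have E (N : {vspace 'rV[K]_n}) : lines N -> (P <= N)%VS -> (Q <= N)%VS -> (P + Q)%VS = N.
  by move=> dN PN QN; apply/eqP; rewrite eqEdim subv_add PN QN dPQ dN.
by rewrite -(E l) // -(E m).
Qed.

Theorem theorem3p5 (F : finFieldType) (L : fieldExtType F)
    (linf : {vspace 'rV[L]_3}) (Sinf : {vspace 'rV[F]_7})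
    (S : set {vspace 'rV[F]_7})
    (bb : {vspace 'rV[L]_3} -> {vspace 'rV[F]_7})
    (pi : set {vspace 'rV[L]_3}) (CC : set {vspace 'rV[F]_7})
    (hL : \dim {:L} = 3%N)
    (hlinf : lines linf) (hSinf : hyperplanes Sinf)
    (hS : regular_spread Sinf S) (hbb : bruck_bose linf Sinf S bb)
    (hpi : order_q_subplane pi) (hext : exterior pi linf)
    (hCC : conic_cover linf Sinf S bb pi CC) :
  forall C : set {vspace 'rV[L]_3}, special_conic pi linf C ->
    exists B : 'M[F]_(4, 7),
      special_twisted_cubic L Sinf CC B /\ cubic_points B = bb_set bb C.
Proof.
move=> C [A [M [Au piE Mns CE Cext]]]; rewrite piE in hext.
have [c linf_c] := hyperplane_equation hlinf.
pose Th := coord_mx A c.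
have Thu : Th \in unitmx := coord_mx_unit hL Au linf_c hext.
have lE := linf_coord Au linf_c.
have [p0 [f [p0S fS f00 bbf]]] := bb_chart_exists hSinf hbb Thu lE.
have fadd := f_add hS hbb Thu lE fS f00 bbf.
have finj := f_inj hbb Thu lE bbf.
have [sg sgE] := f_semilinear hS hbb Thu lE p0S fS f00 bbf.
have [tau [tau_surj tau_sg]] := extend_morphism sg hL.
have tauZ (s : F) x : tau (s *: x) = sg s * tau x.
  by rewrite -mulr_algl rmorphM /= tau_sg.
have tau_cj i x : tau (cj i x) = cj i (tau x) by rewrite /cj rmorphXn.
have tau0 x : (tau x == 0) = (x == 0) by exact: fmorph_eq0.
have tau_inj : injective tau by exact: fmorph_inj.
(* Composing with [tau], which extends [sg], turns the semilinear f into an F-linear map. *)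
pose e x y := f (tau x, tau y).
have [G [H fr]] : exists G H, frame Sinf p0 e G H.
  apply: (exists_frame hL) => //.
  - move=> s x y x' y'; rewrite /e -sgE -fadd /scal /=.
    by rewrite !rmorphD /= !tauZ.
  - move=> x y; rewrite /e -f00 => /finj[/eqP + /eqP].
    by rewrite !tau0 => /eqP-> /eqP->.
  - move=> v; split=> [vS|[x [y ->]]]; last exact: fS.
    have [[a b] <-] := f_surj hbb Thu lE p0S fS bbf vS.
    have [x <-] := tau_surj a; have [y <-] := tau_surj b.
    by exists x, y.
pose pp y := spoint A c (tau y).
have pi_pp P : pi P <-> exists2 y, y != 0 & P = pp y.
  rewrite piE (subplane_spoint hL Au linf_c hext).
  split=> -[y y0 ->]; last by exists (tau y); rewrite ?tau0.
  have [x xy] := tau_surj y; exists x; last by rewrite /pp xy.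
  by rewrite -tau0 xy.
have bb_pp y : y != 0 -> bb (pp y) = <[(p0 + e (cj 1 y / y) (cj 2 y / y))%R]>%VS.
  move=> y0; rewrite /e !rmorphM !fmorphV /= -bbf; congr (bb _).
  have ty0 : tau y != 0 by rewrite tau0.
  rewrite /pp /spoint /apoint /hpoint /= -(vlineZ _ (invr_neq0 ty0)) scalemxAl.
  by rewrite row3Z mulVf // !tau_cj ![(tau y)^-1 * _]mulrC.
have mem_ipoint a b u : (a, b) != (0, 0) ->
    u \in bb (ipoint Th (tau a, tau b)) <-> exists k, u = e (k * a) (k * b).
  move=> ab0; have tab0 : (tau a, tau b) != (0, 0).
    by apply: contra ab0 => /eqP[/eqP + /eqP]; rewrite !tau0 => /eqP-> /eqP->.
  rewrite (mem_bb_ipoint hS hbb Thu lE p0S fS f00 bbf) //.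
  split=> -[k ->]; last by exists (tau k); rewrite /e !rmorphM.
  by have [j <-] := tau_surj k; exists j; rewrite /e /scal !rmorphM.
have tau_indep (x y : L) : indep x y -> indep (tau x) (tau y).
  by apply: contra => /eqP E; rewrite -(inj_eq tau_inj) !rmorphM /= !tau_cj E.
have tau_det x y : conj_det (tau x) (tau y) = tau (conj_det x y).
  by rewrite /conj_det rmorphB !rmorphM /= !tau_cj.
have line_pp (x y : L) : indep x y -> exists2 m, extended_line pi m &
    (ipoint Th (tau (conj_det x y), tau (- cj 2 (conj_det x y))) <= m)%VS /\
    forall P, subline pi m P <->
      exists s t : F, (s, t) <> (0, 0) /\ P = pp (s *: x + t *: y).
  move=> ind; have [m mext [Dm mE]] := spoint_line hL Au linf_c hext (tau_indep _ _ ind).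
  rewrite -piE in mext mE.
  exists m => //; split; first by rewrite rmorphN /= tau_cj -tau_det.
  (* [tau] commutes with conjugation, so [sg] maps F onto the copy of F in L, and F-combinations
     before and after applying [tau] correspond. *)
  have sg_fix s : exists s' : F, sg s = s'%:A.
    by apply: cj_fixed; rewrite -tau_sg -tau_cj cj_alg.
  have fix_sg (s' : F) : exists s : F, sg s = s'%:A.
    have [z zE] := tau_surj s'%:A.
    have [s sE] : exists s : F, z = s%:A.
      by apply: cj_fixed; apply: tau_inj; rewrite tau_cj zE cj_alg.
    by exists s; rewrite -zE sE tau_sg.
  have sg0 s (s' : F) : sg s = s'%:A -> (s == 0) = (s' == 0).
    move=> E; rewrite -(fmorph_eq0 sg) E scaler_eq0 oner_eq0 orbF //.
  move=> P; rewrite mE; split=> -[s [t [st ->]]].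
    have [s' sE] := fix_sg s; have [t' tE] := fix_sg t; exists s', t'; split.
      case=> /eqP + /eqP; rewrite (sg0 _ _ sE) (sg0 _ _ tE) => /eqP s0 /eqP t0.
      by apply: st; rewrite s0 t0.
    by rewrite /pp rmorphD /= !tauZ sE tE !mulr_algl.
  have [s' sE] := sg_fix s; have [t' tE] := sg_fix t; exists s', t'; split.
    case=> /eqP + /eqP; rewrite -(sg0 _ _ sE) -(sg0 _ _ tE) => /eqP s0 /eqP t0.
    by apply: st; rewrite s0 t0.
  by rewrite /pp rmorphD /= !tauZ sE tE !mulr_algl.
have cdet_neq0 (x y : L) : indep x y -> conj_det x y != 0.
  by move=> ind; rewrite /conj_det subr_eq0 mulrC.
have graph_det (D : L) : D != 0 ->
    graph_of e (fun x => - (cj 2 D / D) * x) (bb (ipoint Th (tau D, tau (- cj 2 D)))).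
  move=> D0 v; rewrite mem_ipoint ?xpair_eqE ?(negbTE D0) //.
  split=> -[x ->]; [exists (x * D) | exists (x / D)]; congr (e _ _); by field.
have S_graph B : S B ->
    (exists k, graph_of e (fun x => k * x) B) \/ (forall y, e 0 y \in B).
  case: (bb_infinity hbb) => _ _ bS /bS[P /= [dP Pl] <-].
  have [[a' b'] ab0 ->] := infinite_ipoint Thu lE dP Pl.
  have [a aE] := tau_surj a'; have [b bE] := tau_surj b'; rewrite -aE -bE.
  have ab : (a, b) != (0, 0).
    by apply: contra ab0 => /eqP[a0 b0]; rewrite -aE -bE a0 b0 !rmorph0.
  have [a0|a0] := eqVneq a 0.
    right=> y; apply/mem_ipoint => //; exists (y / b); rewrite a0 mulr0 divfK //.
    by move: ab; rewrite a0 xpair_eqE eqxx.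
  left; exists (b / a) => v; rewrite mem_ipoint //.
  by split=> -[x ->]; [exists (x * a) | exists (x / a)]; congr (e _ _); field.
have graph_S k : exists2 B, S B & graph_of e (fun x => k * x) B.
  exists (bb (ipoint Th (tau 1, tau k))).
    apply: (bb_ipoint hbb Thu lE); rewrite xpair_eqE rmorph1 oner_eq0 //.
  move=> v; rewrite mem_ipoint ?xpair_eqE ?oner_eq0 //.
  by split=> -[x ->]; exists x; rewrite mulr1 mulrC.
have splash_graph B : (bb @` splash pi linf) B ->
    exists2 u : L, norm_one u & graph_of e (fun x => - u * x) B.
  case=> P [dP Pl [m [m2 [R1 [R2 [/pi_pp[y1 y10 ->] /pi_pp[y2 y20 ->] R12 R1m R2m]]]] Pm]] <-.
  have ind : indep y1 y2.
    have [//|/(not_indep y20)[k yE]] := boolP (indep y1 y2); case: R12.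
    rewrite yE /pp tauZ /spoint /hpoint !rmorphM /=.
    have k0 : sg k != 0.
      by move: y10; rewrite yE scaler_eq0 negb_or fmorph_eq0 => /andP[].
    rewrite -[RHS](vlineZ _ k0) scalemxAl row3Z -tau_sg -!tau_cj !cj_alg //.
  have [m' [m'2 _] [Dm' m'E]] := line_pp _ _ ind.
  have sp1 : (pp y1 <= m')%VS.
    have /m'E[_ //] : exists s t : F, (s, t) <> (0, 0) /\ pp y1 = pp (s *: y1 + t *: y2).
    exists 1, 0; rewrite scale1r scale0r addr0; split=> // -[/eqP].
    by rewrite oner_eq0.
  have sp2 : (pp y2 <= m')%VS.
    have /m'E[_ //] : exists s t : F, (s, t) <> (0, 0) /\ pp y2 = pp (s *: y1 + t *: y2).
    exists 0, 1; rewrite scale1r scale0r add0r; split=> // -[/eqP].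
    by rewrite oner_eq0.
  have ppP y : y != 0 -> points (pp y).
    by move=> y0; apply: (hpoint_points Thu); rewrite tau0 (negbTE y0).
  have mm' := line_uniq m2 m'2 (ppP _ y10) (ppP _ y20) R12 R1m R2m sp1 sp2.
  have D0 := cdet_neq0 _ _ ind.
  exists (cj 2 (conj_det y1 y2) / conj_det y1 y2); first exact: norm_one_cj2.
  suff -> : P = ipoint Th (tau (conj_det y1 y2), tau (- cj 2 (conj_det y1 y2))).
    exact: graph_det.
  have [dI Il] : points (ipoint Th (tau (conj_det y1 y2), tau (- cj 2 (conj_det y1 y2))))
      /\ (ipoint Th (tau (conj_det y1 y2), tau (- cj 2 (conj_det y1 y2))) <= linf)%VS.
    by apply: (ipoint_infinite Thu lE); rewrite xpair_eqE tau0 (negbTE D0).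
  (* Otherwise m and linf would share two points and coincide, although pi has points on m and is
     exterior. *)
  apply/eqP/negPn/negP=> /eqP nE; rewrite -mm' in Dm'.
  have ml := line_uniq m2 hlinf dP dI nE Pm Dm' Pl Il.
  apply: (hext (pp y1) _); last by rewrite -ml.
  by rewrite -piE; apply/pi_pp; exists y1.
have graph_splash u : norm_one u ->
    exists2 B, (bb @` splash pi linf) B & graph_of e (fun x => - u * x) B.
  move=> /(norm_one_conj_det hL)[x [y [ind ->]]]; have D0 := cdet_neq0 _ _ ind.
  have [m mext [Dm _]] := line_pp _ _ ind.
  pose I := ipoint Th (tau (conj_det x y), tau (- cj 2 (conj_det x y))).
  exists (bb I); last exact: graph_det.
  exists I => //.
  have [dI Il] : points I /\ (I <= linf)%VS.
    by apply: (ipoint_infinite Thu lE); rewrite xpair_eqE tau0 (negbTE D0).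
  by split=> //; exists m.
have [r r0 rE] := special_conic_trace hL Au linf_c hext Mns Cext.
(* The trace condition is pulled back along [tau], because [pp] and e are parametrised by preimages
   under [tau]. *)
have [r' r'E] := tau_surj r.
have r'0 : r' != 0 by rewrite -tau0 r'E.
have [x1 [x2 [ind kerE]]] := trace_kernel hL r'0.
have tau_tr y : \sum_i cj i (r * (tau y)^-1) = tau (\sum_i cj i (r' * y^-1)).
  by rewrite rmorph_sum; apply: eq_bigr => i _; rewrite /= tau_cj rmorphM fmorphV /= r'E.
apply: (special_conic_cubic hL fr hSinf _ S_graph graph_S splash_graph graph_splash
  _ bb_pp _ hCC ind).
- by move=> B /(spread_planes hS)[].
- by move=> y y0; apply/pi_pp; exists y.
- by move=> y1 y2 /line_pp[m mext [_ mE]]; exists m.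
move=> P; rewrite CE rE; split.
  case=> y [y0 ytr ->]; have [z zy] := tau_surj y; move: y0 ytr; rewrite -zy tau0 => z0.
  rewrite tau_tr => /eqP; rewrite tau0 => /eqP/kerE[s [t zE]]; exists s, t; split.
    by case=> s0 t0; move/eqP: zE; rewrite s0 t0 !scale0r addr0 invr_eq0 (negbTE z0).
  by rewrite -zE invrK.
case=> s [t [st ->]]; have z0 := indep_neq0 ind st.
exists (tau (s *: x1 + t *: x2)^-1); split=> //; first by rewrite tau0 invr_eq0.
rewrite tau_tr invrK; apply/eqP; rewrite tau0; apply/eqP/kerE.
by exists s, t.
Qed.
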